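(* Let $B \subseteq \omega$ be a set that is not hyperarithmetical. Then for every set $A \subseteq \omega$ there is an infinite set $H$ with $H \subseteq A$ or $H \subseteq \omega \setminus A$ such that $B$ is not hyperarithmetical in $H$ and moreover $\omega_1^H = \omega_1^{ck}$.
   Context: $\omega_1^{ck}$ is the least non-computable ordinal and $\omega_1^H$ is the least ordinal not computable relative to $H$. $B$ is hyperarithmetical in $H$ iff $B$ is $\Delta^1_1(H)$. *)

(* Defs.v *)
From Stdlib Require Import Arith List.
Import ListNotations.

Definition emptyset : nat -> bool := fun _ => false.

Inductive prf : Type :=
| pzero : prf
| psucc : prf
| pproj : nat -> prf
| porac : prf
| pcomp : prf -> list prf -> prf
| pprec : prf -> prf -> prf
| pmu   : prf -> prf.

Inductive eval (O : nat -> bool) : prf -> list nat -> nat -> Prop :=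
| ev_zero xs : eval O pzero xs 0
| ev_succ xs : eval O psucc xs (S (hd 0 xs))
| ev_proj i xs : eval O (pproj i) xs (nth i xs 0)
| ev_orac xs : eval O porac xs (if O (hd 0 xs) then 1 else 0)
| ev_comp f gs xs ys z :
    evals O gs xs ys -> eval O f ys z -> eval O (pcomp f gs) xs z
| ev_prec0 f g xs y : eval O f xs y -> eval O (pprec f g) (0 :: xs) y
| ev_precS f g n xs r y :
    eval O (pprec f g) (n :: xs) r -> eval O g (n :: r :: xs) y ->
    eval O (pprec f g) (S n :: xs) y
| ev_mu f xs n :
    eval O f (n :: xs) 0 ->
    (forall m, m < n -> exists k, eval O f (m :: xs) (S k)) ->
    eval O (pmu f) xs n
with evals (O : nat -> bool) : list prf -> list nat -> list nat -> Prop :=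
| evs_nil xs : evals O [] xs []
| evs_cons g gs xs y ys :
    eval O g xs y -> evals O gs xs ys -> evals O (g :: gs) xs (y :: ys).

Definition computable_set_in (O X : nat -> bool) : Prop :=
  exists e : prf, forall n, eval O e [n] (if X n then 1 else 0).

Definition computable_rel_in (O : nat -> bool) (R : nat -> nat -> bool) : Prop :=
  exists e : prf, forall x y, eval O e [x; y] (if R x y then 1 else 0).

Definition is_wellorder (D : nat -> bool) (R : nat -> nat -> bool) : Prop :=
  (forall x, D x = true -> R x x = false) /\
  (forall x y z, D x = true -> D y = true -> D z = true ->
      R x y = true -> R y z = true -> R x z = true) /\
  (forall x y, D x = true -> D y = true -> x <> y ->
      R x y = true \/ R y x = true) /\
  (forall x, D x = true ->
      Acc (fun a b => D a = true /\ D b = true /\ R a b = true) x).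

Definition computable_wellorder_in (O : nat -> bool)
    (D : nat -> bool) (R : nat -> nat -> bool) : Prop :=
  computable_set_in O D /\ computable_rel_in O R /\ is_wellorder D R.

Definition order_iso (D : nat -> bool) (R : nat -> nat -> bool)
    (D' : nat -> bool) (R' : nat -> nat -> bool) : Prop :=
  exists f : nat -> nat,
    (forall x, D x = true -> D' (f x) = true) /\
    (forall y, D' y = true -> exists x, D x = true /\ f x = y) /\
    (forall x y, D x = true -> D y = true -> (R x y = true <-> R' (f x) (f y) = true)).

Definition ordinals_below (O1 O2 : nat -> bool) : Prop :=
  forall D R, computable_wellorder_in O1 D R ->
    exists D' R', computable_wellorder_in O2 D' R' /\ order_iso D R D' R'.

(* omega_1^{O1} = omega_1^{O2}: the O1-computable ordinals and the
   O2-computable ordinals coincide (both are initial segments of the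
   ordinals, with suprema omega_1^{O1}, omega_1^{O2}). *)
Definition omega1_eq (O1 O2 : nat -> bool) : Prop :=
  ordinals_below O1 O2 /\ ordinals_below O2 O1.

Inductive term : Type :=
| tvar : nat -> term
| tzero : term
| tsucc : term -> term
| tplus : term -> term -> term
| tmult : term -> term -> term.

Inductive form : Type :=
| fmem : nat -> term -> form
| feq : term -> term -> form
| fneg : form -> form
| fand : form -> form -> form
| for_ : form -> form -> form
| fall : form -> form
| fex : form -> form.

Fixpoint teval (ne : nat -> nat) (t : term) : nat :=
  match t with
  | tvar i => ne i
  | tzero => 0
  | tsucc t => S (teval ne t)
  | tplus a b => teval ne a + teval ne b
  | tmult a b => teval ne a * teval ne b
  end.

Definition ncons (n : nat) (ne : nat -> nat) : nat -> nat :=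
  fun i => match i with 0 => n | S i => ne i end.

Fixpoint sat (ne : nat -> nat) (se : nat -> nat -> bool) (f : form) : Prop :=
  match f with
  | fmem j t => se j (teval ne t) = true
  | feq a b => teval ne a = teval ne b
  | fneg g => ~ sat ne se g
  | fand g h => sat ne se g /\ sat ne se h
  | for_ g h => sat ne se g \/ sat ne se h
  | fall g => forall n, sat (ncons n ne) se g
  | fex g => exists n, sat (ncons n ne) se g
  end.

Definition senv (X H : nat -> bool) : nat -> nat -> bool :=
  fun j => match j with 0 => X | 1 => H | _ => emptyset end.

Definition sigma11_in (H B : nat -> bool) : Prop :=
  exists phi : form, forall n,
    B n = true <-> exists X : nat -> bool, sat (ncons n (fun _ => 0)) (senv X H) phi.

(* B is hyperarithmetical in H iff B is Delta^1_1(H). *)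
Definition hyp_in (H B : nat -> bool) : Prop :=
  sigma11_in H B /\ sigma11_in H (fun n => negb (B n)).

Definition hyperarithmetical (B : nat -> bool) : Prop := hyp_in emptyset B.

Definition infinite_set (H : nat -> bool) : Prop :=
  forall m, exists n, m <= n /\ H n = true.

(* Main.v *)
Require Import Defs.
From Stdlib Require Import Arith List Lia Bool Cantor.
From Stdlib Require Import Classical ClassicalEpsilon FunctionalExtensionality.
Import ListNotations.

(* Call a set of sets an omega-model if it is closed under the operations used below.  One fixes
   a countable coded omega-model M, omitting B and the diagonal Pi^1_1 set O.  It exists because
   the codes of such models form a nonempty Sigma^1_1 class, and a set that belongs to every
   member of a nonempty Sigma^1_1 class is hyperarithmetical: either two members disagree at some
   place, so that one of them can be made to disagree with B, or the set is Delta^1_1.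

   Mathias forcing over M with two stems, one inside A and one inside the complement, produces a
   generic G on one of the two sides, although A is not in M: by compactness in the space of
   partitions, a question on finite extensions of the stems that has a positive answer for every
   partition has one for the partition given by A, and a negative answer yields a reservoir in M.

   If B were Delta^1_1(G), then for every n exactly one of two trees S_n^G, T_n^G would be
   ill-founded.  Any two trees are comparable, i.e. one of them has a length-preserving monotone
   map to the other, and which one decides whether n is in B.  For every H such maps exist for
   all n, and by a fusion argument they can be chosen continuously in H on the infinite subsets of
   a smaller reservoir.  Hence B is the value of a function of M at G, which is avoided by
   genericity.  All closure conditions on M are true statements about the full power set, so that
   the wellfoundedness of M is irrelevant.

   Finally, if some G-computable well-order has no computable copy, then every computable
   well-order embeds in it, whence O, the set of indices of well-founded trees, is Delta^1_1(G);
   so it is enough to omit O as well. *)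

(** The obstacle is that a Delta^1_1(G) definition is not continuous in G, while a stem fixes only
    finitely much of G. A path through S_n^G exists only for some n, so it cannot be selected for
    all n; a comparison of S_n^H with T_n^H exists for every H, even where the two definitions are
    not complementary. This totality is what the continuous selection starts from. Afterwards only
    functions on finite stems occur, and every forcing question quantifies over numbers alone. No
    side can be fixed in advance, so requirements come in pairs, one for each side: a function on
    stems has to output a wrong value on its side. Each pair is met on at least one side; hence if
    one side fails some requirement from some stage on, the other side meets all of its own. If no
    pair of wrong values could be forced, B or O could be read off from the answers to forcing
    questions and would belong to M. A function that can never become total on its side meets its
    requirement trivially; this escape is closed for the selected comparisons, which are total. *)

(** * Coding of pairs and lists by numbers *)

Definition cpair (x y : nat) : nat := Cantor.to_nat (x, y).
Definition p1 (z : nat) : nat := fst (Cantor.of_nat z).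
Definition p2 (z : nat) : nat := snd (Cantor.of_nat z).

Lemma p1_pair x y : p1 (cpair x y) = x.
Proof. unfold p1, cpair. now rewrite Cantor.cancel_of_to. Qed.
Lemma p2_pair x y : p2 (cpair x y) = y.
Proof. unfold p2, cpair. now rewrite Cantor.cancel_of_to. Qed.
Lemma pair_p z : cpair (p1 z) (p2 z) = z.
Proof. unfold p1, p2, cpair. rewrite <- surjective_pairing. apply Cantor.cancel_to_of. Qed.
Lemma pair_inj x y x' y' : cpair x y = cpair x' y' -> x = x' /\ y = y'.
Proof.
  intros H. split.
  - rewrite <- (p1_pair x y), H. apply p1_pair.
  - rewrite <- (p2_pair x y), H. apply p2_pair.
Qed.
Lemma pair_ge x y : y + x <= cpair x y.
Proof. apply Cantor.to_nat_non_decreasing. Qed.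
Lemma pair_spec x y : cpair x y * 2 = y * 2 + (y + x) * S (y + x).
Proof. apply Cantor.to_nat_spec. Qed.
Lemma p1_le z : p1 z <= z.
Proof. pose proof (pair_ge (p1 z) (p2 z)). rewrite pair_p in H. lia. Qed.
Lemma p2_le z : p2 z <= z.
Proof. pose proof (pair_ge (p1 z) (p2 z)). rewrite pair_p in H. lia. Qed.
Lemma pair_mono x y y' : y <= y' -> cpair x y <= cpair x y'.
Proof. intros H. pose proof (pair_spec x y). pose proof (pair_spec x y'). nia. Qed.

(** A bijection between lists and numbers, so that quantifiers over nodes and stems are plain number
    quantifiers. Decoding uses the code itself as fuel, which suffices because [p2 m < S m]. *)
Fixpoint enc (l : list nat) : nat :=
  match l with [] => 0 | a :: l => S (cpair a (enc l)) end.
Fixpoint decf (k n : nat) : list nat :=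
  match k, n with S k, S m => p1 m :: decf k (p2 m) | _, _ => [] end.
Definition dec (n : nat) : list nat := decf n n.

Lemma decf_stable k n : n <= k -> decf k n = dec n.
Proof.
  unfold dec. revert n.
  induction k as [k IH] using lt_wf_ind. intros n Hn.
  destruct n; [destruct k; reflexivity|]. destruct k; [lia|]. cbn.
  pose proof (p2_le n). f_equal.
  rewrite IH by lia. symmetry. destruct (Nat.eq_dec n k) as [->|]; [apply IH; lia|].
  apply IH; lia.
Qed.
Lemma dec_S m : dec (S m) = p1 m :: dec (p2 m).
Proof. unfold dec at 1. cbn. f_equal. apply decf_stable, p2_le. Qed.
Lemma dec_0 : dec 0 = [].
Proof. reflexivity. Qed.
Lemma dec_enc l : dec (enc l) = l.
Proof. induction l; cbn [enc]; [reflexivity|]. now rewrite dec_S, p1_pair, p2_pair, IHl. Qed.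
Lemma enc_dec n : enc (dec n) = n.
Proof.
  induction n as [n IH] using lt_wf_ind. destruct n; [reflexivity|].
  rewrite dec_S. cbn [enc]. rewrite IH, pair_p; [reflexivity|]. pose proof (p2_le n); lia.
Qed.
Lemma dec_inj n m : dec n = dec m -> n = m.
Proof. intros H. rewrite <- (enc_dec n), H. apply enc_dec. Qed.
Lemma length_enc l : length l <= enc l.
Proof. induction l; cbn [enc length]; [lia|]. pose proof (pair_ge a (enc l)). lia. Qed.
Lemma length_dec n : length (dec n) <= n.
Proof. rewrite <- (enc_dec n) at 2. apply length_enc. Qed.
Lemma tl_dec n : tl (dec n) = dec (p2 (pred n)).
Proof. destruct n; [reflexivity|]. rewrite dec_S. reflexivity. Qed.
Lemma hd_dec n : hd 0 (dec n) = p1 (pred n).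
Proof. destruct n; [reflexivity|]. rewrite dec_S. reflexivity. Qed.

Opaque cpair p1 p2 dec.

(** * Computable functions *)

Definition env (xs : list nat) : nat -> nat := fun i => nth i xs 0.

(* [f] is a function of finitely many variables, presented as a function of an infinite
   environment, that one program computes relative to every oracle. *)
Definition Cmp (f : (nat -> nat) -> nat) : Prop :=
  exists e N, (forall O xs, eval O e xs (f (env xs))) /\
    (forall ne ne', (forall i, i < N -> ne i = ne' i) -> f ne = f ne').

Lemma Cmp_ext f g : (forall ne, f ne = g ne) -> Cmp f -> Cmp g.
Proof.
  intros E (e & N & H & L). exists e, N. split.
  - intros O xs. rewrite <- E. apply H.
  - intros ne ne' A. rewrite <- !E. now apply L.
Qed.

Lemma Cmp_var i : Cmp (fun ne => ne i).
Proof. exists (pproj i), (S i). split; [intros; constructor|]. auto. Qed.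

Lemma Cmp_subst f ts : Cmp f -> Forall Cmp ts ->
  Cmp (fun ne => f (fun i => nth i (map (fun t => t ne) ts) 0)).
Proof.
  intros (e & N & H & L) F.
  assert (exists es M, (forall O xs, evals O es xs (map (fun t => t (env xs)) ts)) /\
    (forall ne ne', (forall i, i < M -> ne i = ne' i) ->
       map (fun t => t ne) ts = map (fun t => t ne') ts)) as (es & M & Hes & LM).
  { clear f e N H L. induction F as [|t ts (e & N & H & L) _ (es & M & IH & IL)].
    - exists [], 0. split; [constructor|reflexivity].
    - exists (e :: es), (max N M). split; [constructor; auto|].
      intros ne ne' A. cbn. f_equal; [apply L|apply IL]; intros; apply A; lia. }
  exists (pcomp e es), M. split.
  - intros O xs. econstructor; [apply Hes|]. apply H.
  - intros ne ne' A. now rewrite (LM _ _ A).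
Qed.

Lemma Cmp_comp1 (g : nat -> nat) : Cmp (fun ne => g (ne 0)) ->
  forall t, Cmp t -> Cmp (fun ne => g (t ne)).
Proof. intros Hg t Ht. apply (Cmp_subst _ [t] Hg). auto. Qed.
Lemma Cmp_comp2 (g : nat -> nat -> nat) : Cmp (fun ne => g (ne 0) (ne 1)) ->
  forall t u, Cmp t -> Cmp u -> Cmp (fun ne => g (t ne) (u ne)).
Proof. intros Hg t u Ht Hu. apply (Cmp_subst _ [t; u] Hg). auto. Qed.
Lemma Cmp_comp3 (g : nat -> nat -> nat -> nat) : Cmp (fun ne => g (ne 0) (ne 1) (ne 2)) ->
  forall t u v, Cmp t -> Cmp u -> Cmp v -> Cmp (fun ne => g (t ne) (u ne) (v ne)).
Proof. intros Hg t u v Ht Hu Hv. apply (Cmp_subst _ [t; u; v] Hg). auto. Qed.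
Lemma Cmp_comp4 (g : nat -> nat -> nat -> nat -> nat) :
  Cmp (fun ne => g (ne 0) (ne 1) (ne 2) (ne 3)) ->
  forall t u v w, Cmp t -> Cmp u -> Cmp v -> Cmp w ->
  Cmp (fun ne => g (t ne) (u ne) (v ne) (w ne)).
Proof. intros Hg t u v w Ht Hu Hv Hw. apply (Cmp_subst _ [t; u; v; w] Hg). auto. Qed.

Lemma Cmp_succ t : Cmp t -> Cmp (fun ne => S (t ne)).
Proof.
  apply (Cmp_comp1 S). exists psucc, 1. split.
  - intros O [|x xs]; apply ev_succ.
  - intros ne ne' A. now rewrite A by lia.
Qed.
Lemma Cmp_const k : Cmp (fun _ => k).
Proof.
  induction k.
  - exists pzero, 0. split; [constructor|reflexivity].
  - now apply Cmp_succ.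
Qed.

(** A program cannot pass on an infinite environment. Since [f] and [g] depend on finitely many
    variables, it is enough to copy the first [N] of them by projections into the parameter list of
    the recursion. *)
Lemma Cmp_rec f (g : nat -> nat -> (nat -> nat) -> nat) t :
  Cmp f -> Cmp (fun ne => g (ne 0) (ne 1) (fun i => ne (S (S i)))) -> Cmp t ->
  Cmp (fun ne => nat_rect (fun _ => nat) (f ne) (fun n r => g n r ne) (t ne)).
Proof.
  intros (ef & Nf & Hf & Lf) (eg & Ng & Hg & Lg) (et & Nt & Ht & Lt).
  set (N := max Nf Ng).
  assert (Lg' : forall n r ne ne', (forall i, i < N -> ne i = ne' i) -> g n r ne = g n r ne').
  { intros n r ne ne' A.
    apply (Lg (fun i => match i with 0 => n | 1 => r | S (S i) => ne i end)
              (fun i => match i with 0 => n | 1 => r | S (S i) => ne' i end)).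
    intros [|[|i]] Hi; auto. apply A. unfold N; lia. }
  exists (pcomp (pprec ef eg) (et :: map pproj (seq 0 N))), (max N Nt). split.
  - intros O xs. set (ys := map (fun i => nth i xs 0) (seq 0 N)).
    assert (E : forall i, i < N -> env ys i = env xs i).
    { intros i Hi. unfold env, ys.
      rewrite (nth_indep _ 0 (nth 0 xs 0)) by (now rewrite length_map, length_seq).
      rewrite (map_nth (fun i => nth i xs 0)). now rewrite seq_nth. }
    assert (EV : forall l, evals O (map pproj l) xs (map (fun i => nth i xs 0) l)).
    { induction l; cbn; constructor; auto. constructor. }
    econstructor; [constructor; [apply Ht|apply EV]|]. fold ys.
    induction (t (env xs)) as [|n IH]; cbn.
    + constructor. rewrite (Lf (env xs) (env ys)); [apply Hf|].
      intros i Hi. symmetry. apply E. unfold N; lia.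
    + econstructor; [apply IH|].
      rewrite (Lg' _ _ (env xs) (env ys)) by (intros; symmetry; auto).
      apply (Hg O (n :: _ :: ys)).
  - intros ne ne' A. rewrite (Lt ne ne') by (intros; apply A; lia).
    induction (t ne') as [|n IH]; cbn.
    + apply Lf. intros; apply A; lia.
    + rewrite IH. apply Lg'. intros; apply A; lia.
Qed.

Lemma Cmp_iter1 (f : nat -> nat) (g : nat -> nat -> nat) (h : nat -> nat -> nat) :
  (forall x, h 0 x = f x) -> (forall n x, h (S n) x = g n (h n x)) ->
  Cmp (fun ne => f (ne 0)) -> Cmp (fun ne => g (ne 0) (ne 1)) ->
  forall t u, Cmp t -> Cmp u -> Cmp (fun ne => h (t ne) (u ne)).
Proof.
  intros H0 HS Hf Hg t u Ht Hu. apply (Cmp_comp2 h); auto.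
  eapply Cmp_ext.
  2: { apply (Cmp_rec (fun ne => f (ne 1)) (fun n r _ => g n r) (fun ne => ne 0)).
       - apply (Cmp_comp1 f Hf). apply Cmp_var.
       - apply Hg.
       - apply Cmp_var. }
  intros ne. cbn beta. induction (ne 0) as [|n IH]; cbn; [now rewrite H0|].
  now rewrite HS, IH.
Qed.

Lemma Cmp_add t u : Cmp t -> Cmp u -> Cmp (fun ne => t ne + u ne).
Proof.
  apply (Cmp_iter1 (fun x => x) (fun _ r => S r) Nat.add); auto.
  - apply Cmp_var.
  - apply Cmp_succ, Cmp_var.
Qed.
Lemma Cmp_pred t : Cmp t -> Cmp (fun ne => pred (t ne)).
Proof.
  apply (Cmp_comp1 pred).
  eapply Cmp_ext.
  2: { apply (Cmp_rec (fun ne => 0) (fun n r _ => n) (fun ne => ne 0)); try apply Cmp_var.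
       apply Cmp_const. }
  intros ne. cbn beta. now destruct (ne 0).
Qed.
Lemma Cmp_sub t u : Cmp t -> Cmp u -> Cmp (fun ne => t ne - u ne).
Proof.
  intros Ht Hu.
  apply (Cmp_iter1 (fun x => x) (fun _ r => pred r) (fun n x => x - n)); auto.
  - intros; lia.
  - intros; lia.
  - apply Cmp_var.
  - apply Cmp_pred, Cmp_var.
Qed.
Lemma Cmp_mul t u : Cmp t -> Cmp u -> Cmp (fun ne => t ne * u ne).
Proof.
  apply (Cmp_comp2 Nat.mul).
  eapply Cmp_ext.
  2: { apply (Cmp_rec (fun ne => 0) (fun n r ne => ne 1 + r) (fun ne => ne 0)); try apply Cmp_var.
       - apply Cmp_const.
       - apply Cmp_add; apply Cmp_var. }
  intros ne. cbn beta. induction (ne 0) as [|n IH]; cbn; [reflexivity|]. now rewrite IH.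
Qed.

(** * Computable predicates, bounded quantifiers and bounded search *)

Definition b2n (b : bool) : nat := if b then 1 else 0.
Definition CB (p : (nat -> nat) -> bool) : Prop := Cmp (fun ne => b2n (p ne)).

Lemma Cmp_ite p f g : CB p -> Cmp f -> Cmp g -> Cmp (fun ne => if p ne then f ne else g ne).
Proof.
  intros Hp Hf Hg. eapply Cmp_ext.
  2: { apply Cmp_add; [apply (Cmp_mul _ _ Hp Hf)|].
       apply Cmp_mul; [apply Cmp_sub; [apply (Cmp_const 1)|apply Hp]|apply Hg]. }
  intros ne. cbn beta. destruct (p ne); cbn; lia.
Qed.
Lemma CB_ext p q : (forall ne, p ne = q ne) -> CB p -> CB q.
Proof. intros E. apply Cmp_ext. intros; now rewrite E. Qed.
Lemma CB_ite p f g : CB p -> CB f -> CB g -> CB (fun ne => if p ne then f ne else g ne).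
Proof.
  intros Hp Hf Hg. eapply Cmp_ext; [|apply (Cmp_ite p _ _ Hp Hf Hg)].
  intros ne; cbn beta. now destruct (p ne).
Qed.
Lemma CB_const b : CB (fun _ => b).
Proof. exact (Cmp_const (b2n b)). Qed.
Lemma CB_negb p : CB p -> CB (fun ne => negb (p ne)).
Proof. intros Hp. apply (CB_ite p (fun _ => false) (fun _ => true)); auto using CB_const. Qed.
Lemma CB_andb p q : CB p -> CB q -> CB (fun ne => p ne && q ne).
Proof. intros Hp Hq. apply (CB_ite p q (fun _ => false)); auto using CB_const. Qed.
Lemma CB_orb p q : CB p -> CB q -> CB (fun ne => p ne || q ne).
Proof. intros Hp Hq. apply (CB_ite p (fun _ => true) q); auto using CB_const. Qed.
Lemma CB_implb p q : CB p -> CB q -> CB (fun ne => implb (p ne) (q ne)).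
Proof. intros Hp Hq. apply (CB_ite p q (fun _ => true)); auto using CB_const. Qed.
Lemma CB_beqb p q : CB p -> CB q -> CB (fun ne => Bool.eqb (p ne) (q ne)).
Proof.
  intros Hp Hq. eapply CB_ext; [|apply (CB_ite p q (fun ne => negb (q ne)) Hp Hq)].
  - intros ne; cbn beta. destruct (p ne), (q ne); reflexivity.
  - now apply CB_negb.
Qed.
Lemma CB_leb t u : Cmp t -> Cmp u -> CB (fun ne => t ne <=? u ne).
Proof.
  intros Ht Hu. eapply Cmp_ext.
  2: { apply (Cmp_sub (fun _ => 1)); [apply Cmp_const|]. apply (Cmp_sub _ _ Ht Hu). }
  intros ne; cbn beta. destruct (Nat.leb_spec (t ne) (u ne)); unfold b2n; lia.
Qed.
Lemma CB_ltb t u : Cmp t -> Cmp u -> CB (fun ne => t ne <? u ne).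
Proof. intros Ht Hu. apply (CB_leb (fun ne => S (t ne))); auto using Cmp_succ. Qed.
Lemma CB_eqb t u : Cmp t -> Cmp u -> CB (fun ne => t ne =? u ne).
Proof.
  intros Ht Hu. eapply CB_ext.
  2: { apply CB_andb; [apply (CB_leb _ _ Ht Hu)|apply (CB_leb _ _ Hu Ht)]. }
  intros ne; cbn beta.
  destruct (Nat.leb_spec (t ne) (u ne)), (Nat.leb_spec (u ne) (t ne)), (Nat.eqb_spec (t ne) (u ne));
    cbn; auto; lia.
Qed.

Definition ball (n : nat) (p : nat -> bool) : bool :=
  nat_rect (fun _ => bool) true (fun i r => r && p i) n.
Lemma ball_spec n p : ball n p = true <-> forall i, i < n -> p i = true.
Proof.
  unfold ball. induction n as [|n IH]; cbn.
  - split; [lia|auto].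
  - rewrite andb_true_iff, IH. split.
    + intros [A B] i Hi. destruct (Nat.eq_dec i n) as [->|]; auto. apply A; lia.
    + intros A. split; auto.
Qed.
Lemma ball_ext n p q : (forall i, i < n -> p i = q i) -> ball n p = ball n q.
Proof.
  unfold ball. induction n as [|n IH]; cbn; auto. intros A. rewrite IH, A; auto.
Qed.
Lemma CB_ball (p : nat -> (nat -> nat) -> bool) t :
  CB (fun ne => p (ne 0) (fun i => ne (S i))) -> Cmp t ->
  CB (fun ne => ball (t ne) (fun i => p i ne)).
Proof.
  intros Hp Ht. eapply Cmp_ext.
  2: { apply (Cmp_rec (fun _ => 1) (fun n r ne => r * b2n (p n ne)) t);
       [apply Cmp_const| |apply Ht].
       apply Cmp_mul; [apply Cmp_var|].
       destruct Hp as (e & N & H & L).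
       assert (Cmp (fun ne => b2n (p (ne 0) (fun i => ne (S i))))) as Hp by (exists e, N; auto).
       (* In the recursion step variable 1 holds the accumulated value; the substitution lets [p]
          skip it. *)
       pose proof (Cmp_subst _ ((fun ne => ne 0) :: map (fun i ne => ne (S (S i))) (seq 0 N)) Hp) as Q.
       eapply Cmp_ext; [|apply Q].
       - intros ne. cbn beta. apply (L (fun i => nth i _ 0) (fun i => match i with 0 => ne 0 | S i => ne (S (S i)) end)).
         intros [|i] Hi; [reflexivity|]. cbn [nth map]. rewrite map_map.
         rewrite (nth_indep _ 0 ((fun i => ne (S (S i))) 0)) by (rewrite length_map, length_seq; lia).
         rewrite (map_nth (fun i => ne (S (S i)))), seq_nth by lia. reflexivity.
       - constructor; [apply Cmp_var|]. apply Forall_map, Forall_forall. intros; apply Cmp_var. }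
  intros ne; cbn beta. unfold ball. induction (t ne) as [|n IH]; cbn; auto. rewrite IH.
  match goal with |- _ = b2n (?a && ?b) => destruct a, b; reflexivity end.
Qed.

Definition bex (n : nat) (p : nat -> bool) : bool := negb (ball n (fun i => negb (p i))).
Lemma bex_spec n p : bex n p = true <-> exists i, i < n /\ p i = true.
Proof.
  unfold bex. rewrite negb_true_iff, <- not_true_iff_false, ball_spec. split.
  - intros H. destruct (existsb p (seq 0 n)) eqn:E.
    + apply existsb_exists in E as (i & Hi & Hp). apply in_seq in Hi. exists i; split; [lia|auto].
    + exfalso. apply H. intros i Hi. apply negb_true_iff. apply not_true_iff_false. intros Hp.
      apply not_true_iff_false in E. apply E. apply existsb_exists. exists i. split; auto.
      apply in_seq; lia.
  - intros (i & Hi & Hp) H. specialize (H i Hi). now rewrite Hp in H.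
Qed.
Lemma CB_bex (p : nat -> (nat -> nat) -> bool) t :
  CB (fun ne => p (ne 0) (fun i => ne (S i))) -> Cmp t ->
  CB (fun ne => bex (t ne) (fun i => p i ne)).
Proof.
  intros Hp Ht. apply CB_negb, (CB_ball (fun i ne => negb (p i ne))); auto. now apply CB_negb.
Qed.

(** Inverts a computable function once a bound and uniqueness are known; the projections and the
    length of a coded list are obtained in this way. *)
Definition bsearch (n : nat) (p : nat -> bool) : nat :=
  nat_rect (fun _ => nat) 0 (fun i r => if p i then i else r) n.
Lemma bsearch_spec n p m : m < n -> p m = true -> (forall i, p i = true -> i = m) -> bsearch n p = m.
Proof.
  unfold bsearch. intros Hm Hp U. induction n as [|n IH]; [lia|]. cbn.
  destruct (p n) eqn:E; [now apply U|]. apply IH.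
  destruct (Nat.eq_dec m n) as [->|]; [congruence|lia].
Qed.

Lemma Cmp_pair t u : Cmp t -> Cmp u -> Cmp (fun ne => cpair (t ne) (u ne)).
Proof.
  apply (Cmp_comp2 cpair).
  (* Triangular numbers, by recursion, since halving is not among the operations at hand. *)
  assert (Cmp (fun ne => nat_rect (fun _ => nat) 0 (fun n r => S n + r) (ne 0))) as T.
  { apply (Cmp_rec (fun _ => 0) (fun n r _ => S n + r) (fun ne => ne 0)).
    - apply Cmp_const.
    - apply Cmp_add; [apply Cmp_succ|]; apply Cmp_var.
    - apply Cmp_var. }
  eapply Cmp_ext.
  2: { apply Cmp_add; [apply (Cmp_var 1)|].
       apply (Cmp_comp1 (fun z => nat_rect (fun _ => nat) 0 (fun n r => S n + r) z) T).
       apply Cmp_add; [apply (Cmp_var 1)|apply (Cmp_var 0)]. }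
  intros ne; cbn beta.
  assert (G : forall z, nat_rect (fun _ => nat) 0 (fun n r => S n + r) z * 2 = z * S z).
  { induction z as [|z IH]; cbn [nat_rect]; nia. }
  pose proof (G (ne 1 + ne 0)). pose proof (pair_spec (ne 0) (ne 1)). lia.
Qed.

Ltac cmp_step :=
  cbv beta; lazymatch goal with
  | |- Cmp (fun ne => b2n (@?p ne)) => change (CB p)
  | |- CB (fun ne => if _ then _ else _) => apply CB_ite
  | |- CB (fun ne => negb _) => apply CB_negb
  | |- CB (fun ne => andb _ _) => apply CB_andb
  | |- CB (fun ne => orb _ _) => apply CB_orb
  | |- CB (fun ne => implb _ _) => apply CB_implb
  | |- CB (fun ne => Bool.eqb _ _) => apply CB_beqb
  | |- CB (fun ne => Nat.ltb _ _) => apply CB_ltb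
  | |- CB (fun ne => Nat.leb _ _) => apply CB_leb
  | |- CB (fun ne => Nat.eqb _ _) => apply CB_eqb
  | |- CB (fun ne => ball _ _) => apply CB_ball
  | |- CB (fun ne => bex _ _) => apply CB_bex
  | |- CB (fun _ => ?b) => apply CB_const
  | |- Cmp (fun ne => ne _) => apply Cmp_var
  | |- Cmp (fun ne => S _) => first [apply Cmp_const | apply Cmp_succ]
  | |- Cmp (fun ne => Nat.add _ _) => apply Cmp_add
  | |- Cmp (fun ne => Nat.mul _ _) => apply Cmp_mul
  | |- Cmp (fun ne => Nat.sub _ _) => apply Cmp_sub
  | |- Cmp (fun ne => Nat.pred _) => apply Cmp_pred
  | |- Cmp (fun ne => cpair _ _) => apply Cmp_pair
  | |- Cmp (fun ne => if _ then _ else _) => apply Cmp_ite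
  | |- Cmp (fun _ => ?k) => apply Cmp_const
  end.

Lemma Cmp_bsearch (p : nat -> (nat -> nat) -> bool) t :
  CB (fun ne => p (ne 0) (fun i => ne (S (S i)))) -> Cmp t ->
  Cmp (fun ne => bsearch (t ne) (fun i => p i ne)).
Proof.
  intros Hp Ht. apply (Cmp_rec (fun _ => 0) (fun n r ne => if p n ne then n else r)); auto.
  - apply Cmp_const.
  - apply Cmp_ite; auto; apply Cmp_var.
Qed.
Lemma Cmp_p1 t : Cmp t -> Cmp (fun ne => p1 (t ne)).
Proof.
  apply (Cmp_comp1 p1).
  eapply Cmp_ext.
  2: { apply (Cmp_bsearch (fun x ne => bex (S (ne 0)) (fun y => cpair x y =? ne 0)) (fun ne => S (ne 0)));
       repeat cmp_step. }
  intros ne; cbn beta. pose proof (p1_le (ne 0)). pose proof (p2_le (ne 0)). apply bsearch_spec.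
  - lia.
  - apply bex_spec. exists (p2 (ne 0)). split; [lia|]. apply Nat.eqb_eq, pair_p.
  - intros i Hi. apply bex_spec in Hi as (y & _ & E). apply Nat.eqb_eq in E. rewrite <- E. now rewrite p1_pair.
Qed.
Lemma Cmp_p2 t : Cmp t -> Cmp (fun ne => p2 (t ne)).
Proof.
  apply (Cmp_comp1 p2).
  eapply Cmp_ext.
  2: { apply (Cmp_bsearch (fun y ne => bex (S (ne 0)) (fun x => cpair x y =? ne 0)) (fun ne => S (ne 0)));
       repeat cmp_step. }
  intros ne; cbn beta. pose proof (p1_le (ne 0)). pose proof (p2_le (ne 0)). apply bsearch_spec.
  - lia.
  - apply bex_spec. exists (p1 (ne 0)). split; [lia|]. apply Nat.eqb_eq, pair_p.
  - intros i Hi. apply bex_spec in Hi as (x & _ & E). apply Nat.eqb_eq in E. rewrite <- E. now rewrite p2_pair.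
Qed.

Lemma skipn_dec k n : skipn k (dec n) = dec (nat_rect (fun _ => nat) n (fun _ r => p2 (pred r)) k).
Proof.
  induction k as [|k IH]; cbn [nat_rect]; [reflexivity|].
  rewrite <- tl_dec, <- IH. clear IH. generalize (dec n). induction k as [|k IH]; intros [|a l]; auto.
  cbn [skipn]. rewrite <- IH. destruct l; reflexivity.
Qed.
Lemma Cmp_skip t u : Cmp t -> Cmp u ->
  Cmp (fun ne => nat_rect (fun _ => nat) (u ne) (fun _ r => p2 (pred r)) (t ne)).
Proof.
  apply (Cmp_iter1 (fun x => x) (fun _ r => p2 (pred r))
    (fun k n => nat_rect (fun _ => nat) n (fun _ r => p2 (pred r)) k)); auto.
  - apply Cmp_var.
  - apply Cmp_p2, Cmp_pred, Cmp_var.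
Qed.
Lemma Cmp_nth t u : Cmp t -> Cmp u -> Cmp (fun ne => nth (t ne) (dec (u ne)) 0).
Proof.
  intros Ht Hu. eapply Cmp_ext.
  2: { apply Cmp_p1, Cmp_pred, (Cmp_skip _ _ Ht Hu). }
  intros ne; cbn beta. rewrite <- hd_dec, <- skipn_dec.
  generalize (dec (u ne)). induction (t ne) as [|k IH]; intros [|a l]; cbn; auto.
Qed.
Lemma Cmp_length t : Cmp t -> Cmp (fun ne => length (dec (t ne))).
Proof.
  apply (Cmp_comp1 (fun n => length (dec n))).
  eapply Cmp_ext.
  (* The length is the only [k] whose [k]-fold tail is empty while the tail before it, if there is
     one, is not. *)
  2: { apply (Cmp_bsearch (fun k ne =>
         let r := nat_rect (fun _ => nat) (ne 0) (fun _ r => p2 (pred r)) in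
         (r k =? 0) && ((k =? 0) || (0 <? r (pred k)))) (fun ne => S (ne 0))).
       - cbv zeta. repeat first [cmp_step | apply Cmp_skip].
       - repeat cmp_step. }
  intros ne; cbn beta.
  assert (Z : forall k, nat_rect (fun _ => nat) (ne 0) (fun _ r => p2 (pred r)) k = 0 <-> length (dec (ne 0)) <= k).
  { intros k.
    assert (forall z, z = 0 <-> length (dec z) = 0) as E.
    { intros [|z]; [split; auto|]. rewrite dec_S. cbn. split; discriminate. }
    rewrite E, <- skipn_dec, length_skipn. lia. }
  apply bsearch_spec.
  - pose proof (length_dec (ne 0)). lia.
  - cbv zeta. rewrite andb_true_iff, orb_true_iff, !Nat.eqb_eq, Nat.ltb_lt. split; [apply Z; lia|].
    destruct (length (dec (ne 0))) as [|k] eqn:E; [auto|]. right. cbn [pred].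
    destruct (Nat.eq_dec (nat_rect (fun _ => nat) (ne 0) (fun _ r => p2 (pred r)) k) 0) as [Q|]; [|lia].
    apply Z in Q. lia.
  - intros i Hi. cbv zeta in Hi. rewrite andb_true_iff, orb_true_iff, !Nat.eqb_eq, Nat.ltb_lt in Hi.
    destruct Hi as [A B]. apply Z in A. destruct B as [->|B]; [lia|].
    destruct i; [lia|]. cbn [pred] in B.
    destruct (le_lt_dec (length (dec (ne 0))) i) as [Q|Q]; [apply Z in Q; lia|lia].
Qed.

Definition memb (l : list nat) (x : nat) : bool := existsb (Nat.eqb x) l.
Lemma memb_In l x : memb l x = true <-> In x l.
Proof.
  unfold memb. rewrite existsb_exists. split.
  - intros (y & Hy & E). apply Nat.eqb_eq in E. now subst.
  - intros H. exists x. split; auto. apply Nat.eqb_refl.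
Qed.
Lemma CB_memb t u : Cmp t -> Cmp u -> CB (fun ne => memb (dec (t ne)) (u ne)).
Proof.
  intros Ht Hu. apply (Cmp_comp2 (fun a b => b2n (memb (dec a) b))); auto.
  eapply CB_ext.
  2: { apply (CB_bex (fun i ne => nth i (dec (ne 0)) 0 =? ne 1) (fun ne => length (dec (ne 0)))).
       - repeat first [cmp_step | apply Cmp_nth].
       - apply Cmp_length, Cmp_var. }
  intros ne; cbn beta. apply eq_true_iff_eq. rewrite bex_spec, memb_In. split.
  - intros (i & Hi & E). apply Nat.eqb_eq in E. rewrite <- E. now apply nth_In.
  - intros H. apply (In_nth _ _ 0) in H as (i & Hi & E). exists i. split; auto. now apply Nat.eqb_eq.
Qed.

(* Tree nodes are stored newest entry first, so the prefixes of a node are its tails;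
   [rl l i] is the entry with index [i] counted from the root. *)
Definition rl (l : list nat) (i : nat) : nat := nth (length l - S i) l 0.
Lemma rl_cons a l i : i < length l -> rl (a :: l) i = rl l i.
Proof.
  intros H. unfold rl. cbn [length]. replace (S (length l) - S i) with (S (length l - S i)) by lia.
  reflexivity.
Qed.
Lemma rl_last a l : rl (a :: l) (length l) = a.
Proof. unfold rl. cbn [length]. now rewrite Nat.sub_diag. Qed.
Lemma Cmp_rl t u : Cmp t -> Cmp u -> Cmp (fun ne => rl (dec (t ne)) (u ne)).
Proof.
  intros Ht Hu. unfold rl. apply Cmp_nth; auto. apply Cmp_sub.
  - now apply Cmp_length.
  - now apply Cmp_succ.
Qed.

Ltac cmp := repeat first
  [ assumption | cmp_step | apply Cmp_p1 | apply Cmp_p2 | apply Cmp_nth | apply Cmp_length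
  | apply CB_memb | apply Cmp_rl ].

Fixpoint pre (f : nat -> nat) (k : nat) : list nat :=
  match k with 0 => [] | S k => f k :: pre f k end.
Lemma length_pre f k : length (pre f k) = k.
Proof. induction k; cbn; auto. Qed.
Lemma rl_pre f k i : i < k -> rl (pre f k) i = f i.
Proof.
  induction k as [|k IH]; [lia|]. intros H. cbn [pre].
  destruct (Nat.eq_dec i k) as [->|].
  - pose proof (rl_last (f k) (pre f k)) as E. now rewrite length_pre in E.
  - rewrite rl_cons by (rewrite length_pre; lia). apply IH; lia.
Qed.
Lemma pre_ext f g k : (forall i, i < k -> f i = g i) -> pre f k = pre g k.
Proof. induction k; cbn; intros H; auto. f_equal; auto. Qed.
Lemma pre_rl l : pre (rl l) (length l) = l.
Proof.
  induction l as [|a l IH]; [reflexivity|]. cbn [length pre]. rewrite rl_last. f_equal.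
  rewrite <- IH at 3. apply pre_ext. intros. now apply rl_cons.
Qed.

(** * Evaluation of programs *)

(** Induction with hypotheses for the programs inside the list of [pcomp], a nested occurrence. *)
Lemma prf_ind_list (P : prf -> Prop) :
  P pzero -> P psucc -> (forall i, P (pproj i)) -> P porac ->
  (forall f gs, P f -> Forall P gs -> P (pcomp f gs)) ->
  (forall f g, P f -> P g -> P (pprec f g)) -> (forall f, P f -> P (pmu f)) -> forall e, P e.
Proof.
  intros Hz Hs Hp Ho Hc Hr Hm. fix IH 1. intros [| |i| |f gs|f g|f].
  - exact Hz.
  - exact Hs.
  - apply Hp.
  - exact Ho.
  - apply Hc; [apply IH|]. induction gs as [|g gs IHgs]; constructor; [apply IH|apply IHgs].
  - apply Hr; apply IH.
  - apply Hm, IH.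
Qed.

Lemma evals_nil O xs ys : evals O [] xs ys <-> ys = [].
Proof. split; [now inversion 1|]. intros ->. constructor. Qed.
Lemma evals_cons O g gs xs ys :
  evals O (g :: gs) xs ys <-> exists y ys', ys = y :: ys' /\ eval O g xs y /\ evals O gs xs ys'.
Proof.
  split; [inversion 1; subst; eauto|]. intros (y & ys' & -> & H1 & H2). now constructor.
Qed.
Lemma eval_comp O f gs xs z :
  eval O (pcomp f gs) xs z <-> exists ys, evals O gs xs ys /\ eval O f ys z.
Proof. split; [inversion 1; subst; eauto|]. intros (ys & H1 & H2). econstructor; eauto. Qed.
Lemma eval_prec O f g xs y :
  eval O (pprec f g) xs y <->
  (exists t, xs = 0 :: t /\ eval O f t y) \/
  (exists n t r, xs = S n :: t /\ eval O (pprec f g) (n :: t) r /\ eval O g (n :: r :: t) y).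
Proof.
  split.
  - inversion 1; subst; [left; eauto|right; eauto 8].
  - intros [(t & -> & H)|(n & t & r & -> & H1 & H2)]; [now constructor|econstructor; eauto].
Qed.
Lemma eval_mu O f xs n :
  eval O (pmu f) xs n <->
  eval O f (n :: xs) 0 /\ forall m, m < n -> exists k, eval O f (m :: xs) (S k).
Proof. split; [now inversion 1|]. intros [H1 H2]. now constructor. Qed.

Lemma eval_functional O e : forall xs y y', eval O e xs y -> eval O e xs y' -> y = y'.
Proof.
  induction e as [| |i| |f gs IHf IHgs|f g IHf IHg|f IHf] using prf_ind_list; intros xs y y' H1 H2.
  1-4: inversion H1; inversion H2; subst; auto.
  - apply eval_comp in H1 as (ys & E1 & F1). apply eval_comp in H2 as (ys' & E2 & F2).
    assert (ys = ys'); [|subst; eauto].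
    clear - IHgs E1 E2. revert ys ys' E1 E2.
    induction IHgs as [|g gs Hg _ IH]; intros ys ys' E1 E2.
    + apply evals_nil in E1, E2. congruence.
    + apply evals_cons in E1 as (y & t & -> & A & B), E2 as (y' & t' & -> & A' & B').
      f_equal; eauto.
  - destruct xs as [|n t]; [inversion H1|]. revert y y' H1 H2.
    induction n as [|n IHn]; intros y y' H1 H2; inversion H1; inversion H2; subst.
    + eauto.
    + assert (r = r0) by eauto. subst. eauto.
  - apply eval_mu in H1 as [A1 B1], H2 as [A2 B2].
    destruct (Nat.lt_trichotomy y y') as [L|[L|L]]; auto.
    + destruct (B2 _ L) as [k Hk]. discriminate (IHf _ _ _ A1 Hk).
    + destruct (B1 _ L) as [k Hk]. discriminate (IHf _ _ _ A2 Hk).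
Qed.

Fixpoint cp (e : prf) : nat :=
  match e with
  | pzero => cpair 0 0
  | psucc => cpair 1 0
  | pproj i => cpair 2 i
  | porac => cpair 3 0
  | pcomp f gs => cpair 4 (cpair (cp f) (enc (map cp gs)))
  | pprec f g => cpair 5 (cpair (cp f) (cp g))
  | pmu f => cpair 6 (cp f)
  end.
Lemma enc_inj l l' : enc l = enc l' -> l = l'.
Proof. intros H. rewrite <- (dec_enc l), H. apply dec_enc. Qed.
Lemma cp_inj e : forall e', cp e = cp e' -> e = e'.
Proof.
  induction e as [| |i| |f gs IHf IHgs|f g IHf IHg|f IHf] using prf_ind_list; intros e' H;
    destruct e'; cbn [cp] in H; apply pair_inj in H as [H1 H2]; try discriminate; auto.
  - apply pair_inj in H2 as [H2 H3]. apply enc_inj in H3. f_equal; auto. clear - IHgs H3.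
    revert l H3. induction IHgs as [|g gs Hg _ IH]; intros [|g' gs']; cbn; try discriminate; auto.
    intros [= A B]. f_equal; auto.
  - apply pair_inj in H2 as [H2 H3]. f_equal; auto.
  - f_equal; auto.
Qed.

(** * Definability of programs *)

Definition Def (P : (nat -> nat) -> (nat -> nat -> bool) -> Prop) : Prop :=
  exists phi, forall ne se, sat ne se phi <-> P ne se.

(* The graph of [t], with its variables and its value at arbitrary places of the environment. *)
Definition DefF (t : (nat -> nat) -> nat) : Prop :=
  forall k (s : nat -> nat),
  exists phi, forall ne se, sat ne se phi <-> ne k = t (fun i => ne (s i)).

Lemma Def_and P Q : Def P -> Def Q -> Def (fun ne se => P ne se /\ Q ne se).
Proof. intros [a A] [b B]. exists (fand a b). intros. cbn. now rewrite A, B. Qed.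
Lemma Def_or P Q : Def P -> Def Q -> Def (fun ne se => P ne se \/ Q ne se).
Proof. intros [a A] [b B]. exists (for_ a b). intros. cbn. now rewrite A, B. Qed.
Lemma Def_not P : Def P -> Def (fun ne se => ~ P ne se).
Proof. intros [a A]. exists (fneg a). intros. cbn. now rewrite A. Qed.
Lemma Def_impl P Q : Def P -> Def Q -> Def (fun ne se => P ne se -> Q ne se).
Proof. intros [a A] [b B]. exists (for_ (fneg a) b). intros. cbn. rewrite A, B. tauto. Qed.
Lemma Def_iff P Q : Def P -> Def Q -> Def (fun ne se => P ne se <-> Q ne se).
Proof. intros A B. apply Def_and; now apply Def_impl. Qed.
Lemma Def_all (Q : nat -> (nat -> nat) -> (nat -> nat -> bool) -> Prop) :
  Def (fun ne se => Q (ne 0) (fun i => ne (S i)) se) -> Def (fun ne se => forall n, Q n ne se).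
Proof. intros [a A]. exists (fall a). intros. cbn. split; intros H n; [apply (A (ncons n ne)), H|apply (A (ncons n ne)); exact (H n)]. Qed.
Lemma Def_ex (Q : nat -> (nat -> nat) -> (nat -> nat -> bool) -> Prop) :
  Def (fun ne se => Q (ne 0) (fun i => ne (S i)) se) -> Def (fun ne se => exists n, Q n ne se).
Proof.
  intros [a A]. exists (fex a). intros. cbn.
  split; intros [n H]; exists n; apply (A (ncons n ne)); exact H.
Qed.
Lemma Def_True : Def (fun _ _ => True).
Proof. exists (feq tzero tzero). intros. cbn. tauto. Qed.

Lemma DefF_var i : DefF (fun ne => ne i).
Proof. intros k s. exists (feq (tvar k) (tvar (s i))). reflexivity. Qed.
Lemma DefF_const c : DefF (fun _ => c).
Proof.
  intros k s. exists (feq (tvar k) (Nat.iter c tsucc tzero)). intros. cbn.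
  replace (teval ne (Nat.iter c tsucc tzero)) with c; [reflexivity|].
  induction c; cbn; auto.
Qed.
Lemma DefF_succ t : DefF t -> DefF (fun ne => S (t ne)).
Proof.
  intros Ht k s. destruct (Ht 0 (fun i => S (s i))) as [a A].
  exists (fex (fand a (feq (tvar (S k)) (tsucc (tvar 0))))). intros. cbn. split.
  - intros (n & H1 & H2). apply A in H1. cbn in H1. congruence.
  - intros H. exists (t (fun i => ne (s i))). split; auto. now apply A.
Qed.
(** Pairing involves a division by 2 and is no term of the language, but twice its value is a
    polynomial, so its graph is an equation between terms. *)
Lemma DefF_pair t u : DefF t -> DefF u -> DefF (fun ne => cpair (t ne) (u ne)).
Proof.
  intros Ht Hu k s.
  destruct (Ht 1 (fun i => S (S (s i)))) as [a A], (Hu 0 (fun i => S (S (s i)))) as [b B].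
  set (x := tvar 1). set (y := tvar 0). set (z := tvar (S (S k))).
  exists (fex (fex (fand (fand a b)
    (feq (tplus z z) (tplus (tplus y y) (tmult (tplus y x) (tsucc (tplus y x)))))))).
  intros. cbn. split.
  - intros (n & m & (H1 & H2) & H3). apply A in H1. apply B in H2. cbn in H1, H2.
    rewrite <- H1, <- H2. pose proof (pair_spec n m). lia.
  - intros H. exists (t (fun i => ne (s i))), (u (fun i => ne (s i))). split; [split|].
    + now apply A.
    + now apply B.
    + rewrite H. pose proof (pair_spec (t (fun i => ne (s i))) (u (fun i => ne (s i)))). lia.
Qed.
Lemma Def_eq t u : DefF t -> DefF u -> Def (fun ne _ => t ne = u ne).
Proof.
  intros Ht Hu. destruct (Ht 0 S) as [a A], (Hu 0 S) as [b B].
  exists (fex (fand a b)). intros. cbn. split.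
  - intros (n & H1 & H2). apply A in H1. apply B in H2.
    change (n = t ne) in H1. change (n = u ne) in H2. congruence.
  - intros H. exists (t ne). split; [now apply A|now apply B].
Qed.
Lemma Def_mem j t : DefF t -> Def (fun ne se => se j (t ne) = true).
Proof.
  intros Ht. destruct (Ht 0 S) as [a A].
  exists (fex (fand a (fmem j (tvar 0)))). intros. cbn. split.
  - intros (n & H1 & H2). apply A in H1. change (n = t ne) in H1. congruence.
  - intros H. exists (t ne). split; [now apply A|auto].
Qed.
Lemma Def_lt t u : DefF t -> DefF u -> Def (fun ne _ => t ne < u ne).
Proof.
  intros Ht Hu. destruct (Ht 1 (fun i => S (S (S i)))) as [a A], (Hu 0 (fun i => S (S (S i)))) as [b B].
  exists (fex (fex (fex (fand (fand a b) (feq (tvar 0) (tplus (tvar 1) (tsucc (tvar 2)))))))).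
  intros. cbn. split.
  - intros (d & n & m & (H1 & H2) & H3). apply A in H1. apply B in H2.
    change (n = t ne) in H1. change (m = u ne) in H2. lia.
  - intros H. exists (u ne - S (t ne)), (t ne), (u ne). split; [split|lia].
    + now apply A.
    + now apply B.
Qed.

Ltac def_step := first
  [ apply Def_all | apply Def_ex | apply Def_and | apply Def_or | apply Def_iff | apply Def_not
  | apply Def_lt | apply Def_eq | apply Def_mem | apply Def_True | apply Def_impl
  | apply DefF_var | apply DefF_const | apply DefF_succ | apply DefF_pair ].

(* Column [0] of a set tabulates programs: [hist X (cp e) (enc xs) y] stands for
   [eval O e xs y].  Using a second-order witness for this table avoids coding finite
   sequences by numbers inside arithmetic. *)
Definition hist (X : nat -> bool) (k xs y : nat) : Prop := X (cpair 0 (cpair k (cpair xs y))) = true.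

(** The recursion on [i] takes place in the metatheory, so that each instance is one fixed
    arithmetical formula; the same holds for [evsrel] and the list [gs]. *)
Fixpoint nthrel (i xs y : nat) : Prop :=
  (xs = 0 /\ y = 0) \/
  exists a t, xs = S (cpair a t) /\ match i with 0 => y = a | S i => nthrel i t y end.
Fixpoint evsrel (X : nat -> bool) (gs : list prf) (xs ys : nat) : Prop :=
  match gs with
  | [] => ys = 0
  | g :: gs => exists y t, ys = S (cpair y t) /\ hist X (cp g) xs y /\ evsrel X gs xs t
  end.

Lemma nthrel_spec i xs y : nthrel i (enc xs) y <-> y = nth i xs 0.
Proof.
  revert xs. induction i as [|i IH]; intros [|a l]; cbn [nthrel enc nth]; split.
  1, 5: intros [[_ ->]|(b & t & H & _)]; [auto|discriminate].
  1, 4: auto.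
  - intros [[H _]|(b & t & H & ->)]; [discriminate|]. injection H as H. now apply pair_inj in H.
  - intros ->. right. eauto.
  - intros [[H _]|(b & t & H & Q)]; [discriminate|]. injection H as H. apply pair_inj in H as [-> <-].
    now apply IH.
  - intros ->. right. exists a, (enc l). split; auto. now apply IH.
Qed.

(** One unfolding of the evaluation rules, with the immediate subprograms looked up in the table; a
    recursion also looks up its own value at the preceding argument. *)
Definition step (e : prf) (X H : nat -> bool) (xs y : nat) : Prop :=
  match e with
  | pzero => y = 0
  | psucc => exists x, nthrel 0 xs x /\ y = S x
  | pproj i => nthrel i xs y
  | porac => exists x, nthrel 0 xs x /\ ((H x = true /\ y = 1) \/ (~ H x = true /\ y = 0))
  | pcomp f gs => exists ys, evsrel X gs xs ys /\ hist X (cp f) ys y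
  | pprec f g =>
      (exists t, xs = S (cpair 0 t) /\ hist X (cp f) t y) \/
      (exists n t r, xs = S (cpair (S n) t) /\ hist X (cp e) (S (cpair n t)) r /\
         hist X (cp g) (S (cpair n (S (cpair r t)))) y)
  | pmu f => hist X (cp f) (S (cpair y xs)) 0 /\
      forall m, m < y -> exists k, hist X (cp f) (S (cpair m xs)) (S k)
  end.

(** An equivalence, so that the table is correct on failures as well: formulas built over the table
    may negate its atoms. *)
Definition here (e : prf) (X H : nat -> bool) : Prop :=
  forall xs y, hist X (cp e) xs y <-> step e X H xs y.
Fixpoint Theta (e : prf) (X H : nat -> bool) : Prop :=
  here e X H /\
  match e with
  | pcomp f gs => Theta f X H /\ fold_right (fun g r => Theta g X H /\ r) True gs
  | pprec f g => Theta f X H /\ Theta g X H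
  | pmu f => Theta f X H
  | _ => True
  end.

Lemma Def_comp2 (Q : nat -> nat -> (nat -> nat -> bool) -> Prop) t u :
  Def (fun ne se => Q (ne 0) (ne 1) se) -> DefF t -> DefF u ->
  Def (fun ne se => Q (t ne) (u ne) se).
Proof.
  intros [a A] Ht Hu.
  destruct (Ht 0 (fun i => S (S i))) as [b B], (Hu 1 (fun i => S (S i))) as [c C].
  exists (fex (fex (fand a (fand b c)))). intros. cbn [sat]. split.
  - intros (y & x & H1 & H2 & H3). apply A in H1. apply B in H2. apply C in H3.
    cbn [ncons] in *. change (x = t ne) in H2. change (y = u ne) in H3. congruence.
  - intros H. exists (u ne), (t ne). split; [now apply A|]. split; [now apply B|now apply C].
Qed.

Lemma Def_nthrel i t u : DefF t -> DefF u -> Def (fun ne _ => nthrel i (t ne) (u ne)).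
Proof.
  revert t u. induction i as [|i IH]; intros t u;
    apply (Def_comp2 (fun x y _ => nthrel _ x y)); cbn [nthrel]; repeat def_step.
  apply IH; def_step.
Qed.
Lemma Def_hist k t u : DefF k -> DefF t -> DefF u ->
  Def (fun ne se => hist (se 0) (k ne) (t ne) (u ne)).
Proof. intros. unfold hist. repeat def_step; auto. Qed.
Lemma Def_evsrel gs t u : DefF t -> DefF u -> Def (fun ne se => evsrel (se 0) gs (t ne) (u ne)).
Proof.
  revert t u. induction gs as [|g gs IH]; intros t u;
    apply (Def_comp2 (fun x y se => evsrel (se 0) _ x y)); cbn [evsrel]; repeat def_step.
  apply IH; repeat def_step.
Qed.
Lemma Def_here e : Def (fun _ se => here e (se 0) (se 1)).
Proof.
  unfold here. apply Def_all, Def_all, Def_iff; [apply Def_hist; repeat def_step|].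
  destruct e; cbn [step];
    repeat first [apply Def_hist | apply Def_nthrel | apply Def_evsrel | def_step].
Qed.
Lemma Def_Theta e : Def (fun _ se => Theta e (se 0) (se 1)).
Proof.
  induction e as [| |i| |f gs IHf IHgs|f g IHf IHg|f IHf] using prf_ind_list; cbn [Theta];
    (apply Def_and; [apply Def_here|]); auto using Def_True, Def_and.
  apply Def_and; auto. induction IHgs; cbn; auto using Def_True, Def_and.
Qed.

Definition HOK (X H : nat -> bool) (e : prf) : Prop :=
  forall xs y, hist X (cp e) (enc xs) y <-> eval H e xs y.

Lemma evsrel_spec X H gs : Forall (HOK X H) gs ->
  forall xs ys, evsrel X gs (enc xs) (enc ys) <-> evals H gs xs ys.
Proof.
  induction 1 as [|g gs Hg _ IH]; intros xs ys; cbn [evsrel].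
  - rewrite evals_nil. destruct ys; cbn; split; congruence.
  - rewrite evals_cons. split.
    + intros (y & t & E & A & B). destruct ys as [|y' ys]; [discriminate|].
      injection E as E. apply pair_inj in E as [-> <-]. apply Hg in A. apply IH in B. eauto.
    + intros (y & t & -> & A & B). apply Hg in A. apply IH in B. exists y, (enc t). auto.
Qed.

Definition subprograms (e : prf) : list prf :=
  match e with pcomp f gs => f :: gs | pprec f g => [f; g] | pmu f => [f] | _ => [] end.

Lemma step_spec e X H :
  Forall (HOK X H) (subprograms e) -> (match e with pprec _ _ => HOK X H e | _ => True end) ->
  forall xs y, step e X H (enc xs) y <-> eval H e xs y.
Proof.
  intros F G xs y. destruct e as [| |i| |f hs|f g|f]; cbn [step subprograms] in *.
  - split; [intros ->; constructor|now inversion 1].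
  - split.
    + intros (x & A & ->). apply nthrel_spec in A as ->. destruct xs; apply ev_succ.
    + intros A. exists (hd 0 xs). split; [|now inversion A]. apply nthrel_spec. now destruct xs.
  - rewrite nthrel_spec. split; [intros ->; constructor|now inversion 1].
  - assert (N : nth 0 xs 0 = hd 0 xs) by now destruct xs. split.
    + intros (x & A & B). apply nthrel_spec in A. rewrite N in A. subst x.
      assert (y = if H (hd 0 xs) then 1 else 0) as ->; [|constructor].
      destruct (H (hd 0 xs)); destruct B as [[B ->]|[B ->]]; congruence.
    + intros A. exists (hd 0 xs). split; [now apply nthrel_spec|].
      inversion A; subst. destruct (H (hd 0 xs)); [left|right]; split; congruence.
  - inversion F as [|? ? Hf Hg]; subst. rewrite eval_comp. split.
    + intros (ys & A & B). rewrite <- (enc_dec ys) in A, B. apply (evsrel_spec _ _ _ Hg) in A.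
      apply Hf in B. eauto.
    + intros (ys & A & B). exists (enc ys). split; [now apply (evsrel_spec _ _ _ Hg)|now apply Hf].
  - inversion F as [|? ? Hf F']; subst. inversion F' as [|? ? Hg _]; subst.
    rewrite eval_prec. split.
    + intros [(t & E & A)|(n & t & r & E & A & B)].
      * left. destruct xs as [|x xs]; [discriminate|]. injection E as E.
        apply pair_inj in E as [-> <-]. exists xs. split; auto. now apply Hf.
      * right. destruct xs as [|x xs]; [discriminate|]. injection E as E.
        apply pair_inj in E as [-> <-]. exists n, xs, r. split; auto. split.
        -- now apply (G (n :: xs)).
        -- now apply (Hg (n :: r :: xs)).
    + intros [(t & -> & A)|(n & t & r & -> & A & B)].
      * left. exists (enc t). split; auto. now apply Hf.
      * right. exists n, (enc t), r. split; auto. split.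
        -- now apply (G (n :: t)).
        -- now apply (Hg (n :: r :: t)).
  - inversion F as [|? ? Hf _]; subst. rewrite eval_mu. split.
    + intros [A B]. split; [now apply (Hf (y :: xs))|]. intros m Hm. destruct (B m Hm) as [k Hk].
      exists k. now apply (Hf (m :: xs)).
    + intros [A B]. split; [now apply (Hf (y :: xs))|]. intros m Hm. destruct (B m Hm) as [k Hk].
      exists k. now apply (Hf (m :: xs)).
Qed.

(** Induction on the program. For [pprec] the table refers to itself, so there an inner induction on
    the recursion argument is needed before [HOK] is known for the program. *)
Lemma Theta_HOK X H e : Theta e X H -> HOK X H e.
Proof.
  induction e as [| |i| |f gs IHf IHgs|f g IHf IHg|f IHf] using prf_ind_list; cbn [Theta];
    intros [A B].
  1-4: intros xs y; rewrite (A (enc xs) y); apply step_spec; cbn [subprograms]; auto.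
  - destruct B as [B C]. intros xs y. rewrite (A (enc xs) y). apply step_spec; auto.
    cbn [subprograms]. constructor; auto. clear - IHgs C. induction IHgs; constructor; cbn in C; tauto.
  - destruct B as [B C]. intros xs. destruct xs as [|n t].
    + intros y. rewrite (A (enc []) y). cbn [step enc]. split.
      * intros [(t & E & _)|(n & t & r & E & _)]; discriminate.
      * intros E. inversion E.
    + induction n as [|n IHn]; intros y; rewrite (A _ y); cbn [step]; rewrite eval_prec; split.
      * intros [(t' & E & Q)|(n & t' & r & E & _)]; injection E as E; apply pair_inj in E as [E1 E2];
          [|discriminate]. subst. left. exists t. split; auto. now apply IHf.
      * intros [(t' & [= <-] & Q)|(n & t' & r & E & _)]; [|discriminate].
        left. exists (enc t). split; auto. now apply IHf.
      * intros [(t' & E & Q)|(n' & t' & r & E & P & Q)]; injection E as E; apply pair_inj in E as [E1 E2];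
          [discriminate|]. injection E1 as <-. subst t'. right. exists n, t, r. split; auto. split.
        -- now apply IHn.
        -- now apply (IHg C (n :: r :: t)).
      * intros [(t' & E & Q)|(n' & t' & r & [= <- <-] & P & Q)]; [discriminate|].
        right. exists n, (enc t), r. split; auto. split.
        -- now apply (IHn r).
        -- now apply (IHg C (n :: r :: t)).
  - intros xs y. rewrite (A (enc xs) y). apply step_spec; cbn [subprograms]; auto.
Qed.

Lemma hist_exists (H Xu : nat -> bool) :
  exists X, (fun x => X (cpair 1 x)) = Xu /\ forall e, Theta e X H.
Proof.
  exists (fun z => if p1 z =? 0 then
      if excluded_middle_informative (exists e, cp e = p1 (p2 z) /\
        eval H e (dec (p1 (p2 (p2 z)))) (p2 (p2 (p2 z)))) then true else false
    else Xu (p2 z)).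
  split.
  { extensionality x. now rewrite p1_pair, p2_pair. }
  set (X := fun z : nat => _).
  assert (K : forall e, HOK X H e).
  { intros e xs y. unfold hist, X. repeat rewrite ?p1_pair, ?p2_pair. rewrite dec_enc. cbn [Nat.eqb].
    destruct (excluded_middle_informative _) as [Q|Q]; split; intros A; auto; try discriminate.
    - destruct Q as (e' & E & Q). apply cp_inj in E. now subst.
    - exfalso; eauto. }
  assert (K' : forall e, here e X H).
  { intros e xs y. rewrite <- (enc_dec xs). rewrite (K e (dec xs) y). symmetry. apply step_spec.
    - apply Forall_forall; auto.
    - destruct e; auto. }
  induction e as [| |i| |f gs IHf IHgs|f g IHf IHg|f IHf] using prf_ind_list; cbn [Theta]; split; auto.
  split; auto. induction IHgs; cbn; auto.
Qed.

(** * Arithmetical relations with computable atoms *)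

(* [P ne X H], where [X] is column [1] of the set variable [0]; its atoms are computable
   relations, which are looked up in the table stored in column [0]. *)
Definition RDef (P : (nat -> nat) -> (nat -> bool) -> (nat -> bool) -> Prop) : Prop :=
  exists es phi, forall ne X H, Forall (HOK X H) es ->
    (sat ne (senv X H) phi <-> P ne (fun x => X (cpair 1 x)) H).

(** The conditions [Theta] for the finitely many programs used are added to the formula. Then every
    solution carries correct tables, and every [Xu] can be completed by them, so one existential set
    quantifier covers both. *)
Lemma RDef_form P : RDef P -> exists phi, forall ne H,
  (forall X, sat ne (senv X H) phi -> P ne (fun x => X (cpair 1 x)) H) /\
  (forall Xu, P ne Xu H -> exists X, sat ne (senv X H) phi).
Proof.
  intros (es & phi & HP).
  assert (Def (fun _ se => fold_right (fun e r => Theta e (se 0) (se 1) /\ r) True es)) as [psi HT].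
  { clear. induction es; cbn; auto using Def_True, Def_and, Def_Theta. }
  exists (fand phi psi). intros ne H. split.
  - intros X [A B]. apply HT in B. apply HP; auto. clear - B. cbn in B.
    induction es; constructor; cbn in B; [now apply Theta_HOK|tauto].
  - intros Xu A. destruct (hist_exists H Xu) as (X & E & T). exists X. cbn [sat]. split.
    + apply HP; [|now rewrite E]. apply Forall_forall. intros; now apply Theta_HOK.
    + apply HT. cbn. clear - T. induction es; cbn; auto.
Qed.

Lemma sigma11_intro P H B : RDef P ->
  (forall n, B n = true <-> exists Xu, P (ncons n (fun _ => 0)) Xu H) -> sigma11_in H B.
Proof.
  intros HP HB. destruct (RDef_form P HP) as [phi Hphi]. exists phi. intros n. rewrite HB.
  destruct (Hphi (ncons n (fun _ => 0)) H) as [A C]. split.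
  - intros [Xu Q]. eauto.
  - intros [X Q]. eauto.
Qed.

Lemma RDef_ext P Q : (forall ne X H, P ne X H <-> Q ne X H) -> RDef P -> RDef Q.
Proof.
  intros E (es & phi & A). exists es, phi. intros. rewrite <- E. auto.
Qed.
Lemma RDef_and P Q : RDef P -> RDef Q -> RDef (fun ne X H => P ne X H /\ Q ne X H).
Proof.
  intros (es & a & A) (es' & b & B). exists (es ++ es'), (fand a b). intros ne X H F.
  apply Forall_app in F as [F F']. cbn. now rewrite A, B by auto.
Qed.
Lemma RDef_or P Q : RDef P -> RDef Q -> RDef (fun ne X H => P ne X H \/ Q ne X H).
Proof.
  intros (es & a & A) (es' & b & B). exists (es ++ es'), (for_ a b). intros ne X H F.
  apply Forall_app in F as [F F']. cbn. now rewrite A, B by auto.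
Qed.
Lemma RDef_not P : RDef P -> RDef (fun ne X H => ~ P ne X H).
Proof.
  intros (es & a & A). exists es, (fneg a). intros ne X H F. cbn. now rewrite A by auto.
Qed.
Lemma RDef_impl P Q : RDef P -> RDef Q -> RDef (fun ne X H => P ne X H -> Q ne X H).
Proof.
  intros A B. eapply RDef_ext; [|apply (RDef_or _ _ (RDef_not _ A) B)].
  intros; cbn beta. tauto.
Qed.
Lemma RDef_iff P Q : RDef P -> RDef Q -> RDef (fun ne X H => P ne X H <-> Q ne X H).
Proof. intros A B. apply RDef_and; now apply RDef_impl. Qed.
Lemma RDef_all (Q : nat -> (nat -> nat) -> (nat -> bool) -> (nat -> bool) -> Prop) :
  RDef (fun ne X H => Q (ne 0) (fun i => ne (S i)) X H) ->
  RDef (fun ne X H => forall n, Q n ne X H).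
Proof.
  intros (es & a & A). exists es, (fall a). intros ne X H F. cbn.
  split; intros B n; [apply (A (ncons n ne) X H F), B|apply (A (ncons n ne) X H F); exact (B n)].
Qed.
Lemma RDef_ex (Q : nat -> (nat -> nat) -> (nat -> bool) -> (nat -> bool) -> Prop) :
  RDef (fun ne X H => Q (ne 0) (fun i => ne (S i)) X H) ->
  RDef (fun ne X H => exists n, Q n ne X H).
Proof.
  intros (es & a & A). exists es, (fex a). intros ne X H F. cbn.
  split; intros [n B]; exists n; apply (A (ncons n ne) X H F); exact B.
Qed.

Lemma DefF_enc_vars l : DefF (fun ne => enc (map ne l)).
Proof.
  induction l as [|i l IH]; cbn [map enc]; repeat def_step. apply IH.
Qed.
Lemma Cmp_local_vars (t : (nat -> nat) -> nat) N :
  (forall ne ne', (forall i, i < N -> ne i = ne' i) -> t ne = t ne') ->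
  forall ne, t (env (map ne (seq 0 N))) = t ne.
Proof.
  intros L ne. apply L. intros i Hi. unfold env.
  rewrite (nth_indep _ 0 (ne 0)) by (now rewrite length_map, length_seq).
  now rewrite map_nth, seq_nth.
Qed.
(** Evaluation is deterministic, hence a correct table holds exactly one value of [t] at the given
    arguments. *)
Lemma RDef_graph t : Cmp t -> RDef (fun ne _ _ => ne 0 = t (fun i => ne (S i))).
Proof.
  intros (e & N & E & L).
  destruct (Def_hist (fun _ => cp e) (fun ne => enc (map ne (map S (seq 0 N)))) (fun ne => ne 0))
    as [phi HP]; [apply DefF_const|apply DefF_enc_vars|apply DefF_var|].
  exists [e], phi. intros ne X H F. inversion F as [|? ? K _]; subst.
  rewrite HP. cbn [senv]. rewrite (K _ (ne 0)), map_map.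
  rewrite <- (Cmp_local_vars t N L (fun i => ne (S i))). split.
  - intros A. apply (eval_functional _ _ _ _ _ A (E H _)).
  - intros ->. apply E.
Qed.
Lemma RDef_eq t u : Cmp t -> Cmp u -> RDef (fun ne _ _ => t ne = u ne).
Proof.
  intros Ht Hu. eapply RDef_ext.
  2: { apply (RDef_ex (fun n ne _ _ => n = t ne /\ n = u ne)).
       apply RDef_and; now apply RDef_graph. }
  intros ne X H; cbn beta. split; [intros (n & -> & A); auto|intros A; exists (t ne); auto].
Qed.
Lemma RDef_bool p : CB p -> RDef (fun ne _ _ => p ne = true).
Proof.
  intros Hp. eapply RDef_ext; [|apply (RDef_eq _ _ Hp (Cmp_const 1))].
  intros ne X H; cbn beta. destruct (p ne); cbn; split; congruence.
Qed.
Lemma RDef_le t u : Cmp t -> Cmp u -> RDef (fun ne _ _ => t ne <= u ne).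
Proof.
  intros Ht Hu. eapply RDef_ext; [|apply (RDef_bool _ (CB_leb _ _ Ht Hu))].
  intros; cbn beta. apply Nat.leb_le.
Qed.
Lemma RDef_lt t u : Cmp t -> Cmp u -> RDef (fun ne _ _ => t ne < u ne).
Proof. intros Ht Hu. apply RDef_le; auto using Cmp_succ. Qed.
Lemma RDef_mem t : Cmp t -> RDef (fun ne X _ => X (t ne) = true).
Proof.
  intros Ht. eapply RDef_ext.
  2: { apply (RDef_ex (fun n ne X _ => n = t ne /\ X n = true)).
       apply RDef_and; [now apply RDef_graph|].
       destruct (Def_mem 0 (fun ne => cpair 1 (ne 0))) as [phi HP]; [repeat def_step|].
       exists [], phi. intros. now rewrite HP. }
  intros ne X H; cbn beta. split; [intros (n & -> & A); auto|intros A; exists (t ne); auto].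
Qed.
Lemma RDef_eval e t u : Cmp t -> Cmp u -> RDef (fun ne _ H => eval H e (dec (t ne)) (u ne)).
Proof.
  intros Ht Hu. eapply RDef_ext.
  2: { apply (RDef_ex (fun n ne _ H => n = cpair (t ne) (u ne) /\ eval H e (dec (p1 n)) (p2 n))).
       apply RDef_and; [apply (RDef_graph (fun ne => cpair (t ne) (u ne))); now apply Cmp_pair|].
       destruct (Def_mem 0 (fun ne => cpair 0 (cpair (cp e) (ne 0)))) as [phi HP]; [repeat def_step|].
       exists [e], phi. intros ne X H F. inversion F as [|? ? K _]; subst. rewrite HP. cbn [senv].
       rewrite <- (K _ (p2 (ne 0))), enc_dec. unfold hist. now rewrite pair_p. }
  intros ne X H; cbn beta. split.
  - intros (n & -> & A). now rewrite p1_pair, p2_pair in A.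
  - intros A. eexists. split; [reflexivity|]. now rewrite p1_pair, p2_pair.
Qed.


(** * Tarski trees *)

(* A path of the Tarski tree is a table [f] of truth values and term values.  The cell
   [cpair 0 (cpair a e)] holds the truth value of the formula coded by [a] in the environment
   coded by [e] ([0] for false, [S w] for true, where [w] is a witness in case of an
   existential formula), the cell [cpair 1 (cpair a e)] the value of the term [a], and
   [cpair (2 + j) v] tells whether [v] belongs to the set variable [j].  Tarski's conditions
   at a cell [c] involve at most two further cells [d1 c w] and [d2 c w (f (d1 c w))]. *)
Definition fc (c : nat) : nat := p1 (p2 c).
Definition fe (c : nat) : nat := p2 (p2 c).
Definition ft (c : nat) : nat := p1 (pred (fc c)).
Definition fr (c : nat) : nat := p2 (pred (fc c)).

Definition d1 (c w : nat) : nat :=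
  if p1 c =? 0 then
    if ft c =? 0 then cpair 1 (cpair (p2 (fr c)) (fe c)) else
    if ft c =? 1 then cpair 1 (cpair (p1 (fr c)) (fe c)) else
    if ft c =? 2 then cpair 0 (cpair (p1 (fr c)) (fe c)) else
    if ft c =? 3 then cpair 0 (cpair (fr c) (S (cpair w (fe c)))) else c
  else if p1 c =? 1 then
    if ft c =? 0 then cpair 1 (cpair (S (cpair 0 (pred (fr c)))) (p2 (pred (fe c)))) else
    if ft c =? 1 then c else
    if ft c =? 2 then cpair 1 (cpair (fr c) (fe c)) else cpair 1 (cpair (p1 (fr c)) (fe c))
  else c.
Definition d2 (c w x : nat) : nat :=
  if p1 c =? 0 then
    if ft c =? 0 then cpair (2 + p1 (fr c)) x else
    if ft c =? 1 then cpair 1 (cpair (p2 (fr c)) (fe c)) else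
    if ft c =? 2 then cpair 0 (cpair (p2 (fr c)) (fe c)) else c
  else if p1 c =? 1 then
    if 3 <=? ft c then cpair 1 (cpair (p2 (fr c)) (fe c)) else c
  else c.
(** Formula tags: 0 membership, 1 equality, 2 nand, 3 existential. Term tags: 0 variable, 1 zero, 2
    successor, 3 sum, 4 product. A de Bruijn variable is resolved by lowering its index and taking
    the tail of the environment. Among the set variables, the first is unconstrained, the second is
    the oracle and all others are empty. *)
Definition rule (h : bool) (c w x1 x2 y : nat) : bool :=
  if p1 c =? 0 then
    if ft c =? 0 then Bool.eqb (y =? 0) (x2 =? 0) else
    if ft c =? 1 then Bool.eqb (y =? 0) (negb (x1 =? x2)) else
    if ft c =? 2 then Bool.eqb (y =? 0) (negb (x1 =? 0) && negb (x2 =? 0)) else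
    if ft c =? 3 then
      implb (y =? 0) (x1 =? 0) && implb (y =? S w) (negb (x1 =? 0)) else true
  else if p1 c =? 1 then
    if ft c =? 0 then
      if fe c =? 0 then y =? 0 else if fr c =? 0 then y =? p1 (pred (fe c)) else y =? x1 else
    if ft c =? 1 then y =? 0 else
    if ft c =? 2 then y =? S x1 else
    if ft c =? 3 then y =? x1 + x2 else
    if ft c =? 4 then y =? x1 * x2 else true
  else if p1 c =? 2 then true
  else if p1 c =? 3 then Bool.eqb (y =? 0) (negb h) else y =? 0.

Definition tarski (H : nat -> bool) (f : nat -> nat) : Prop :=
  forall c w, rule (H (p2 c)) c w (f (d1 c w)) (f (d2 c w (f (d1 c w)))) (f c) = true.

Definition root (c : nat) : nat := cpair 0 (cpair (p1 c) (S (cpair (p2 c) 0))).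
(** A condition is imposed only when every cell that it involves lies inside the node. This makes
    the tree closed under tails, and membership of a node depends only on the oracle below its
    length. *)
Definition chk (H : nat -> bool) (l : list nat) (c w : nat) : bool :=
  implb ((d1 c w <? length l) && (d2 c w (rl l (d1 c w)) <? length l))
    (rule (H (p2 c)) c w (rl l (d1 c w)) (rl l (d2 c w (rl l (d1 c w)))) (rl l c)).
Definition Tr (c : nat) (H : nat -> bool) (l : list nat) : bool :=
  implb (root c <? length l) (negb (rl l (root c) =? 0)) &&
  ball (length l) (fun d => ball (length l) (fun w => chk H l d w)).

Lemma Tr_spec c H l : Tr c H l = true <->
  (root c < length l -> rl l (root c) <> 0) /\
  (forall d w, d < length l -> w < length l -> d1 d w < length l ->
    d2 d w (rl l (d1 d w)) < length l ->
    rule (H (p2 d)) d w (rl l (d1 d w)) (rl l (d2 d w (rl l (d1 d w)))) (rl l d) = true).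
Proof.
  unfold Tr, chk. rewrite andb_true_iff, ball_spec. split; intros [A B]; split.
  - intros L. apply Nat.ltb_lt in L. rewrite L in A. cbn in A. now apply negb_true_iff, Nat.eqb_neq in A.
  - intros d w L1 L2 L3 L4. specialize (B d L1). rewrite ball_spec in B. specialize (B w L2).
    apply Nat.ltb_lt in L3, L4. now rewrite L3, L4 in B.
  - destruct (Nat.ltb_spec (root c) (length l)) as [L|L]; cbn; auto.
    apply negb_true_iff, Nat.eqb_neq; auto.
  - intros d L1. apply ball_spec. intros w L2.
    destruct (Nat.ltb_spec (d1 d w) (length l)) as [L3|L3]; cbn [andb implb]; auto.
    destruct (Nat.ltb_spec (d2 d w (rl l (d1 d w))) (length l)) as [L4|L4]; cbn [andb implb]; auto.
Qed.

Lemma Tr_tail c H a l : Tr c H (a :: l) = true -> Tr c H l = true.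
Proof.
  rewrite !Tr_spec. cbn [length]. intros [A B]. split.
  - intros L. rewrite <- (rl_cons a) by auto. apply A; lia.
  - intros d w L1 L2 L3 L4. specialize (B d w). rewrite !rl_cons in B by auto.
    apply B; lia.
Qed.
Lemma Tr_local c H H' l : (forall x, x < length l -> H x = H' x) -> Tr c H l = Tr c H' l.
Proof.
  intros E. unfold Tr. f_equal. apply ball_ext. intros d Hd. apply ball_ext. intros w _.
  unfold chk. pose proof (p2_le d). now rewrite E by lia.
Qed.
Lemma Tr_path c H f : (forall k, Tr c H (pre f k) = true) <-> tarski H f /\ f (root c) <> 0.
Proof.
  split.
  - intros T. split.
    + intros d w. set (x := d1 d w). set (y := d2 d w (f x)). set (k := S (d + w + x + y)).
      destruct (proj1 (Tr_spec _ _ _) (T k)) as [_ B]. specialize (B d w).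
      rewrite length_pre in B. fold x in B.
      rewrite (rl_pre f k x) in B by (unfold k; lia). fold y in B.
      rewrite !rl_pre in B by (unfold k; lia). apply B; unfold k; lia.
    + destruct (proj1 (Tr_spec _ _ _) (T (S (root c)))) as [A _].
      rewrite length_pre, rl_pre in A by lia. apply A; lia.
  - intros [A B] k. apply Tr_spec. rewrite length_pre. split.
    + intros L. now rewrite rl_pre.
    + intros d w L1 L2 L3 L4. rewrite (rl_pre f k (d1 d w)) in * by auto.
      rewrite !rl_pre by auto. apply A.
Qed.

Lemma Cmp_fc c : Cmp c -> Cmp (fun ne => fc (c ne)).
Proof. intros. unfold fc. cmp. Qed.
Lemma Cmp_fe c : Cmp c -> Cmp (fun ne => fe (c ne)).
Proof. intros. unfold fe. cmp. Qed.
Lemma Cmp_ft c : Cmp c -> Cmp (fun ne => ft (c ne)).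
Proof. intros. unfold ft. apply Cmp_p1, Cmp_pred, Cmp_fc. auto. Qed.
Lemma Cmp_fr c : Cmp c -> Cmp (fun ne => fr (c ne)).
Proof. intros. unfold fr. apply Cmp_p2, Cmp_pred, Cmp_fc. auto. Qed.
Lemma Cmp_d1 c w : Cmp c -> Cmp w -> Cmp (fun ne => d1 (c ne) (w ne)).
Proof.
  apply (Cmp_comp2 d1). unfold d1.
  repeat first [apply Cmp_fe | apply Cmp_ft | apply Cmp_fr | apply Cmp_p1 | apply Cmp_p2 | cmp_step].
Qed.
Lemma Cmp_d2 c w x : Cmp c -> Cmp w -> Cmp x -> Cmp (fun ne => d2 (c ne) (w ne) (x ne)).
Proof.
  apply (Cmp_comp3 d2). unfold d2.
  repeat first [apply Cmp_fe | apply Cmp_ft | apply Cmp_fr | apply Cmp_p1 | apply Cmp_p2 | cmp_step].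
Qed.
Lemma CB_rule h c w x1 x2 y : CB h -> Cmp c -> Cmp w -> Cmp x1 -> Cmp x2 -> Cmp y ->
  CB (fun ne => rule (h ne) (c ne) (w ne) (x1 ne) (x2 ne) (y ne)).
Proof.
  intros. unfold rule.
  repeat first [assumption | apply Cmp_fe | apply Cmp_ft | apply Cmp_fr | apply Cmp_p1 | apply Cmp_p2
               | cmp_step].
Qed.
(** Oracles are restricted to finite sets given by codes; by [Tr_local] these suffice to decide any
    single node. *)
Lemma CB_Tr c E l : Cmp c -> Cmp E -> Cmp l ->
  CB (fun ne => Tr (c ne) (memb (dec (E ne))) (dec (l ne))).
Proof.
  intros Hc HE Hl.
  apply (Cmp_comp3 (fun c E l => b2n (Tr c (memb (dec E)) (dec l)))); auto.
  unfold Tr, chk, root. apply CB_andb; [cmp|].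
  apply CB_ball; [apply CB_ball|]; [|cmp|cmp].
  apply CB_implb; [apply CB_andb|].
  - apply CB_ltb; [apply Cmp_d1|]; cmp.
  - apply CB_ltb; [apply Cmp_d2|]; cmp. apply Cmp_d1; cmp.
  - apply CB_rule; cmp; repeat first [apply Cmp_d1 | apply Cmp_d2 | cmp].
Qed.

(** * Codes of formulas; soundness and completeness of Tarski trees *)

Fixpoint cT (t : term) : nat :=
  match t with
  | tvar i => S (cpair 0 i)
  | tzero => S (cpair 1 0)
  | tsucc t => S (cpair 2 (cT t))
  | tplus a b => S (cpair 3 (cpair (cT a) (cT b)))
  | tmult a b => S (cpair 4 (cpair (cT a) (cT b)))
  end.
(** Nand: with the existential quantifier it expresses all connectives, which keeps [rule] down to
    four formula tags. *)
Definition nd (a b : nat) : nat := S (cpair 2 (cpair a b)).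
Fixpoint cF (f : form) : nat :=
  match f with
  | fmem j t => S (cpair 0 (cpair j (cT t)))
  | feq a b => S (cpair 1 (cpair (cT a) (cT b)))
  | fneg g => nd (cF g) (cF g)
  | fand g h => nd (nd (cF g) (cF h)) (nd (cF g) (cF h))
  | for_ g h => nd (nd (cF g) (cF g)) (nd (cF h) (cF h))
  | fall g => nd (S (cpair 3 (nd (cF g) (cF g)))) (S (cpair 3 (nd (cF g) (cF g))))
  | fex g => S (cpair 3 (cF g))
  end.

Definition Xof (f : nat -> nat) (v : nat) : bool := negb (f (cpair 2 v) =? 0).

Lemma env_cons n e : env (dec (S (cpair n e))) = ncons n (env (dec e)).
Proof. rewrite dec_S, p1_pair, p2_pair. extensionality i. now destruct i. Qed.

Ltac cell_in T :=
  unfold rule, d2, d1, fe, fr, ft, fc in T;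
  repeat (rewrite ?p1_pair, ?p2_pair in T; cbn [Nat.eqb Nat.leb pred] in T).

Section Soundness.
Variables (H : nat -> bool) (f : nat -> nat).
Hypothesis Tf : tarski H f.

Lemma tarski_var i : forall e, f (cpair 1 (cpair (S (cpair 0 i)) e)) = env (dec e) i.
Proof.
  induction i as [|i IH]; intros e.
  - pose proof (Tf (cpair 1 (cpair (S (cpair 0 0)) e)) 0) as T. cell_in T.
    destruct e as [|e]; cbn [Nat.eqb] in T; apply Nat.eqb_eq in T; rewrite T; [reflexivity|].
    rewrite dec_S. reflexivity.
  - pose proof (Tf (cpair 1 (cpair (S (cpair 0 (S i))) e)) 0) as T. cell_in T.
    destruct e as [|e]; cbn [Nat.eqb pred] in T; apply Nat.eqb_eq in T; rewrite T; [reflexivity|].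
    rewrite IH, dec_S. reflexivity.
Qed.
Lemma tarski_term t : forall e, f (cpair 1 (cpair (cT t) e)) = teval (env (dec e)) t.
Proof.
  induction t as [i| |t IH|a IHa b IHb|a IHa b IHb]; intros e; cbn [cT teval].
  - apply tarski_var.
  - pose proof (Tf (cpair 1 (cpair (S (cpair 1 0)) e)) 0) as T; cell_in T. now apply Nat.eqb_eq in T.
  - pose proof (Tf (cpair 1 (cpair (S (cpair 2 (cT t))) e)) 0) as T; cell_in T.
    apply Nat.eqb_eq in T. now rewrite T, IH.
  - pose proof (Tf (cpair 1 (cpair (S (cpair 3 (cpair (cT a) (cT b)))) e)) 0) as T; cell_in T.
    apply Nat.eqb_eq in T. now rewrite T, IHa, IHb.
  - pose proof (Tf (cpair 1 (cpair (S (cpair 4 (cpair (cT a) (cT b)))) e)) 0) as T; cell_in T.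
    apply Nat.eqb_eq in T. now rewrite T, IHa, IHb.
Qed.

Definition holds (a e : nat) : Prop := f (cpair 0 (cpair a e)) <> 0.
Lemma tarski_nd a b e : holds (nd a b) e <-> ~ (holds a e /\ holds b e).
Proof.
  unfold holds. unfold nd. pose proof (Tf (cpair 0 (cpair (S (cpair 2 (cpair a b))) e)) 0) as T. cell_in T.
  apply Bool.eqb_prop in T. fold (nd a b) in *.
  destruct (Nat.eqb_spec (f (cpair 0 (cpair (nd a b) e))) 0) as [A|A];
    destruct (Nat.eqb_spec (f (cpair 0 (cpair a e))) 0) as [B|B];
    destruct (Nat.eqb_spec (f (cpair 0 (cpair b e))) 0) as [C|C]; cbn in T; try discriminate; tauto.
Qed.
Lemma tarski_ex a e : holds (S (cpair 3 a)) e <-> exists w, holds a (S (cpair w e)).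
Proof.
  unfold holds. split.
  - intros N. set (w := pred (f (cpair 0 (cpair (S (cpair 3 a)) e)))). exists w.
    pose proof (Tf (cpair 0 (cpair (S (cpair 3 a)) e)) w) as T. cell_in T.
    apply andb_true_iff in T as [_ T].
    replace (f (cpair 0 (cpair (S (cpair 3 a)) e)) =? S w) with true in T.
    + cbn in T. now apply negb_true_iff, Nat.eqb_neq in T.
    + symmetry. apply Nat.eqb_eq. unfold w. lia.
  - intros [w N] Z. pose proof (Tf (cpair 0 (cpair (S (cpair 3 a)) e)) w) as T. cell_in T.
    apply andb_true_iff in T as [T _]. rewrite Z in T. cbn in T. now apply Nat.eqb_eq in T.
Qed.
Lemma tarski_set j v : f (cpair (2 + j) v) <> 0 <-> senv (Xof f) H j v = true.
Proof.
  destruct j as [|[|j]]; cbn [senv].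
  - unfold Xof. rewrite negb_true_iff. symmetry. apply Nat.eqb_neq.
  - pose proof (Tf (cpair 3 v) 0) as T. cell_in T. apply Bool.eqb_prop in T. cbn [Nat.add].
    destruct (Nat.eqb_spec (f (cpair 3 v)) 0), (H v); cbn in T; try discriminate;
      split; auto; congruence.
  - pose proof (Tf (cpair (4 + j) v) 0) as T. cell_in T. apply Nat.eqb_eq in T.
    cbn [Nat.add] in *. split; [contradiction|discriminate].
Qed.

Lemma tarski_sat phi : forall e, holds (cF phi) e <-> sat (env (dec e)) (senv (Xof f) H) phi.
Proof.
  induction phi as [j t|a b|g IH|g IHg h IHh|g IHg h IHh|g IH|g IH]; intros e; cbn [cF sat].
  - rewrite <- tarski_set, <- tarski_term. unfold holds.
    pose proof (Tf (cpair 0 (cpair (S (cpair 0 (cpair j (cT t)))) e)) 0) as T. cell_in T.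
    apply Bool.eqb_prop in T.
    destruct (Nat.eqb_spec (f (cpair 0 (cpair (S (cpair 0 (cpair j (cT t)))) e))) 0) as [A|A];
      destruct (Nat.eqb_spec (f (cpair (2 + j) (f (cpair 1 (cpair (cT t) e))))) 0) as [B|B];
      try discriminate; tauto.
  - rewrite <- !tarski_term. unfold holds.
    pose proof (Tf (cpair 0 (cpair (S (cpair 1 (cpair (cT a) (cT b)))) e)) 0) as T. cell_in T.
    apply Bool.eqb_prop in T.
    destruct (Nat.eqb_spec (f (cpair 0 (cpair (S (cpair 1 (cpair (cT a) (cT b)))) e))) 0) as [A|A];
      destruct (Nat.eqb_spec (f (cpair 1 (cpair (cT a) e))) (f (cpair 1 (cpair (cT b) e)))) as [B|B];
      try discriminate; tauto.
  - rewrite tarski_nd, IH. tauto.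
  - rewrite !tarski_nd, IHg, IHh. tauto.
  - rewrite !tarski_nd, IHg, IHh. tauto.
  - rewrite tarski_nd, tarski_ex. split.
    + intros A n. apply NNPP. intros B. apply A. split; exists n; rewrite tarski_nd, IH, env_cons; tauto.
    + intros A [[w B] _]. rewrite tarski_nd, IH, env_cons in B. apply B. split; apply A.
  - rewrite tarski_ex. split; intros [w A]; exists w; [rewrite <- env_cons|]; apply IH; auto.
    now rewrite env_cons.
Qed.
End Soundness.

(** Tarski's conditions are imposed at every cell, including those whose number codes no formula.
    Decoding is therefore total, with a dummy value for unknown tags, and the table is defined
    through decoded formulas. *)
Fixpoint dTf (k n : nat) : term :=
  match k with
  | 0 => tzero
  | S k =>
    let t := p1 (pred n) in let r := p2 (pred n) in
    if t =? 0 then tvar r else if t =? 1 then tzero else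
    if t =? 2 then tsucc (dTf k r) else if t =? 3 then tplus (dTf k (p1 r)) (dTf k (p2 r)) else
    if t =? 4 then tmult (dTf k (p1 r)) (dTf k (p2 r)) else tzero
  end.
Fixpoint dFf (k n : nat) : form :=
  match k with
  | 0 => feq tzero tzero
  | S k =>
    let t := p1 (pred n) in let r := p2 (pred n) in
    if t =? 0 then fmem (p1 r) (dTf (S (p2 r)) (p2 r)) else
    if t =? 1 then feq (dTf (S (p1 r)) (p1 r)) (dTf (S (p2 r)) (p2 r)) else
    if t =? 2 then fneg (fand (dFf k (p1 r)) (dFf k (p2 r))) else
    if t =? 3 then fex (dFf k r) else feq tzero tzero
  end.
Definition dT (n : nat) : term := dTf (S n) n.
Definition dF (n : nat) : form := dFf (S n) n.

(** A tag of at least 2 excludes the code 0 and makes the parts strictly smaller, which is the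
    descent required by the fuel. *)
Lemma code_lt n t : p1 (pred n) = t -> 2 <= t ->
  p2 (pred n) < n /\ p1 (p2 (pred n)) < n /\ p2 (p2 (pred n)) < n.
Proof.
  intros E L. pose proof (pair_ge (p1 (pred n)) (p2 (pred n))) as G. rewrite pair_p in G.
  pose proof (p1_le (p2 (pred n))). pose proof (p2_le (p2 (pred n))). lia.
Qed.
Lemma dTf_stable k : forall k' n, n < k -> n < k' -> dTf k n = dTf k' n.
Proof.
  induction k as [|k IH]; intros [|k'] n L L'; try lia. cbn [dTf]. cbv zeta.
  destruct (Nat.eqb_spec (p1 (pred n)) 0); auto. destruct (Nat.eqb_spec (p1 (pred n)) 1); auto.
  destruct (Nat.eqb_spec (p1 (pred n)) 2) as [E|].
  { apply code_lt in E; auto. f_equal. apply IH; lia. }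
  destruct (Nat.eqb_spec (p1 (pred n)) 3) as [E|].
  { apply code_lt in E; [|lia]. f_equal; apply IH; lia. }
  destruct (Nat.eqb_spec (p1 (pred n)) 4) as [E|]; auto.
  apply code_lt in E; [|lia]. f_equal; apply IH; lia.
Qed.
Lemma dFf_stable k : forall k' n, n < k -> n < k' -> dFf k n = dFf k' n.
Proof.
  induction k as [|k IH]; intros [|k'] n L L'; try lia. cbn [dFf]. cbv zeta.
  destruct (Nat.eqb_spec (p1 (pred n)) 0); auto. destruct (Nat.eqb_spec (p1 (pred n)) 1); auto.
  destruct (Nat.eqb_spec (p1 (pred n)) 2) as [E|].
  { apply code_lt in E; auto. f_equal. f_equal; apply IH; lia. }
  destruct (Nat.eqb_spec (p1 (pred n)) 3) as [E|]; auto.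
  apply code_lt in E; [|lia]. f_equal; apply IH; lia.
Qed.
Lemma dT_eq n : dT n =
    let t := p1 (pred n) in let r := p2 (pred n) in
    if t =? 0 then tvar r else if t =? 1 then tzero else
    if t =? 2 then tsucc (dT r) else if t =? 3 then tplus (dT (p1 r)) (dT (p2 r)) else
    if t =? 4 then tmult (dT (p1 r)) (dT (p2 r)) else tzero.
Proof.
  unfold dT at 1. cbn [dTf]. cbv zeta.
  destruct (Nat.eqb_spec (p1 (pred n)) 0); auto. destruct (Nat.eqb_spec (p1 (pred n)) 1); auto.
  destruct (Nat.eqb_spec (p1 (pred n)) 2) as [E|].
  { apply code_lt in E; auto. f_equal. apply dTf_stable; lia. }
  destruct (Nat.eqb_spec (p1 (pred n)) 3) as [E|].
  { apply code_lt in E; [|lia]. f_equal; apply dTf_stable; lia. }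
  destruct (Nat.eqb_spec (p1 (pred n)) 4) as [E|]; auto.
  apply code_lt in E; [|lia]. f_equal; apply dTf_stable; lia.
Qed.
Lemma dF_eq n : dF n =
    let t := p1 (pred n) in let r := p2 (pred n) in
    if t =? 0 then fmem (p1 r) (dT (p2 r)) else
    if t =? 1 then feq (dT (p1 r)) (dT (p2 r)) else
    if t =? 2 then fneg (fand (dF (p1 r)) (dF (p2 r))) else
    if t =? 3 then fex (dF r) else feq tzero tzero.
Proof.
  unfold dF at 1. cbn [dFf]. cbv zeta.
  destruct (Nat.eqb_spec (p1 (pred n)) 0); auto. destruct (Nat.eqb_spec (p1 (pred n)) 1); auto.
  destruct (Nat.eqb_spec (p1 (pred n)) 2) as [E|].
  { apply code_lt in E; auto. f_equal. f_equal; apply dFf_stable; lia. }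
  destruct (Nat.eqb_spec (p1 (pred n)) 3) as [E|]; auto.
  apply code_lt in E; [|lia]. f_equal; apply dFf_stable; lia.
Qed.

Section Completeness.
Variables (X H : nat -> bool).

(** The witness of an outermost existential quantifier is exposed, because the cell of such a
    formula has to store it; for other formulas [w] is a dummy. *)
Definition truth (a e w : nat) : Prop :=
  match dF a with
  | fex g => sat (ncons w (env (dec e))) (senv X H) g
  | g => sat (env (dec e)) (senv X H) g
  end.
Definition table (c : nat) : nat :=
  if p1 c =? 0 then
    match excluded_middle_informative (exists w, truth (fc c) (fe c) w) with
    | left E => S (proj1_sig (constructive_indefinite_description _ E))
    | right _ => 0
    end
  else if p1 c =? 1 then teval (env (dec (fe c))) (dT (fc c))
  else b2n (senv X H (p1 c - 2) (p2 c)).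

Lemma truth_sat a e : (exists w, truth a e w) <-> sat (env (dec e)) (senv X H) (dF a).
Proof.
  unfold truth. destruct (dF a); try reflexivity; (split; [intros [_ A]; auto|exists 0; auto]).
Qed.
Lemma table_form a e : table (cpair 0 (cpair a e)) = 0 <-> ~ sat (env (dec e)) (senv X H) (dF a).
Proof.
  rewrite <- truth_sat. unfold table, fc, fe. rewrite ?p1_pair, ?p2_pair, ?p1_pair. cbn [Nat.eqb].
  destruct (excluded_middle_informative _); split; intros; try tauto; discriminate.
Qed.
Lemma table_term a e : table (cpair 1 (cpair a e)) = teval (env (dec e)) (dT a).
Proof. unfold table, fc, fe. now rewrite ?p1_pair, ?p2_pair, ?p1_pair. Qed.
Lemma table_set j v : table (cpair (2 + j) v) = b2n (senv X H j v).
Proof.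
  unfold table. rewrite p1_pair, p2_pair. cbn [Nat.add Nat.eqb].
  now replace (S (S j) - 2) with j by lia.
Qed.

Lemma table_tarski : tarski H table.
Proof.
  intros c w.
  destruct (Nat.eqb_spec (p1 c) 0) as [C0|C0].
  - assert (Ec : c = cpair 0 (cpair (fc c) (fe c))).
    { unfold fc, fe. now rewrite pair_p, <- C0, pair_p. }
    assert (Z : table c = 0 <-> ~ sat (env (dec (fe c))) (senv X H) (dF (fc c))).
    { rewrite Ec at 1. apply table_form. }
    unfold rule, d2, d1. rewrite C0. cbn [Nat.eqb].
    pose proof (dF_eq (fc c)) as D. cbv zeta in D. fold (ft c) (fr c) in D.
    destruct (Nat.eqb_spec (ft c) 0) as [T|T].
    { rewrite table_term, table_set. rewrite D in Z. cbn [sat] in Z. apply eqb_true_iff.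
      destruct (senv X H (p1 (fr c)) _); cbn [b2n Nat.eqb]; [apply Nat.eqb_neq|apply Nat.eqb_eq];
        intuition congruence. }
    destruct (Nat.eqb_spec (ft c) 1) as [T1|T1].
    { rewrite !table_term. rewrite D in Z. cbn [sat] in Z. apply eqb_true_iff.
      destruct (Nat.eqb_spec (teval (env (dec (fe c))) (dT (p1 (fr c))))
                  (teval (env (dec (fe c))) (dT (p2 (fr c))))); cbn;
        [apply Nat.eqb_neq|apply Nat.eqb_eq]; tauto. }
    destruct (Nat.eqb_spec (ft c) 2) as [T2|T2].
    { pose proof (table_form (p1 (fr c)) (fe c)) as Z1. pose proof (table_form (p2 (fr c)) (fe c)) as Z2.
      rewrite D in Z. cbn [sat] in Z. apply eqb_true_iff.
      destruct (Nat.eqb_spec (table c) 0);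
        destruct (Nat.eqb_spec (table (cpair 0 (cpair (p1 (fr c)) (fe c)))) 0);
        destruct (Nat.eqb_spec (table (cpair 0 (cpair (p2 (fr c)) (fe c)))) 0); cbn; auto; tauto. }
    destruct (Nat.eqb_spec (ft c) 3) as [T3|T3]; auto.
    pose proof (table_form (fr c) (S (cpair w (fe c)))) as Z1. rewrite env_cons in Z1.
    rewrite D in Z. cbn [sat] in Z. apply andb_true_iff. split.
    + destruct (Nat.eqb_spec (table c) 0) as [A|A]; cbn; auto. apply Nat.eqb_eq. apply Z1.
      intros B. apply Z in A. apply A. eauto.
    + destruct (Nat.eqb_spec (table c) (S w)) as [A|A]; cbn; auto. apply negb_true_iff, Nat.eqb_neq.
      intros B. apply Z1 in B. apply B. clear - A C0 D. unfold table in A. rewrite C0 in A. cbn [Nat.eqb] in A.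
      destruct (excluded_middle_informative _) as [Q|]; [|discriminate]. injection A as A.
      destruct (constructive_indefinite_description _ Q) as [w' Hw]. cbn in A. subst w'.
      unfold truth in Hw. now rewrite D in Hw.
  - destruct (Nat.eqb_spec (p1 c) 1) as [C1|C1].
    + assert (Z : table c = teval (env (dec (fe c))) (dT (fc c))).
      { unfold table. now rewrite C1. }
      unfold rule, d2, d1. rewrite C1. cbn [Nat.eqb].
      pose proof (dT_eq (fc c)) as D. cbv zeta in D. fold (ft c) (fr c) in D.
      destruct (Nat.eqb_spec (ft c) 0) as [T|T].
      { rewrite D in Z. cbn [teval] in Z. rewrite Z.
        destruct (Nat.eqb_spec (fe c) 0) as [E|E].
        - rewrite E. apply Nat.eqb_eq. unfold env. rewrite dec_0. now destruct (fr c).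
        - destruct (fe c) as [|e]; [lia|]. rewrite dec_S. cbn [pred].
          destruct (Nat.eqb_spec (fr c) 0) as [R|R]; [rewrite R; apply Nat.eqb_refl|].
          destruct (fr c) as [|r]; [lia|]. cbn [pred]. apply Nat.eqb_eq. rewrite table_term.
          rewrite dT_eq. cbv zeta. cbn [pred]. rewrite p1_pair, p2_pair. reflexivity. }
      destruct (Nat.eqb_spec (ft c) 1) as [T1|T1].
      { rewrite Z, D. reflexivity. }
      destruct (Nat.eqb_spec (ft c) 2) as [T2|T2].
      { rewrite Z, D, table_term. apply Nat.eqb_refl. }
      destruct (Nat.eqb_spec (ft c) 3) as [T3|T3].
      { rewrite T3. cbn [Nat.leb]. rewrite Z, D, !table_term. apply Nat.eqb_refl. }
      destruct (Nat.eqb_spec (ft c) 4) as [T4|T4]; auto.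
      rewrite T4. cbn [Nat.leb]. rewrite Z, D, !table_term. apply Nat.eqb_refl.
    + assert (Z : table c = b2n (senv X H (p1 c - 2) (p2 c))).
      { unfold table. apply Nat.eqb_neq in C0, C1. now rewrite C0, C1. }
      unfold rule. rewrite Z. apply Nat.eqb_neq in C0, C1. rewrite C0, C1.
      apply Nat.eqb_neq in C0, C1.
      destruct (Nat.eqb_spec (p1 c) 2); auto.
      destruct (Nat.eqb_spec (p1 c) 3) as [E|E].
      { rewrite E. cbn [Nat.sub senv]. now destruct (H (p2 c)). }
      destruct (p1 c) as [|[|[|[|j]]]]; try lia. reflexivity.
Qed.
Lemma Xof_table : Xof table = X.
Proof.
  extensionality v. unfold Xof. change 2 with (2 + 0). rewrite table_set. cbn [senv]. now destruct (X v).
Qed.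
End Completeness.

Lemma env_single n : env (dec (S (cpair n 0))) = ncons n (fun _ => 0).
Proof.
  rewrite env_cons. f_equal. extensionality i. unfold env. rewrite dec_0. now destruct i.
Qed.
Lemma Tr_sound phi n H f : (forall k, Tr (cpair (cF phi) n) H (pre f k) = true) ->
  sat (ncons n (fun _ => 0)) (senv (Xof f) H) phi.
Proof.
  intros P. apply Tr_path in P as [T R]. rewrite <- env_single. apply tarski_sat; auto.
  unfold holds. unfold root in R. now rewrite p1_pair, p2_pair in R.
Qed.
Lemma Tr_complete phi n H X : sat (ncons n (fun _ => 0)) (senv X H) phi ->
  exists f, forall k, Tr (cpair (cF phi) n) H (pre f k) = true.
Proof.
  intros P. exists (table X H). apply Tr_path. pose proof (table_tarski X H) as T. split; auto.
  unfold root. rewrite p1_pair, p2_pair. apply (tarski_sat H _ T phi). now rewrite env_single, Xof_table.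
Qed.

Definition path (T : list nat -> bool) (f : nat -> nat) : Prop := forall k, T (pre f k) = true.
(** Kleene's normal form: Sigma^1_1 predicates are ill-foundedness of a computable family of trees,
    uniformly in the formula, the argument and the oracle. *)
Lemma Tr_iff phi n H : (exists X, sat (ncons n (fun _ => 0)) (senv X H) phi) <->
  exists f, path (Tr (cpair (cF phi) n) H) f.
Proof.
  split; [intros [X A]; eapply Tr_complete; eauto|]. intros [f A]. exists (Xof f). now apply Tr_sound.
Qed.

(** * Comparison of trees *)

Definition tail_closed (T : list nat -> bool) : Prop := forall a l, T (a :: l) = true -> T l = true.
Definition child (T : list nat -> bool) (s' s : list nat) : Prop :=
  exists a, s' = a :: s /\ T s' = true.

Lemma path_or_wf T : tail_closed T -> (exists f, path T f) \/ Acc (child T) [].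
Proof.
  intros TC. destruct (classic (Acc (child T) [])) as [A|A]; auto. left.
  assert (N : forall s, exists a, ~ Acc (child T) s -> T (a :: s) = true /\ ~ Acc (child T) (a :: s)).
  { intros s. destruct (classic (exists a, T (a :: s) = true /\ ~ Acc (child T) (a :: s))) as [[a Ha]|Q].
    - exists a; auto.
    - exists 0. intros B. exfalso. apply B. constructor. intros s' (a & -> & Ta).
      apply NNPP. intros C. apply Q. eauto. }
  apply choice in N as [next Hn].
  set (s := fix s k := match k with 0 => [] | S k => next (s k) :: s k end).
  assert (B : forall k, ~ Acc (child T) (s k)).
  { induction k; cbn; auto. now apply Hn. }
  exists (fun k => next (s k)). intros k.
  assert (E : forall k, pre (fun k => next (s k)) k = s k) by (induction k0; cbn; congruence).
  rewrite E. apply (TC (next (s k))). now apply Hn.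
Qed.

Definition tmap (S T : list nat -> bool) (g : list nat -> list nat) : Prop :=
  forall l, S l = true -> T (g l) = true /\ length (g l) = length l /\
    forall a l', l = a :: l' -> tl (g l) = g l'.

Lemma tmap_path S T g f : tail_closed S -> tmap S T g -> path S f -> exists f', path T f'.
Proof.
  intros TC M P. exists (fun k => hd 0 (g (pre f (1 + k)))).
  assert (E : forall k, pre (fun k => hd 0 (g (pre f (1 + k)))) k = g (pre f k)).
  { induction k as [|k IH]; cbn [pre].
    - destruct (M _ (P 0)) as (_ & L & _). cbn in L. symmetry. now apply length_zero_iff_nil.
    - rewrite IH. destruct (M _ (P (1 + k))) as (_ & L & R). cbn [pre Nat.add] in *.
      rewrite <- (R _ _ eq_refl). destruct (g (f k :: pre f k)); [discriminate|reflexivity]. }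
  intros k. rewrite E. now apply M.
Qed.

Definition Sub (T : list nat -> bool) (s : list nat) : list nat -> bool := fun l => T (l ++ s).

(** Maps between the subtrees at level one are glued together. Nodes are stored newest first, so the
    level-one ancestor of [l] is given by its last entry; this entry is replaced by the chosen [b]
    and the rest is mapped by the chosen [g]. *)
Lemma tmap_assemble S T : T [] = true ->
  (forall a, S [a] = true -> exists b g, tmap (Sub S [a]) (Sub T [b]) g) ->
  tail_closed S -> exists g, tmap S T g.
Proof.
  intros T0 C TC.
  assert (C' : forall a, exists bg : nat * (list nat -> list nat),
    S [a] = true -> tmap (Sub S [a]) (Sub T [fst bg]) (snd bg)).
  { intros a. destruct (classic (S [a] = true)) as [A|A].
    - destruct (C a A) as (b & g & Hg). exists (b, g). auto.
    - exists (0, fun l => l). contradiction. }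
  apply choice in C' as [h Hh].
  exists (fun l => match l with [] => [] | _ =>
            let a := last l 0 in snd (h a) (removelast l) ++ [fst (h a)] end).
  assert (R : forall r a, S (r ++ [a]) = true -> S [a] = true).
  { induction r as [|x r IH]; intros a; cbn; auto. intros H. apply IH. now apply TC in H. }
  intros l Sl. destruct l as [|x l]; [split; auto; split; auto; discriminate|].
  remember (x :: l) as m eqn:Em.
  assert (E : m = removelast m ++ [last m 0]) by (apply app_removelast_last; subst; discriminate).
  set (a := last m 0) in *. set (r := removelast m) in *.
  assert (Sa : S [a] = true) by (apply (R r); now rewrite <- E).
  assert (Sr : Sub S [a] r = true) by (unfold Sub; now rewrite <- E).
  destruct (Hh a Sa r Sr) as (A & B & D).
  replace (match m with [] => [] | _ => _ end) with (snd (h a) r ++ [fst (h a)]) by now rewrite Em.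
  split; [exact A|]. split.
  - rewrite E, !length_app, B. reflexivity.
  - intros a0 l' E'. assert (a0 = x /\ l' = l) as [-> ->] by (split; congruence).
    cbv zeta. destruct l as [|y l].
    + assert (Er : length r = 0) by (unfold r; now rewrite Em). rewrite Er in B.
      apply length_zero_iff_nil in B. rewrite B. reflexivity.
    + assert (Er : r = x :: removelast (y :: l)) by (unfold r; rewrite Em; reflexivity).
      assert (Ea : last (y :: l) 0 = a) by (unfold a; rewrite Em; reflexivity).
      cbv zeta. rewrite Ea. rewrite <- (D _ _ Er).
      assert (snd (h a) r <> []) by (intros Z; rewrite Z, Er in B; discriminate).
      destruct (snd (h a) r); [congruence|reflexivity].
Qed.

Lemma Sub_cons T b t : Sub (Sub T t) [b] = Sub T (b :: t).
Proof. extensionality l. unfold Sub. now rewrite <- app_assoc. Qed.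
Lemma Sub_tail_closed T s : tail_closed T -> tail_closed (Sub T s).
Proof. intros TC a l. apply TC. Qed.

Lemma tmap_empty S T : tail_closed S -> S [] <> true -> exists g, tmap S T g.
Proof.
  intros TC E. exists (fun l => l). intros l Sl. exfalso. apply E.
  induction l; auto. apply IHl. now apply TC in Sl.
Qed.

(** If [T] has a path, a node goes to the initial segment of that path of the same length. Otherwise
    well-founded induction on the nodes of [T], for all [S] at once, replaces a comparison of
    ordinal ranks. *)
Lemma tree_comparable S T : tail_closed S -> tail_closed T ->
  (exists g, tmap S T g) \/ (exists g, tmap T S g).
Proof.
  intros TS TT. destruct (path_or_wf T TT) as [[f P]|A].
  - left. exists (fun l => pre f (length l)). intros l _. split; [apply P|].
    split; [apply length_pre|]. intros a l' ->. reflexivity.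
  - assert (G : forall t, Acc (child T) t -> forall S, tail_closed S ->
      (exists g, tmap S (Sub T t) g) \/ (exists g, tmap (Sub T t) S g)).
    { clear S TS A. intros t A. induction A as [t _ IH]. intros S TS.
      destruct (classic (S [] = true)) as [S0|S0]; [|left; now apply tmap_empty].
      destruct (classic (Sub T t [] = true)) as [T0|T0];
        [|right; apply tmap_empty; auto using Sub_tail_closed].
      destruct (classic (forall a, S [a] = true -> exists b g, tmap (Sub S [a]) (Sub (Sub T t) [b]) g))
        as [C|C].
      - left. now apply tmap_assemble.
      (* Some child [a] of [S] maps into no child of [T]. By the induction hypothesis every child of
         [T] then maps into this one child, which serves as image for all of them. *)
      - right. apply not_all_ex_not in C as [a C]. apply tmap_assemble; auto using Sub_tail_closed.
        intros b Tb. exists a. rewrite Sub_cons.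
        destruct (IH (b :: t)) with (S := Sub S [a]) as [[g Hg]|D]; auto using Sub_tail_closed.
        + now exists b.
        + exfalso. apply C. intros _. exists b, g. now rewrite Sub_cons. }
    destruct (G [] A S TS) as [[g Hg]|[g Hg]]; [left|right]; exists g;
      replace T with (Sub T []); auto; extensionality l; unfold Sub; now rewrite app_nil_r.
Qed.

(* A path [f] of [UT p q H] compares, for every [n], the trees [Tr (cpair p n) H] and
   [Tr (cpair q n) H]: [x |-> f (cpair n (S x))] maps the first to the second if
   [f (cpair n 0) = 0], and the second to the first otherwise. *)
Definition UT (p q : nat) (H : nat -> bool) (l : list nat) : bool :=
  ball (length l) (fun n => ball (length l) (fun x => implb (cpair n (S x) <? length l)
    (implb (Tr (if rl l (cpair n 0) =? 0 then cpair p n else cpair q n) H (dec x))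
       (Tr (if rl l (cpair n 0) =? 0 then cpair q n else cpair p n) H (dec (rl l (cpair n (S x)))) &&
        ((length (dec (rl l (cpair n (S x)))) =? length (dec x)) &&
         implb (negb (x =? 0))
           (p2 (pred (rl l (cpair n (S x)))) =? rl l (cpair n (S (p2 (pred x)))))))))).

Lemma UT_spec p q H l : UT p q H l = true <->
  forall n x, cpair n (S x) < length l ->
    let c := rl l (cpair n 0) in let y := rl l (cpair n (S x)) in
    Tr (if c =? 0 then cpair p n else cpair q n) H (dec x) = true ->
    Tr (if c =? 0 then cpair q n else cpair p n) H (dec y) = true /\
    length (dec y) = length (dec x) /\
    (x <> 0 -> p2 (pred y) = rl l (cpair n (S (p2 (pred x))))).
Proof.
  unfold UT. rewrite ball_spec. cbv zeta. split.
  - intros A n x L T. pose proof (pair_ge n (S x)).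
    assert (n < length l) as Ln by lia. specialize (A n Ln). rewrite ball_spec in A.
    assert (x < length l) as Lx by lia. specialize (A x Lx).
    apply Nat.ltb_lt in L. rewrite L, T in A. cbn [implb] in A.
    rewrite !andb_true_iff, Nat.eqb_eq in A. destruct A as (A & B & C). split; auto. split; auto.
    intros N. apply Nat.eqb_neq in N. rewrite N in C. now apply Nat.eqb_eq in C.
  - intros A n _. apply ball_spec. intros x _.
    destruct (Nat.ltb_spec (cpair n (S x)) (length l)) as [L|L]; cbn [implb]; auto.
    specialize (A n x L).
    destruct (Tr (if rl l (cpair n 0) =? 0 then cpair p n else cpair q n) H (dec x)); cbn [implb]; auto.
    destruct (A eq_refl) as (B & C & D). rewrite !andb_true_iff, Nat.eqb_eq. split; auto. split; auto.
    destruct (Nat.eqb_spec x 0); cbn; auto. apply Nat.eqb_eq. auto.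
Qed.

(** The switch for [n] and the image of the parent of [x] are stored before the image of [x], so
    cutting a node of [UT] leaves the remaining conditions intact. *)
Lemma pair_S_lt n x k : cpair n (S x) < k -> cpair n 0 < k /\ cpair n (S (p2 (pred x))) < k /\ x < k.
Proof.
  intros L. pose proof (pair_mono n 0 (S x)). pose proof (pair_mono n (S (p2 (pred x))) (S x)).
  pose proof (p2_le (pred x)). pose proof (pair_ge n (S x)). lia.
Qed.
Lemma UT_tail p q H : tail_closed (UT p q H).
Proof.
  intros a l. rewrite !UT_spec. cbv zeta. intros A n x L. pose proof (pair_S_lt _ _ _ L) as (L0 & L1 & _).
  specialize (A n x). rewrite !rl_cons in A by auto. apply A. cbn; lia.
Qed.
Lemma UT_local p q H H' l : (forall x, x < length l -> H x = H' x) -> UT p q H l = UT p q H' l.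
Proof.
  intros E. unfold UT. apply ball_ext. intros n _. apply ball_ext. intros x Lx.
  destruct (cpair n (S x) <? length l); cbn [implb]; auto. f_equal.
  - apply Tr_local. intros z Hz. pose proof (length_dec x). apply E; lia.
  - destruct (Nat.eqb_spec (length (dec (rl l (cpair n (S x))))) (length (dec x))) as [Q|Q];
      cbn [andb]; [|now rewrite !andb_false_r].
    f_equal. apply Tr_local. intros z Hz. pose proof (length_dec x). apply E; lia.
Qed.
Lemma CB_UT p q E l : Cmp p -> Cmp q -> Cmp E -> Cmp l ->
  CB (fun ne => UT (p ne) (q ne) (memb (dec (E ne))) (dec (l ne))).
Proof.
  apply (Cmp_comp4 (fun p q E l => b2n (UT p q (memb (dec E)) (dec l)))).
  unfold UT. repeat first [apply CB_Tr | progress cmp].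
Qed.

Lemma enc_tl l : p2 (pred (enc l)) = enc (tl l).
Proof. destruct l; cbn [enc pred tl]; [apply (p2_pair 0 0)|apply p2_pair]. Qed.

Lemma UT_has_path p q H : exists f, path (UT p q H) f.
Proof.
  assert (C : forall n, exists cg : nat * (list nat -> list nat),
    tmap (Tr (if fst cg =? 0 then cpair p n else cpair q n) H)
         (Tr (if fst cg =? 0 then cpair q n else cpair p n) H) (snd cg)).
  { intros n. destruct (tree_comparable (Tr (cpair p n) H) (Tr (cpair q n) H)) as [[g Hg]|[g Hg]].
    - intros a l. apply Tr_tail.
    - intros a l. apply Tr_tail.
    - exists (0, g). exact Hg.
    - exists (1, g). exact Hg. }
  apply choice in C as [h Hh].
  exists (fun z => match p2 z with 0 => fst (h (p1 z)) | S x => enc (snd (h (p1 z)) (dec x)) end).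
  set (f := fun z : nat => _). intros k. apply UT_spec. rewrite length_pre. intros n x L.
  pose proof (pair_S_lt _ _ _ L) as (L0 & L1 & _). rewrite !rl_pre by auto. cbv zeta.
  assert (F0 : f (cpair n 0) = fst (h n)) by (unfold f; now rewrite p1_pair, p2_pair).
  assert (F1 : forall x, f (cpair n (S x)) = enc (snd (h n) (dec x)))
    by (intros; unfold f; now rewrite p1_pair, p2_pair).
  rewrite F0, !F1, dec_enc. intros T. destruct (Hh n _ T) as (A & B & C). split; auto. split; auto.
  intros N. destruct x as [|x]; [lia|]. rewrite enc_tl. f_equal. cbn [pred].
  apply (C (p1 x)). apply dec_S.
Qed.

(** Tree maps carry paths forward, so an ill-founded source has an ill-founded target. As exactly
    one of the two trees is ill-founded, it must be the target, and the direction of the map tells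
    which one it is. *)
Lemma UT_decides p q H f n : path (UT p q H) f ->
  ((exists g, path (Tr (cpair p n) H) g) <-> ~ exists g, path (Tr (cpair q n) H) g) ->
  (f (cpair n 0) <> 0 <-> exists g, path (Tr (cpair p n) H) g).
Proof.
  intros P X.
  assert (M : exists g, tmap (Tr (if f (cpair n 0) =? 0 then cpair p n else cpair q n) H)
                (Tr (if f (cpair n 0) =? 0 then cpair q n else cpair p n) H) g).
  { exists (fun l => dec (f (cpair n (S (enc l))))). intros l T.
    pose proof (P (S (cpair n (S (enc l))))) as U. rewrite UT_spec in U.
    specialize (U n (enc l)). rewrite length_pre in U.
    pose proof (pair_S_lt n (enc l) _ (Nat.lt_succ_diag_r _)) as (L0 & L1 & _).
    rewrite !rl_pre in U by auto. cbv zeta in U. rewrite dec_enc in U.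
    destruct U as (A & B & C); auto. split; auto. split; auto.
    intros a l' ->. rewrite enc_tl in C. cbn [tl] in C. rewrite <- C by discriminate. apply tl_dec. }
  destruct M as [g M]. destruct (Nat.eqb_spec (f (cpair n 0)) 0) as [Z|Z].
  - split; [contradiction|]. intros [h Q]. exfalso. apply (proj1 X); [eauto|].
    eapply tmap_path; eauto. intros a l; apply Tr_tail.
  - split; auto. intros _. apply X. intros [h Q]. apply (proj1 X); [|eauto].
    eapply tmap_path; eauto. intros a l; apply Tr_tail.
Qed.

(** * Stems and reservoirs *)

Definition sub (X Y : nat -> bool) : Prop := forall x, X x = true -> Y x = true.
Definition above (x : nat) (F : list nat) : Prop := forall y, In y F -> y < x.

Inductive ext (X : nat -> bool) (F : list nat) : list nat -> Prop :=
| ext_refl : ext X F F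
| ext_cons F' x : ext X F F' -> X x = true -> above x F' -> ext X F (x :: F').

Lemma ext_trans X F F' F'' : ext X F F' -> ext X F' F'' -> ext X F F''.
Proof. intros A B. induction B; auto. now constructor. Qed.
Lemma ext_mono (X Y : nat -> bool) F F' : (forall x, X x = true -> In x F' -> Y x = true) ->
  ext X F F' -> ext Y F F'.
Proof.
  intros S A. induction A as [|F' x A IH Xx Ab]; constructor; auto.
  - apply IH. intros; apply S; cbn; auto.
  - apply S; cbn; auto.
Qed.
Lemma ext_sub X Y F F' : sub X Y -> ext X F F' -> ext Y F F'.
Proof. intros S. apply ext_mono. auto. Qed.
Lemma ext_incl X F F' : ext X F F' -> incl F F'.
Proof. induction 1; [apply incl_refl|now apply incl_tl]. Qed.
Lemma ext_new X F F' y : ext X F F' -> In y F' -> In y F \/ (X y = true /\ above y F).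
Proof.
  induction 1 as [|F' x A IH Xx Ab]; auto. intros [<-|I]; auto. right. split; auto.
  intros z Hz. apply Ab. now apply (ext_incl _ _ _ A).
Qed.

Lemma list_max_In F : list_max F <> 0 -> In (list_max F) F.
Proof.
  induction F as [|x F IH]; cbn; [lia|]. fold (list_max F). intros N.
  destruct (Nat.max_spec x (list_max F)) as [[L E]|[L E]]; rewrite E in *; auto.
Qed.
Lemma list_max_ge F x : In x F -> x <= list_max F.
Proof. intros H. pose proof (proj1 (list_max_le F (list_max F)) (le_n _)) as A. rewrite Forall_forall in A. auto. Qed.
Lemma list_max_incl F F' : incl F F' -> list_max F <= list_max F'.
Proof. intros I. apply list_max_le, Forall_forall. intros x Hx. now apply list_max_ge, I. Qed.
Lemma above_S F : above (S (list_max F)) F.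
Proof. intros y Hy. apply list_max_ge in Hy. lia. Qed.
Lemma above_le x y F : x <= y -> above x F -> above y F.
Proof. intros L A z Hz. specialize (A z Hz). lia. Qed.
Lemma above_dec x F : {above x F} + {~ above x F}.
Proof. apply excluded_middle_informative. Qed.

Lemma inf_above X m : infinite_set X -> infinite_set (fun x => X x && (m <=? x)).
Proof.
  intros I k. destruct (I (k + m)) as (n & L & Xn). exists n. split; [lia|]. rewrite Xn.
  cbn. apply Nat.leb_le. lia.
Qed.
Lemma sub_andb_l X p : sub (fun x => X x && p x) X.
Proof. intros x H. now apply andb_true_iff in H. Qed.
Lemma sub_trans X Y Z : sub X Y -> sub Y Z -> sub X Z.
Proof. unfold sub; auto. Qed.

Section Fusion.
Variables (F0 : list nat) (P : list nat -> (nat -> bool) -> Prop).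
Hypothesis dense : forall F X, infinite_set X -> exists X', infinite_set X' /\ sub X' X /\ P F X'.
(** Only the reservoir beyond the stem counts. The fused set also contains points chosen before the
    reservoir for [F] was fixed, but these are not above [F]. *)
Hypothesis hered : forall F X Y, P F X -> (forall x, Y x = true -> above x F -> X x = true) -> P F Y.

Lemma dense_list Fs : forall X, infinite_set X ->
  exists X', infinite_set X' /\ sub X' X /\ forall F, In F Fs -> P F X'.
Proof.
  induction Fs as [|F Fs IH]; intros X I.
  - exists X. split; auto. split; [intros x; auto|]. contradiction.
  - destruct (dense F X I) as (X1 & I1 & S1 & P1). destruct (IH X1 I1) as (X2 & I2 & S2 & P2).
    exists X2. split; auto. split; [eapply sub_trans; eauto|]. intros G [<-|HG]; auto.
    eapply hered; eauto.
Qed.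

(** Each stage chooses a point above all stems listed so far, adds the stems prolonged by it to the
    list, and thins the reservoir so that [P] holds for this finite list. The chosen points form the
    new set. *)
Lemma fusion X : infinite_set X ->
  exists X', infinite_set X' /\ sub X' X /\ forall F, ext X' F0 F -> P F X'.
Proof.
  intros I.
  assert (N : forall st : list (list nat) * (nat -> bool), exists r : nat * (nat -> bool),
    infinite_set (snd st) ->
    snd st (fst r) = true /\ (forall F, In F (fst st) -> above (fst r) F) /\
    infinite_set (snd r) /\ (forall y, snd r y = true -> snd st y = true /\ fst r < y) /\
    forall F, In F (fst st ++ map (cons (fst r)) (fst st)) -> P F (snd r)).
  { intros [Fs Y]. cbn. destruct (classic (infinite_set Y)) as [IY|]; [|exists (0, Y); contradiction].
    destruct (IY (S (list_max (concat Fs)))) as (x & L & Yx).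
    destruct (dense_list (Fs ++ map (cons x) Fs) (fun y => Y y && (S x <=? y)) (inf_above _ _ IY))
      as (Z & IZ & SZ & PZ).
    exists (x, Z). cbn. intros _. split; auto. split.
    { intros F HF y Hy. assert (In y (concat Fs)) as Q by (apply in_concat; eauto).
      apply list_max_ge in Q. lia. }
    split; auto. split; auto. intros y Hy. apply SZ in Hy. apply andb_true_iff in Hy as [A B].
    split; auto. now apply Nat.leb_le in B. }
  apply choice in N as [nx Hnx].
  destruct (dense F0 X I) as (X0 & I0 & S0 & P0).
  set (st := fix st k := match k with
    | 0 => ([F0], X0)
    | S k => (fst (st k) ++ map (cons (fst (nx (st k)))) (fst (st k)), snd (nx (st k))) end).
  set (xs := fun k => fst (nx (st k))).
  assert (IS : forall k, infinite_set (snd (st k))).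
  { induction k as [|k IH]; cbn; auto. now destruct (Hnx (st k) IH) as (_ & _ & A & _). }
  assert (M : forall k j, k <= j -> sub (snd (st j)) (snd (st k)) /\ incl (fst (st k)) (fst (st j))).
  { intros k j L. induction L as [|j L [IH1 IH2]]; [split; [intros x; auto|apply incl_refl]|].
    destruct (Hnx (st j) (IS j)) as (_ & _ & _ & A & _). split.
    - intros x Hx. apply IH1. now apply A.
    - intros x Hx. cbn. apply in_app_iff. auto. }
  assert (XS : forall k, snd (st k) (xs k) = true) by (intros k; now destruct (Hnx (st k) (IS k))).
  assert (LT : forall k j, k < j -> xs k < xs j).
  { intros k j L. destruct (Hnx (st k) (IS k)) as (_ & _ & _ & A & _).
    apply A. apply (M (S k) j L). apply XS. }
  set (Y := fun x => if excluded_middle_informative (exists k, x = xs k) then true else false).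
  assert (HY : forall x, Y x = true <-> exists k, x = xs k).
  { intros x. unfold Y. destruct (excluded_middle_informative _); split; auto; discriminate. }
  assert (GE : forall k, k <= xs k).
  { induction k; [lia|]. specialize (LT k (S k)). lia. }
  exists Y. split; [|split].
  - intros m. exists (xs m). split; auto. apply HY. eauto.
  - intros x Hx. apply HY in Hx as [k ->]. apply S0. apply (M 0 k); [lia|]. apply XS.
  - assert (C : forall F, ext Y F0 F -> forall j, above (xs j) F -> In F (fst (st j))).
    { intros F E. induction E as [|F x E IH Yx Ab]; intros j A.
      - apply (M 0 j); [lia|]. cbn; auto.
      - apply HY in Yx as [i ->]. assert (i < j) as L.
        { destruct (le_lt_dec j i) as [L|L]; auto. exfalso.
          assert (xs i < xs j) by (apply A; cbn; auto).
          destruct (Nat.eq_dec j i) as [->|]; [lia|]. specialize (LT j i). lia. }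
        apply (M (S i) j L). cbn. apply in_app_iff. right. apply in_map. auto. }
    intros F E. destruct E as [|F x E Yx Ab].
    + eapply hered; [apply P0|]. intros x Hx _. apply HY in Hx as [k ->].
      apply (M 0 k); [lia|]. apply XS.
    + apply HY in Yx as [i ->]. specialize (C F E i Ab).
      destruct (Hnx (st i) (IS i)) as (_ & _ & _ & _ & Q).
      eapply hered; [apply Q; apply in_app_iff; right; apply in_map, C|].
      intros y Hy A. apply HY in Hy as [j ->].
      assert (i < j) as L.
      { assert (xs i < xs j) by (apply A; cbn; auto).
        destruct (le_lt_dec j i) as [L|L]; auto. destruct (Nat.eq_dec j i) as [->|]; [lia|].
        specialize (LT j i). lia. }
      apply (M (S i) j L). apply XS.
Qed.
End Fusion.

Definition lies (F : list nat) (X H : nat -> bool) : Prop :=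
  (forall y, In y F -> H y = true) /\ forall y, H y = true -> In y F \/ (X y = true /\ above y F).

Lemma lies_exists F X : infinite_set X -> exists H, infinite_set H /\ lies F X H.
Proof.
  intros I. exists (fun y => memb F y || (X y && if above_dec y F then true else false)).
  split; [|split].
  - intros m. destruct (I (max m (S (list_max F)))) as (n & L & Xn). exists n. split; [lia|].
    rewrite Xn. destruct (above_dec n F) as [|A]; [apply orb_true_r|].
    exfalso. apply A. eapply above_le; [|apply above_S]. lia.
  - intros y Hy. apply memb_In in Hy. now rewrite Hy.
  - intros y Hy. apply orb_true_iff in Hy as [Hy|Hy]; [left; now apply memb_In|].
    apply andb_true_iff in Hy as [A B]. destruct (above_dec y F); [auto|discriminate].
Qed.

Definition sfx (s l : list nat) : Prop :=
  length s <= length l /\ forall i, i < length s -> rl l i = rl s i.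
Lemma sfx_refl s : sfx s s.
Proof. split; auto. Qed.
Lemma sfx_trans s l m : sfx s l -> sfx l m -> sfx s m.
Proof. intros [A B] [C D]. split; [lia|]. intros i Hi. rewrite D by lia. auto. Qed.
Lemma sfx_cons a s : sfx s (a :: s).
Proof. split; [cbn; lia|]. intros. now apply rl_cons. Qed.

(** * Continuous selection of paths *)

Section Selection.
Variable U : (nat -> bool) -> list nat -> bool.
Hypothesis U_local : forall H H' l, (forall x, x < length l -> H x = H' x) -> U H l = U H' l.
Hypothesis U_path : forall H, exists f, path (U H) f.

Definition null (F s : list nat) (X : nat -> bool) : Prop :=
  forall H f, infinite_set H -> lies F X H -> path (U H) f -> pre f (length s) = s -> False.

Lemma null_mono F s X Y : null F s X -> (forall x, Y x = true -> above x F -> X x = true) -> null F s Y.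
Proof.
  intros N S H f I [A B] P E. apply (N H f I); auto. split; auto.
  intros y Hy. destruct (B y Hy) as [|[C D]]; auto.
Qed.

(** Nullness passes to smaller reservoirs but its failure does not, hence the quantifier over all
    infinite subsets. *)
Definition positive (X1 : nat -> bool) (F s : list nat) : Prop :=
  forall X, infinite_set X -> sub X X1 -> ~ null F s X.

Lemma decide_dense F m X : infinite_set X -> exists X', infinite_set X' /\ sub X' X /\
  forall c, c < m -> null F (dec c) X' \/ positive X' F (dec c).
Proof.
  intros I. induction m as [|m (X' & I' & S' & D')].
  - exists X. split; auto. split; [intros x; auto|lia].
  - destruct (classic (exists Z, infinite_set Z /\ sub Z X' /\ null F (dec m) Z)) as [(Z & IZ & SZ & NZ)|Q].
    + exists Z. split; auto. split; [eapply sub_trans; eauto|]. intros c Lc.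
      destruct (Nat.eq_dec c m) as [->|]; auto. destruct (D' c) as [A|A]; [lia| |].
      * left. eapply null_mono; eauto.
      * right. intros W IW SW. apply A; auto. eapply sub_trans; eauto.
    + exists X'. split; auto. split; auto. intros c Lc.
      destruct (Nat.eq_dec c m) as [->|]; [|apply D'; lia].
      right. intros W IW SW NW. apply Q. eauto.
Qed.

Lemma positive_hered F X Y s : positive X F s -> (forall x, Y x = true -> above x F -> X x = true) ->
  positive Y F s.
Proof.
  intros PX SY Z IZ SZ NZ.
  apply (PX (fun x => Z x && (S (list_max F) <=? x))).
  - now apply inf_above.
  - intros x Hx. apply andb_true_iff in Hx as [A B]. apply SY; [now apply SZ|].
    apply Nat.leb_le in B. eapply above_le; [apply B|apply above_S].
  - eapply null_mono; eauto. intros x Hx _. now apply andb_true_iff in Hx.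
Qed.

Section Reservoir.
Variables (F0 : list nat) (X1 : nat -> bool).
(** The bound by the maximum of the stem leaves finitely many nodes to decide for each stem, as
    density requires, while every node is reached once the stem has grown. *)
Hypothesis decided : forall F, ext X1 F0 F ->
  forall c, c <= list_max F -> null F (dec c) X1 \/ positive X1 F (dec c).

Definition stable (F : list nat) (X : nat -> bool) : Prop :=
  ext X1 F0 F -> forall c, c <= list_max F -> positive X1 F (dec c) ->
  forall x, X x = true -> X1 x = true -> above x F -> positive X1 (x :: F) (dec c).

(** If infinitely many points [x] spoiled the positivity of a node, let [Z] be the set of them. Any
    [H] with stem [F] and further points in [Z] has a least new point [x], so it lies beyond the
    stem [x :: F], where the node is null. The node would be null for [F] and [Z], against
    positivity. Hence for each of the finitely many nodes almost all points are harmless. *)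
Lemma stable_dense F X : infinite_set X -> exists X', infinite_set X' /\ sub X' X /\ stable F X'.
Proof.
  intros I. destruct (classic (ext X1 F0 F)) as [E|E].
  2: { exists X. split; auto. split; [intros x; auto|]. intros ?; contradiction. }
  assert (B : forall c, c <= list_max F -> positive X1 F (dec c) -> exists m, forall x,
    m <= x -> X1 x = true -> above x F -> positive X1 (x :: F) (dec c)).
  { intros c Lc Pc. apply NNPP. intros Q.
    set (Z := fun x => X1 x && if excluded_middle_informative (above x F /\ ~ positive X1 (x :: F) (dec c))
                               then true else false).
    assert (HZ : forall x, Z x = true -> X1 x = true /\ above x F /\ null (x :: F) (dec c) X1).
    { intros x Hx. apply andb_true_iff in Hx as [A B].
      destruct (excluded_middle_informative _) as [[C D]|]; [|discriminate]. split; auto. split; auto.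
      assert (E' : ext X1 F0 (x :: F)) by now constructor.
      assert (L' : c <= list_max (x :: F)) by (cbn; fold (list_max F); lia).
      destruct (decided _ E' c L') as [N|N]; [auto|contradiction]. }
    apply (Pc Z).
    - intros m. apply NNPP. intros R. apply Q. exists m. intros x L Xx Ab. apply NNPP. intros N. apply R.
      exists x. split; auto. unfold Z. rewrite Xx. cbn. destruct (excluded_middle_informative _); tauto.
    - intros x Hx. now apply HZ.
    - intros H f IH [A B] P Ef.
      assert (exists x, H x = true /\ ~ In x F) as (x0 & Hx0 & Nx0).
      { destruct (IH (S (list_max F))) as (x & L & Hx). exists x. split; auto. intros J.
        apply list_max_ge in J. lia. }
      assert (exists x, (H x = true /\ ~ In x F) /\ forall y, H y = true /\ ~ In y F -> x <= y)
        as (x & (Hx & Nx) & Mx).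
      { clear - Hx0 Nx0. revert Hx0 Nx0. induction x0 as [x0 IH] using lt_wf_ind. intros Hx0 Nx0.
        destruct (classic (exists y, y < x0 /\ H y = true /\ ~ In y F)) as [(y & L & C & D)|Q].
        - now apply (IH y).
        - exists x0. split; auto. intros y Hy. apply Nat.nlt_ge. intros L. apply Q. exists y; tauto. }
      destruct (B x Hx) as [J|[Zx _]]; [contradiction|]. apply HZ in Zx as (X1x & Abx & Nl).
      apply (Nl H f); auto. split; [intros y [<-|J]; auto|].
      intros y Hy. destruct (classic (In y F)) as [J|J]; [left; cbn; auto|].
      destruct (Nat.eq_dec x y) as [->|Nxy]; [left; cbn; auto|]. right.
      destruct (B y Hy) as [|[Zy _]]; [contradiction|]. apply HZ in Zy as (X1y & Aby & _).
      split; auto. intros z [<-|Hz]; [|auto]. specialize (Mx y (conj Hy J)). lia. }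
  assert (exists m, forall c, c <= list_max F -> positive X1 F (dec c) ->
    forall x, m <= x -> X1 x = true -> above x F -> positive X1 (x :: F) (dec c)) as [m Hm].
  { revert B. generalize (list_max F) as N. intros N.
    assert (forall k, k <= N -> (forall c, c <= N -> positive X1 F (dec c) -> exists m, forall x,
      m <= x -> X1 x = true -> above x F -> positive X1 (x :: F) (dec c)) ->
      exists m, forall c, c <= k -> positive X1 F (dec c) ->
      forall x, m <= x -> X1 x = true -> above x F -> positive X1 (x :: F) (dec c)) as G.
    { induction k as [|k IH]; intros L B.
      - destruct (classic (positive X1 F (dec 0))) as [P|P].
        + destruct (B 0 L P) as [m Hm]. exists m. intros c Lc. replace c with 0 by lia. auto.
        + exists 0. intros c Lc. replace c with 0 by lia. contradiction.
      - destruct IH as [m Hm]; [lia|auto|]. destruct (classic (positive X1 F (dec (S k)))) as [P|P].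
        + destruct (B _ L P) as [m' Hm']. exists (max m m'). intros c Lc Pc x Lx.
          destruct (Nat.eq_dec c (S k)) as [->|]; [apply Hm'; lia|apply Hm; auto; lia].
        + exists m. intros c Lc Pc x Lx. destruct (Nat.eq_dec c (S k)) as [->|]; [contradiction|].
          apply Hm; auto; lia. }
    intros B. apply G; auto. }
  exists (fun x => X x && (m <=? x)). split; [now apply inf_above|]. split; [apply sub_andb_l|].
  intros _ c Lc Pc x Hx X1x Ab. apply andb_true_iff in Hx as [_ L]. apply Nat.leb_le in L. eauto.
Qed.
Lemma stable_hered F X Y : stable F X -> (forall x, Y x = true -> above x F -> X x = true) -> stable F Y.
Proof. intros S A E c Lc Pc x Hx X1x Ab. apply S; auto. Qed.

Variable X2 : nat -> bool.
Hypothesis I2 : infinite_set X2.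
Hypothesis S2 : sub X2 X1.
Hypothesis stab : forall F, ext X2 F0 F -> stable F X2.

Lemma positive_ext F F' s : ext X2 F0 F -> ext X2 F F' -> enc s <= list_max F ->
  positive X1 F s -> positive X1 F' s.
Proof.
  intros E0 E L Ps. induction E as [|F' x E IH X2x Ab]; auto.
  rewrite <- (dec_enc s). assert (ext X2 F0 F') by (eapply ext_trans; eauto). apply stab; auto.
  - eapply ext_sub; eauto.
  - apply (Nat.le_trans _ _ _ L). now apply list_max_incl, (ext_incl X2).
  - now rewrite dec_enc.
Qed.

(** The selected node. Whenever the stem receives a point, the current node is prolonged by one
    positive child if there is one whose code is within the bound up to which nodes are decided;
    otherwise it stays. *)
Fixpoint psi (F : list nat) : list nat :=
  if list_eq_dec Nat.eq_dec F F0 then [] else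
  match F with
  | [] => []
  | _ :: F' =>
      match excluded_middle_informative
        (exists k, enc (k :: psi F') <= list_max F /\ positive X1 F (k :: psi F')) with
      | left E => proj1_sig (constructive_indefinite_description _ E) :: psi F'
      | right _ => psi F'
      end
  end.

Lemma ext_length X F F' : ext X F F' -> length F <= length F'.
Proof. induction 1; cbn; lia. Qed.
Lemma psi_start : psi F0 = [].
Proof.
  assert (forall F, F = F0 -> psi F = []) as A; [|now apply A].
  intros [|x F] E; cbn [psi]; (destruct (list_eq_dec _ _ F0); [reflexivity|contradiction]).
Qed.
Lemma psi_step F x : ext X2 F0 F ->
  (exists k, psi (x :: F) = k :: psi F /\ enc (k :: psi F) <= list_max (x :: F) /\
     positive X1 (x :: F) (k :: psi F)) \/
  (psi (x :: F) = psi F /\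
     ~ exists k, enc (k :: psi F) <= list_max (x :: F) /\ positive X1 (x :: F) (k :: psi F)).
Proof.
  intros E. cbn [psi]. destruct (list_eq_dec _ _ _) as [Q|_].
  { exfalso. apply ext_length in E. rewrite <- Q in E. cbn in E. lia. }
  destruct (excluded_middle_informative _) as [W|W]; [left|right; auto].
  destruct (constructive_indefinite_description _ W) as [k Hk]. exists k. cbn [proj1_sig]. tauto.
Qed.

Lemma psi_invariant F : ext X2 F0 F -> positive X1 F (psi F) /\ enc (psi F) <= list_max F.
Proof.
  induction 1 as [|F x E [IH1 IH2] X2x Ab].
  (* The empty node is positive because [U H] has a path for every [H]. *)
  - rewrite psi_start. split; [|cbn; lia]. intros X IX _ N. destruct (lies_exists F0 X IX) as (H & IH & LH).
    destruct (U_path H) as [f P]. apply (N H f); auto.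
  - destruct (psi_step F x E) as [(k & -> & A & B)|[-> _]]; auto. split.
    + apply (positive_ext F); auto. constructor; auto. constructor.
    + cbn. fold (list_max F). lia.
Qed.
Lemma psi_mono F F' : ext X2 F0 F -> ext X2 F F' -> sfx (psi F) (psi F').
Proof.
  intros E0 E. induction E as [|F' x E IH X2x Ab]; [apply sfx_refl|].
  destruct (psi_step F' x) as [(k & -> & _)|[-> _]]; auto; [eapply ext_trans; eauto|].
  eapply sfx_trans; [apply IH|apply sfx_cons].
Qed.
(** Positivity at [F'] yields an actual [H] with a path through the node. The length of the node is
    at most the maximum of [F'], and all further points of [H] are larger, so [H] and the finite set
    [F'] agree as far as [U] looks. *)
Lemma psi_in_tree F F' : ext X2 F0 F -> ext X2 F F' -> U (memb F') (psi F) = true.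
Proof.
  intros E0 E. destruct (psi_invariant F E0) as [Ps L].
  pose proof (positive_ext F F' (psi F) E0 E L Ps) as Ps'.
  apply NNPP. intros N. apply (Ps' X2 I2 S2). intros H f IH [A B] P Q. apply N. rewrite <- Q, <- (P (length (psi F))).
  apply U_local. rewrite length_pre. intros x Lx.
  pose proof (length_enc (psi F)). pose proof (list_max_incl F F' (ext_incl _ _ _ E)).
  apply eq_true_iff_eq. rewrite memb_In. split; auto. intros Hx.
  destruct (B x Hx) as [|[_ Ab]]; auto. exfalso.
  assert (In (list_max F') F') as J by (apply list_max_In; lia). specialize (Ab _ J). lia.
Qed.
(** Positivity provides some [H'] inside [H] and a path through the current node. The child taken by
    this path is decided at a long enough finite part of [H'], and it cannot be null there, since
    [H'] and the path witness the contrary. So it is positive. *)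
Lemma psi_grow F H : ext X2 F0 F -> infinite_set H -> sub H X2 ->
  exists F', ext H F F' /\ length (psi F) < length (psi F').
Proof.
  intros E IH SH. destruct (psi_invariant F E) as [Ps L].
  assert (exists F' k, ext H F F' /\ enc (k :: psi F) <= list_max F' /\ positive X1 F' (k :: psi F))
    as (F' & k & E' & Lk & Pk).
  { apply NNPP. intros Q. apply (Ps H IH); [eapply sub_trans; eauto|].
    intros H' f IH' [A B] P Ef. set (s := psi F) in *. set (k := f (length s)).
    assert (Ek : pre f (length (k :: s)) = k :: s) by (cbn [length pre]; now rewrite Ef).
    (* The stem [F] together with the points of [H'] below [m]. *)
    assert (G : forall m, exists F', ext H F F' /\ (forall y, In y F' -> H' y = true) /\
      (forall y, H' y = true -> y < m -> In y F') /\ (forall y, In y F' -> In y F \/ y < m)).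
    { induction m as [|m (F' & E1 & E2 & E3 & E4)].
      - exists F. split; [constructor|]. split; auto. split; [lia|auto].
      - destruct (classic (H' m = true /\ ~ In m F')) as [[C D]|C].
        + exists (m :: F'). assert (~ In m F) as NF by (intros J; apply D; now apply (ext_incl _ _ _ E1)).
          destruct (B m C) as [|[Hm Am]]; [contradiction|].
          split.
          { constructor; auto. intros y Hy. destruct (E4 y Hy) as [J|J]; auto. }
          split; [intros y [<-|J]; auto|]. split.
          * intros y Hy Ly. destruct (Nat.eq_dec y m) as [->|]; [cbn; auto|]. right. apply E3; auto; lia.
          * intros y [<-|J]; [right; lia|]. destruct (E4 y J); [auto|right; lia].
        + exists F'. split; auto. split; auto. split.
          * intros y Hy Ly. destruct (Nat.eq_dec y m) as [->|]; [|apply E3; auto; lia].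
            apply NNPP. intros D. auto.
          * intros y J. destruct (E4 y J); [auto|right; lia]. }
    destruct (IH' (S (enc (k :: s) + list_max F))) as (y & Ly & Hy).
    destruct (G (S y)) as (F' & E1 & E2 & E3 & E4).
    assert (In y F') as Jy by (apply E3; auto).
    assert (enc (k :: s) <= list_max F') as Lk by (apply list_max_ge in Jy; lia).
    assert (ext X1 F0 F') as E1'.
    { eapply ext_trans; [eapply ext_sub; [apply S2|apply E]|].
      eapply ext_sub; [eapply sub_trans; [apply SH|apply S2]|apply E1]. }
    destruct (decided F' E1' (enc (k :: s)) Lk) as [N|N]; rewrite dec_enc in N.
    - apply (N H' f); auto. split; auto. intros z Hz.
      destruct (classic (In z F')) as [J|J]; auto. right. split.
      + destruct (B z Hz) as [J'|[J' _]]; [exfalso; apply J; now apply (ext_incl _ _ _ E1)|].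
        now apply S2, SH.
      + assert (y < z) as Lz.
        { apply Nat.nle_gt. intros Lz. apply J, E3; auto. lia. }
        intros w Hw. destruct (E4 w Hw) as [J'|J']; [apply list_max_ge in J'; lia|lia].
    - apply Q. exists F', k. auto. }
  assert (EX : ext X2 F F') by (eapply ext_sub; eauto).
  (* One more point is needed, since [psi] looks for a child only when a point is added. *)
  destruct (IH (S (list_max F'))) as (x & Lx & Hx).
  exists (x :: F'). assert (above x F') as Ab by (eapply above_le; [apply Lx|apply above_S]).
  split; [now constructor|].
  assert (E'' : ext X2 F0 F') by (eapply ext_trans; eauto).
  destruct (psi_step F' x E'') as [(j & -> & _)|[Eq NE]].
  - pose proof (psi_mono F F' E EX) as [A _]. cbn. lia.
  - apply Nat.nle_gt. intros C. apply NE. exists k.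
    assert (psi F' = psi F) as ->.
    { pose proof (psi_mono F F' E EX) as [A B]. rewrite Eq in C.
      rewrite <- (pre_rl (psi F)), <- (pre_rl (psi F')).
      replace (length (psi F')) with (length (psi F)) by lia. apply pre_ext. auto. }
    split; [change (list_max (x :: F')) with (max x (list_max F')); lia|].
    apply (positive_ext F'); auto. constructor; auto. constructor.
Qed.
Lemma psi_total F H k : ext X2 F0 F -> infinite_set H -> sub H X2 ->
  exists F', ext H F F' /\ k <= length (psi F').
Proof.
  intros E IH SH. induction k as [|k (F' & E' & L)].
  - exists F. split; [constructor|lia].
  - destruct (psi_grow F' H) as (F'' & E'' & L'); auto.
    { eapply ext_trans; [apply E|]. eapply ext_sub; eauto. }
    exists F''. split; [eapply ext_trans; eauto|lia].
Qed.
End Reservoir.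

(** Two fusions are made in succession, because stability speaks of positivity for the reservoir
    [X1], which must be fixed first. The bound of the length by the maximum of the stem is kept for
    later: long outputs force large elements into the generic set. *)
Theorem selection F0 X : infinite_set X -> exists X' ps, infinite_set X' /\ sub X' X /\
  (forall F, ext X' F0 F -> length (ps F) <= list_max F /\
     forall F', ext X' F F' -> sfx (ps F) (ps F') /\ U (memb F') (ps F) = true) /\
  (forall F H k, ext X' F0 F -> infinite_set H -> sub H X' ->
     exists F', ext H F F' /\ k <= length (ps F')).
Proof.
  intros I.
  destruct (fusion F0 (fun F X' => forall c, c <= list_max F -> null F (dec c) X' \/ positive X' F (dec c)))
    with (X := X) as (X1 & I1 & S1 & D1); auto.
  { intros F Y IY. destruct (decide_dense F (S (list_max F)) Y IY) as (Y' & A & B & C).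
    exists Y'. split; auto. split; auto. intros c Lc. apply C. lia. }
  { intros F Y Y' A B c Lc. destruct (A c Lc) as [N|N]; [left; eapply null_mono; eauto|].
    right. eapply positive_hered; eauto. }
  destruct (fusion F0 (stable F0 X1)) with (X := X1) as (X2 & I2 & S2 & D2); auto.
  { intros F Y IY. now apply stable_dense. }
  { apply stable_hered. }
  exists X2, (psi F0 X1). split; auto. split; [eapply sub_trans; eauto|]. split.
  - intros F E. split.
    + destruct (psi_invariant F0 X1 X2 S2 D2 F E) as [_ L].
      pose proof (length_enc (psi F0 X1 F)). lia.
    + intros F' E'. split; [eapply psi_mono; eauto|eapply psi_in_tree; eauto].
  - intros F H k E IH SH. eapply psi_total; eauto.
Qed.
End Selection.

(** * Compactness for partitions *)

(** Compactness of Cantor space for a decreasing sequence of conditions, the [m]-th of which depends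
    on the values below [m]. *)
Lemma konig (Fail : nat -> (nat -> bool) -> Prop) :
  (forall m D D', (forall x, x < m -> D x = D' x) -> Fail m D -> Fail m D') ->
  (forall m D, Fail (S m) D -> Fail m D) ->
  (forall m, exists D, Fail m D) -> exists Z, forall m, Fail m Z.
Proof.
  intros Loc Mon Ex.
  assert (Mon' : forall m k D, m <= k -> Fail k D -> Fail m D).
  { intros m k D L. induction L; auto. }
  set (good := fun k (D : nat -> bool) => forall m, exists D', (forall x, x < k -> D' x = D x) /\ Fail m D').
  assert (N : forall kD : nat * (nat -> bool), exists D', good (fst kD) (snd kD) ->
    good (S (fst kD)) D' /\ forall x, x < fst kD -> D' x = snd kD x).
  { intros [k D]. cbn. destruct (classic (good k D)) as [G|G]; [|exists D; contradiction].
    set (u := fun b x => if x =? k then b else D x).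
    destruct (classic (good (S k) (u true))) as [A|A]; [|destruct (classic (good (S k) (u false))) as [B|B]].
    - exists (u true). intros _. split; auto. intros x L. unfold u. destruct (Nat.eqb_spec x k); auto; lia.
    - exists (u false). intros _. split; auto. intros x L. unfold u. destruct (Nat.eqb_spec x k); auto; lia.
    - exfalso. apply not_all_ex_not in A as [m A], B as [m' B].
      destruct (G (max m m')) as (D' & E & Q). destruct (D' k) eqn:Dk.
      + apply A. exists D'. split; [|eapply Mon'; [|apply Q]; lia]. intros x L. unfold u.
        destruct (Nat.eqb_spec x k) as [->|]; auto. apply E; lia.
      + apply B. exists D'. split; [|eapply Mon'; [|apply Q]; lia]. intros x L. unfold u.
        destruct (Nat.eqb_spec x k) as [->|]; auto. apply E; lia. }
  apply choice in N as [nx Hnx].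
  set (D := fix D k := match k with 0 => fun _ => false | S k => nx (k, D k) end).
  assert (G : forall k, good k (D k)).
  { induction k; [|now apply (Hnx (k, D k))]. intros m. destruct (Ex m) as [D' HD]. exists D'. split; auto; lia. }
  assert (C : forall k j x, x < k -> k <= j -> D j x = D k x).
  { intros k j x Lx L. induction L as [|j L IH]; auto. rewrite <- IH. apply (Hnx (j, D j)); [apply G|cbn; lia]. }
  exists (fun x => D (S x) x). intros m. destruct (G m m) as (D' & E & Q). eapply Loc; [|apply Q].
  intros x L. rewrite E by auto. apply C; lia.
Qed.

(** Below [m] a partition is a finite set, so the quantifier over all partitions is one over codes
    [D]. The question is then arithmetical, although it bears on partitions outside the model. *)
Definition covers (X : nat -> bool) (F0 F1 : list nat) (g0 g1 : list nat -> Prop) (m : nat) : Prop :=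
  forall D : nat,
  (exists F : nat, ext (fun x => X x && (x <? m) && memb (dec D) x) F0 (dec F) /\ g0 (dec F)) \/
  (exists F : nat, ext (fun x => X x && (x <? m) && negb (memb (dec D) x)) F1 (dec F) /\ g1 (dec F)).

Lemma restrict_list (Z : nat -> bool) m : exists D, forall x, x < m -> memb D x = Z x.
Proof.
  exists (filter Z (seq 0 m)). intros x L. apply eq_true_iff_eq. rewrite memb_In, filter_In, in_seq.
  intuition lia.
Qed.

Lemma uncovered X F0 F1 (g0 g1 : list nat -> Prop) : (forall m, ~ covers X F0 F1 g0 g1 m) ->
  exists Z : nat -> bool,
    (forall F, ext (fun x => X x && Z x) F0 F -> ~ g0 F) /\
    (forall F, ext (fun x => X x && negb (Z x)) F1 F -> ~ g1 F).
Proof.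
  intros N.
  destruct (konig (fun m Z =>
    (forall F, ext (fun x => X x && (x <? m) && Z x) F0 F -> ~ g0 F) /\
    (forall F, ext (fun x => X x && (x <? m) && negb (Z x)) F1 F -> ~ g1 F))) as [Z HZ].
  - intros m D D' E [A B]. split; intros F EF; [apply A|apply B]; revert EF; apply ext_mono;
      intros x Hx _; rewrite !andb_true_iff in *; destruct Hx as [[Hx L] Dx]; (split; [auto|]);
      apply Nat.ltb_lt in L; rewrite E; auto.
  - intros m D [A B]. split; intros F EF; [apply A|apply B]; revert EF; apply ext_mono;
      intros x Hx _; rewrite !andb_true_iff, Nat.ltb_lt in *; intuition lia.
  - intros m. apply NNPP. intros R. apply (N m). intros D. apply NNPP. intros T. apply R.
    exists (memb (dec D)). apply not_or_and in T as [T1 T2]. split; intros F EF G.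
    + apply T1. exists (enc F). rewrite dec_enc. auto.
    + apply T2. exists (enc F). rewrite dec_enc. auto.
  - exists Z. split; intros F EF; apply (HZ (S (list_max F))); revert EF; apply ext_mono;
      intros x Hx J; apply list_max_ge in J; rewrite !andb_true_iff, Nat.ltb_lt in *; intuition lia.
Qed.

Lemma infinite_split X (Z : nat -> bool) : infinite_set X ->
  exists C s, infinite_set C /\ sub C X /\ forall x, C x = true -> Z x = s.
Proof.
  intros I. destruct (classic (infinite_set (fun x => X x && Z x))) as [A|A].
  - exists (fun x => X x && Z x), true. split; auto. split; [apply sub_andb_l|].
    intros x Hx. now apply andb_true_iff in Hx.
  - exists (fun x => X x && negb (Z x)), false. split; [|split; [apply sub_andb_l|]].
    + intros m. apply NNPP. intros N. apply A. intros m'.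
      destruct (I (max m m')) as (x & L & Xx). exists x. split; [lia|]. rewrite Xx. cbn.
      destruct (Z x) eqn:E; auto. exfalso. apply N. exists x. split; [lia|]. now rewrite Xx, E.
    + intros x Hx. apply andb_true_iff in Hx as [_ Hx]. now apply negb_true_iff.
Qed.

Definition refuted (C : nat -> bool) (F : list nat) (g : list nat -> Prop) : Prop :=
  forall F', ext C F (dec F') -> ~ g (dec F').

(** Each value of the bit [b] has its own counterexample partition, and [C] is homogeneous for both.
    If it lies on the first side of both partitions, [g0] is refuted for both bits; if it lies on
    the second side of one of them, [g1] is refuted. *)
Lemma uncovered_reservoir X F0 F1 (g0 : bool -> list nat -> Prop) g1 : infinite_set X ->
  (forall b, ~ exists m, covers X F0 F1 (g0 b) g1 m) ->
  exists C, infinite_set C /\ sub C X /\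
    ((forall b, refuted C F0 (g0 b)) \/ refuted C F1 g1).
Proof.
  intros I N.
  destruct (uncovered X F0 F1 (g0 true) g1) as (Z1 & A1 & B1); [intros m H; apply (N true); eauto|].
  destruct (uncovered X F0 F1 (g0 false) g1) as (Z0 & A0 & B0); [intros m H; apply (N false); eauto|].
  destruct (infinite_split X Z1 I) as (C1 & s1 & I1 & S1 & E1).
  destruct (infinite_split C1 Z0 I1) as (C & s0 & IC & SC & E0).
  assert (SX : sub C X) by (eapply sub_trans; eauto).
  exists C. split; auto. split; auto.
  destruct s1; [destruct s0|].
  - left. intros [|] F EF; [apply A1|apply A0]; revert EF; apply ext_sub; intros x Hx;
      rewrite (SX x Hx); [rewrite (E1 x)|rewrite (E0 x)]; auto.
  - right. intros F EF. apply B0. revert EF. apply ext_sub. intros x Hx.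
    rewrite (SX x Hx), (E0 x); auto.
  - right. intros F EF. apply B1. revert EF. apply ext_sub. intros x Hx.
    rewrite (SX x Hx), (E1 x); auto.
Qed.

(** * Sequences by dependent choice and limits of nodes *)

Lemma generic_sequence {C : Type} (Ok : C -> Prop) (le : C -> C -> Prop) (D : nat -> C -> Prop) c0 :
  Ok c0 -> (forall c n, Ok c -> exists c', Ok c' /\ le c' c /\ D n c') ->
  exists s : nat -> C, s 0 = c0 /\ (forall k, Ok (s k)) /\ forall k, le (s (S k)) (s k) /\ D k (s (S k)).
Proof.
  intros O0 N.
  assert (N' : forall cn : C * nat, exists c', Ok (fst cn) -> Ok c' /\ le c' (fst cn) /\ D (snd cn) c').
  { intros [c n]. cbn. destruct (classic (Ok c)) as [O|O]; [|exists c; contradiction].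
    destruct (N c n O) as [c' H]. eauto. }
  apply choice in N' as [nx Hnx].
  set (s := fix s k := match k with 0 => c0 | S k => nx (s k, k) end).
  assert (OK : forall k, Ok (s k)).
  { induction k; auto. now destruct (Hnx (s k, k) IHk). }
  exists s. split; auto. split; auto. intros k. apply (Hnx (s k, k)). apply OK.
Qed.

Lemma limit_path (s : nat -> list nat) :
  (forall k, sfx (s k) (s (S k))) -> (forall k, k <= length (s k)) ->
  exists f, forall k, pre f (length (s k)) = s k.
Proof.
  intros M L.
  assert (M' : forall j k, j <= k -> sfx (s j) (s k)).
  { intros j k H. induction H; [apply sfx_refl|]. eapply sfx_trans; eauto. }
  exists (fun i => rl (s (S i)) i). intros k. rewrite <- (pre_rl (s k)) at 2. apply pre_ext. intros i Hi.
  destruct (le_lt_dec (S i) k) as [H|H].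
  - symmetry. apply (M' _ _ H). specialize (L (S i)). lia.
  - apply (M' k (S i)); auto. lia.
Qed.
Lemma tail_closed_sfx T s l : tail_closed T -> sfx s l -> T l = true -> T s = true.
Proof.
  intros TC [A B]. rewrite <- (pre_rl s), <- (pre_rl l).
  rewrite <- (pre_ext (rl l) (rl s)) by auto. induction A as [|m A IH]; auto.
  intros H. apply IH. apply (TC _ _ H).
Qed.
Lemma sfx_pre_le f j k : j <= k -> sfx (pre f j) (pre f k).
Proof.
  intros L. split; rewrite ?length_pre; auto. intros i Hi. rewrite !rl_pre by lia. reflexivity.
Qed.
Lemma pre_sfx f l : pre f (length l) = l -> forall k, length l <= k -> sfx l (pre f k).
Proof. intros E k L. rewrite <- E. now apply sfx_pre_le. Qed.

(** * Definability of stems *)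

(** The computable part of [ext]: the old stem is the end of the list, since points are added in
    front, and the added points decrease along the list and exceed the old ones. *)
Definition extb (F F' : list nat) : bool :=
  (length F <=? length F') &&
  ball (length F) (fun i => nth (length F' - length F + i) F' 0 =? nth i F 0) &&
  ball (length F' - length F) (fun i => ball (length F') (fun j =>
    implb (i <? j) (nth j F' 0 <? nth i F' 0))).

Lemma ext_iff X F F' : ext X F F' <-> extb F F' = true /\
  forall z, (exists i, i < length F' - length F /\ z = nth i F' 0) -> X z = true.
Proof.
  unfold extb. rewrite !andb_true_iff, !ball_spec, Nat.leb_le. split.
  - induction 1 as [|F' x E IH Xx Ab].
    + rewrite Nat.sub_diag. split; [|intros z (i & Hi & _); lia]. split; [|lia]. split; [lia|].
      intros i _. apply Nat.eqb_refl.
    + destruct IH as (((L & A) & B) & C). cbn [length]. rewrite Nat.sub_succ_l by auto.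
      split; [split; [split; [lia|]|]|].
      * intros i Hi. apply (A i Hi).
      * intros [|i] Hi; apply ball_spec; intros [|j] Hj; try reflexivity.
        -- cbn [nth implb Nat.ltb Nat.leb]. apply Nat.ltb_lt. apply Ab, nth_In. lia.
        -- assert (i < length F' - length F) as Hi' by lia. specialize (B i Hi').
           rewrite ball_spec in B. apply (B j). lia.
      * intros z ([|i] & Hi & ->); auto. apply C. exists i. split; auto. lia.
  - intros (((L & A) & B) & C). remember (length F' - length F) as d eqn:Ed.
    revert F' L A B C Ed. induction d as [|d IH]; intros F' L A B C Ed.
    + assert (F = F') as ->; [|constructor]. apply (nth_ext _ _ 0 0); [lia|].
      intros n Hn. specialize (A n Hn). apply Nat.eqb_eq in A. auto.
    + destruct F' as [|x F']; [cbn in Ed; lia|]. cbn [length] in *. constructor.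
      * apply IH; try lia.
        -- apply A.
        -- intros i Hi. apply ball_spec. intros j Hj. specialize (B (S i)).
           rewrite ball_spec in B. apply (B ltac:(lia) (S j)). lia.
        -- intros z (i & Hi & ->). apply C. exists (S i). split; [lia|reflexivity].
      * apply C. exists 0. split; [lia|reflexivity].
      * intros y Hy. apply (In_nth _ _ 0) in Hy as (j & Hj & <-). specialize (B 0).
        rewrite ball_spec in B. specialize (B ltac:(lia) (S j) ltac:(lia)). now apply Nat.ltb_lt in B.
Qed.
Lemma RDef_stem (X : nat -> (nat -> nat) -> (nat -> bool) -> (nat -> bool) -> bool) F F' :
  RDef (fun ne Y H => X (ne 0) (fun i => ne (S i)) Y H = true) -> Cmp F -> Cmp F' ->
  RDef (fun ne Y H => ext (fun z => X z ne Y H) (dec (F ne)) (dec (F' ne))).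
Proof.
  intros HX HF HF'. eapply RDef_ext.
  { intros ne Y H. symmetry. apply ext_iff. }
  apply RDef_and.
  - apply RDef_bool. apply (Cmp_comp2 (fun F F' => b2n (extb (dec F) (dec F')))); auto.
    unfold extb. cmp.
  - apply (RDef_all (fun z ne Y H => (exists i, i < length (dec (F' ne)) - length (dec (F ne)) /\
      z = nth i (dec (F' ne)) 0) -> X z ne Y H = true)).
    apply RDef_impl; auto. eapply RDef_ext.
    2: { apply (RDef_bool (fun ne => bex (length (dec (F' (fun i => ne (S i)))) - length (dec (F (fun i => ne (S i)))))
           (fun i => ne 0 =? nth i (dec (F' (fun i => ne (S i)))) 0))).
         destruct HF as (e & N & A & B), HF' as (e' & N' & A' & B').
         assert (W : forall G : (nat -> nat) -> nat, Cmp G -> forall k, Cmp (fun ne => G (fun i => ne (k + i)))).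
         { clear. intros G (e & N & A & B) k.
           pose proof (Cmp_subst G (map (fun i ne => ne (k + i)) (seq 0 N))) as Q.
           eapply Cmp_ext; [|apply Q].
           - intros ne; cbn beta. apply B. intros i Hi. rewrite map_map.
             rewrite (nth_indep _ 0 ((fun i => ne (k + i)) 0)) by (rewrite length_map, length_seq; lia).
             rewrite (map_nth (fun i => ne (k + i))), seq_nth by lia. reflexivity.
           - exists e, N; auto.
           - apply Forall_map, Forall_forall. intros; apply Cmp_var. }
         assert (HF : Cmp F) by (exists e, N; auto). assert (HF' : Cmp F') by (exists e', N'; auto).
         apply CB_bex.
         - apply CB_eqb; [apply Cmp_var|]. apply Cmp_nth; [apply Cmp_var|apply (W F' HF' 2)].
         - apply Cmp_sub; apply Cmp_length; [apply (W F' HF' 1)|apply (W F HF 1)]. }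
    intros ne Y H; cbn beta. rewrite bex_spec. split; intros (i & Hi & E); exists i; split; auto;
      now apply Nat.eqb_eq.
Qed.

Lemma RDef_andb P Q : RDef (fun ne X H => P ne X H = true) -> RDef (fun ne X H => Q ne X H = true) ->
  RDef (fun ne X H => P ne X H && Q ne X H = true).
Proof.
  intros A B. eapply RDef_ext; [|apply (RDef_and _ _ A B)]. intros; cbn beta. now rewrite andb_true_iff.
Qed.
Lemma RDef_allb (P : bool -> (nat -> nat) -> (nat -> bool) -> (nat -> bool) -> Prop) :
  RDef (P true) -> RDef (P false) -> RDef (fun ne X H => forall b, P b ne X H).
Proof.
  intros A B. eapply RDef_ext; [|apply (RDef_and _ _ A B)]. intros; cbn beta. split.
  - intros [? ?] [|]; auto.
  - auto.
Qed.
Lemma RDef_exb (P : bool -> (nat -> nat) -> (nat -> bool) -> (nat -> bool) -> Prop) :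
  RDef (P true) -> RDef (P false) -> RDef (fun ne X H => exists b, P b ne X H).
Proof.
  intros A B. eapply RDef_ext; [|apply (RDef_or _ _ A B)]. intros; cbn beta. split.
  - intros [?|?]; eauto.
  - intros [[|] ?]; auto.
Qed.

Definition col (X : nat -> bool) (i : nat) : nat -> bool := fun x => X (cpair i x).
Lemma RDef_col i t : Cmp i -> Cmp t -> RDef (fun ne X _ => col X (i ne) (t ne) = true).
Proof. intros. unfold col. apply RDef_mem. now apply Cmp_pair. Qed.

Ltac rdef := repeat (cbv beta; lazymatch goal with
  | |- Cmp _ => cmp
  | |- CB _ => cmp
  | |- RDef (fun ne X H => forall b : bool, _) => apply RDef_allb
  | |- RDef (fun ne X H => exists b : bool, _) => apply RDef_exb
  | |- RDef (fun ne X H => forall n : nat, _) => apply RDef_all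
  | |- RDef (fun ne X H => exists n : nat, _) => apply RDef_ex
  | |- RDef (fun ne X H => _ /\ _) => apply RDef_and
  | |- RDef (fun ne X H => _ \/ _) => apply RDef_or
  | |- RDef (fun ne X H => _ <-> _) => apply RDef_iff
  | |- RDef (fun ne X H => ~ _) => apply RDef_not
  | |- RDef (fun ne X H => _ < _) => apply RDef_lt
  | |- RDef (fun ne X H => _ <= _) => apply RDef_le
  | |- RDef (fun ne X H => @eq nat _ _) => apply RDef_eq
  | |- RDef (fun ne X H => col X _ _ = true) => apply RDef_col
  | |- RDef (fun ne X H => X _ = true) => apply RDef_mem
  | |- RDef (fun ne X H => andb _ _ = true) => apply RDef_andb
  | |- RDef (fun ne X H => ext _ _ _) => apply RDef_stem
  | |- RDef (fun ne X H => UT _ _ _ _ = true) => apply RDef_bool, CB_UT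
  | |- RDef (fun ne X H => Tr _ _ _ = true) => apply RDef_bool, CB_Tr
  | |- RDef (fun ne X H => infinite_set _) => unfold infinite_set
  | |- RDef (fun ne X H => sub _ _) => unfold sub
  | |- RDef (fun ne X H => sfx _ _) => unfold sfx
  | |- RDef (fun ne X H => _ -> _) => apply RDef_impl
  | |- RDef (fun ne X H => _ = true) => apply RDef_bool
  end).

(** * Avoiding non-hyperarithmetical sets *)

Definition through (T : list nat -> bool) (s : list nat) (f : nat -> nat) : Prop :=
  path T f /\ pre f (length s) = s.

Lemma emptyset_memb : emptyset = memb (dec 0).
Proof. reflexivity. Qed.

(** Formulas quantify over sets, not over functions. A set of nodes of [T] in which every member has
    a child replaces the path, which is recovered by dependent choice. *)
Lemma through_coded T s (Q : list nat -> Prop) : tail_closed T ->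
  (forall l l', Q l -> sfx l l' -> Q l') ->
  (exists X : nat -> bool, exists l, sfx s (dec l) /\ Q (dec l) /\ X l = true /\
     forall l', X l' = true -> T (dec l') = true /\ exists a, X (S (cpair a l')) = true) <->
  exists f k, through T s f /\ Q (pre f k).
Proof.
  intros TC QM. split.
  - intros (X & l & S & Ql & Xl & HX).
    destruct (generic_sequence (fun l => X (enc l) = true) (fun l' l => exists a, l' = a :: l)
      (fun _ _ => True) (dec l)) as (c & C0 & CX & CS).
    { now rewrite enc_dec. }
    { intros m _ Xm. destruct (HX _ Xm) as [_ [a Xa]]. exists (a :: m). split; eauto. }
    assert (LC : forall k, length (c k) = k + length (dec l)).
    { induction k; [now rewrite C0|]. destruct (CS k) as [[a ->] _]. cbn. now rewrite IHk. }
    destruct (limit_path c) as [f Hf].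
    { intros k. destruct (CS k) as [[a ->] _]. apply sfx_cons. }
    { intros k. rewrite LC. lia. }
    assert (P : path T f).
    { intros k. apply (tail_closed_sfx T _ (c k)); auto.
      - rewrite <- (Hf k). apply sfx_pre_le. rewrite LC. lia.
      - destruct (HX _ (CX k)) as [A _]. now rewrite dec_enc in A. }
    exists f, (length (dec l)).
    assert (E : pre f (length (dec l)) = dec l) by (rewrite <- C0; apply Hf).
    split; [split; auto|now rewrite E].
    destruct S as [S1 S2]. rewrite <- (pre_rl s) at 2. apply pre_ext. intros i Hi.
    rewrite <- S2 by auto. rewrite <- E, rl_pre by lia. reflexivity.
  - intros (f & k & (P & E) & Qk).
    set (X := fun l => if excluded_middle_informative (exists j, l = enc (pre f j)) then true else false).
    assert (HX : forall l, X l = true <-> exists j, l = enc (pre f j)).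
    { intros l. unfold X. destruct (excluded_middle_informative _); split; auto; discriminate. }
    exists X, (enc (pre f (k + length s))). rewrite dec_enc. split; [apply pre_sfx; auto; lia|].
    split; [apply (QM _ _ Qk); apply sfx_pre_le; lia|]. split; [apply HX; eauto|].
    intros l Xl. apply HX in Xl as [j ->]. rewrite dec_enc. split; [apply P|].
    exists (f j). apply HX. exists (S j). reflexivity.
Qed.

Lemma avoidance P (Bs : nat -> nat -> bool) : RDef P -> (forall j, ~ hyperarithmetical (Bs j)) ->
  (exists X, P (ncons 0 (fun _ => 0)) X emptyset) ->
  exists X, P (ncons 0 (fun _ => 0)) X emptyset /\ forall i j, exists x, col X i x <> Bs j x.
Proof.
  intros HP NB [X0 HX0]. destruct (RDef_form P HP) as [phi Hphi].
  destruct (Hphi (ncons 0 (fun _ => 0)) emptyset) as [PS PC]. clear Hphi.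
  destruct (PC X0 HX0) as [X1 HX1].
  set (c := cpair (cF phi) 0). set (T := Tr c emptyset).
  assert (TC : tail_closed T) by (intros a l; apply Tr_tail).
  destruct (Tr_complete phi 0 emptyset X1 HX1) as [f0 P0].
  (* In a Tarski path column 2 holds the quantified set, whose column 1 is the set [Xu] without the
     evaluation tables, and column [i] of the latter is the set in question. *)
  set (cell := fun i x => cpair 2 (cpair 1 (cpair i x))).
  (* If [s] has no such extension, all paths through [s] agree with [Bs j] on column [i]. Then a
     number is in [Bs j] iff some path through [s] says so, and is outside iff some path denies it,
     which is a Delta^1_1 definition. *)
  assert (DN : forall s, (exists f, through T s f) -> forall i j, exists s', (exists f, through T s' f) /\
    sfx s s' /\ forall f, through T s' f -> exists x, negb (f (cell i x) =? 0) <> Bs j x).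
  { intros s [f Hf] i j. apply NNPP. intros Q.
    assert (U : forall g x, through T s g -> negb (g (cell i x) =? 0) = Bs j x).
    { intros g x Hg. apply NNPP. intros N. apply Q.
      exists (pre g (S (cell i x + length s))). split; [|split].
      - exists g. split; [apply Hg|]. now rewrite length_pre.
      - apply pre_sfx; [apply Hg|lia].
      - intros h [_ Eh]. rewrite length_pre in Eh. exists x.
        rewrite <- (rl_pre h (S (cell i x + length s))), Eh, rl_pre by lia. exact N. }
    apply (NB j). split.
    - apply sigma11_intro with (P := fun ne X _ => exists l, sfx (dec (enc s)) (dec l) /\
        (cell i (ne 0) < length (dec l) /\ 0 < rl (dec l) (cell i (ne 0))) /\ X l = true /\
        forall l', X l' = true -> Tr c (memb (dec 0)) (dec l') = true /\ exists a, X (S (cpair a l')) = true).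
      { unfold cell. rdef. }
      intros n. rewrite dec_enc, <- emptyset_memb. fold T. cbn [ncons].
      rewrite (through_coded T s (fun l => cell i n < length l /\ 0 < rl l (cell i n)) TC).
      + split.
        * intros Bn. exists f, (S (cell i n)). split; auto. rewrite length_pre. split; auto.
          rewrite rl_pre by lia. specialize (U f n Hf). rewrite Bn in U.
          apply negb_true_iff, Nat.eqb_neq in U. lia.
        * intros (g & k & Hg & L & R). rewrite length_pre in L. rewrite rl_pre in R by auto.
          rewrite <- (U g n Hg). apply negb_true_iff, Nat.eqb_neq. lia.
      + intros l l' [A B] [C D]. split; [lia|]. now rewrite D.
    - apply sigma11_intro with (P := fun ne X _ => exists l, sfx (dec (enc s)) (dec l) /\
        (cell i (ne 0) < length (dec l) /\ 0 = rl (dec l) (cell i (ne 0))) /\ X l = true /\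
        forall l', X l' = true -> Tr c (memb (dec 0)) (dec l') = true /\ exists a, X (S (cpair a l')) = true).
      { unfold cell. rdef. }
      intros n. rewrite dec_enc, <- emptyset_memb. fold T. cbn [ncons].
      rewrite (through_coded T s (fun l => cell i n < length l /\ 0 = rl l (cell i n)) TC).
      + split.
        * intros Bn. exists f, (S (cell i n)). split; auto. rewrite length_pre. split; auto.
          rewrite rl_pre by lia. specialize (U f n Hf). apply negb_true_iff in Bn. rewrite Bn in U.
          apply negb_false_iff, Nat.eqb_eq in U. lia.
        * intros (g & k & Hg & L & R). rewrite length_pre in L. rewrite rl_pre in R by auto.
          rewrite <- (U g n Hg), <- R. reflexivity.
      + intros l l' [A B] [C D]. split; [lia|]. now rewrite D. }
  destruct (generic_sequence (fun s => exists f, through T s f) (fun s' s => sfx s s')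
    (fun n s => S n <= length s /\
       forall f, through T s f -> exists x, negb (f (cell (p1 n) x) =? 0) <> Bs (p2 n) x) [])
    as (s & _ & SO & SS).
  { exists f0. split; auto. }
  { intros r n Hr. destruct (DN r Hr (p1 n) (p2 n)) as (r' & [f Hf] & S' & D').
    exists (pre f (S n + length r')). split; [|split; [|split]].
    - exists f. split; [apply Hf|]. now rewrite length_pre.
    - eapply sfx_trans; [apply S'|]. apply pre_sfx; [apply Hf|lia].
    - rewrite length_pre. lia.
    - intros g [Pg Eg]. apply D'. split; auto. rewrite length_pre in Eg. destruct Hf as [_ Ef].
      rewrite <- Ef at 2. apply pre_ext. intros i Hi.
      rewrite <- (rl_pre g (S n + length r')), Eg, rl_pre by lia. reflexivity. }
  destruct (limit_path s) as [f Hf].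
  { intros k. apply SS. }
  { intros [|k]; [lia|]. apply SS. }
  assert (LS : forall k, k <= length (s k)) by (intros [|k]; [lia|apply SS]).
  assert (Pf : path T f).
  { intros k. apply (tail_closed_sfx T _ (s k)); auto.
    - rewrite <- (Hf k). now apply sfx_pre_le.
    - destruct (SO k) as (g & Pg & Eg). rewrite <- Eg. apply Pg. }
  exists (fun x => Xof f (cpair 1 x)). split.
  - apply (PS (Xof f)). now apply Tr_sound.
  - intros i j. destruct (SS (cpair i j)) as [_ [_ A]]. rewrite p1_pair, p2_pair in A.
    apply (A f). split; auto.
Qed.

(** * The countable model *)

Definition coded_family := nat -> nat -> bool.

(* [R (cpair F l)] says that the continuous function [R] has output [l] on the stem [F]. *)
Definition Good (M : coded_family) (p q F : nat) (X R : nat -> bool) : Prop :=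
  (forall F' l, ext X (dec F) (dec F') -> R (cpair F' l) = true ->
     (length (dec l) = 0 \/ exists x, memb (dec F') x = true /\ length (dec l) <= x) /\
     forall F'', ext X (dec F') (dec F'') ->
       UT p q (memb (dec F'')) (dec l) = true /\
       forall l', R (cpair F'' l') = true -> sfx (dec l) (dec l')) /\
  (forall F' h k, ext X (dec F) (dec F') -> infinite_set (M h) -> sub (M h) X ->
     exists F'' l, ext (M h) (dec F') (dec F'') /\ R (cpair F'' l) = true /\ k <= length (dec l)).

(* Output of length at least [k] (for [e = 0]), respectively output telling that the [n]-th
   comparison has outcome [b] (for [e <> 0]). *)
Definition output_code (e k : nat) (R : nat -> bool) (n : nat) (b : bool) (F : nat) : Prop :=
  exists l, R (cpair F l) = true /\
    ((e = 0 /\ k <= length (dec l)) \/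
     (0 < e /\ cpair n 0 < length (dec l) /\ Bool.eqb (negb (rl (dec l) (cpair n 0) =? 0)) b = true)).
Definition output (e k : nat) (R : nat -> bool) (n : nat) (b : bool) (F : list nat) : Prop :=
  output_code e k R n b (enc F).

Definition closed_selection (M : coded_family) : Prop :=
  forall p q F x, infinite_set (M x) ->
  exists x' r, infinite_set (M x') /\ sub (M x') (M x) /\ Good M p q F (M x') (M r).

Definition covered (X A0 A1 : nat -> bool) (F0 F1 e0 k0 e1 k1 n0 : nat) (b0 : bool) (n1 : nat) (b1 : bool) :=
  exists m, covers X (dec F0) (dec F1) (output e0 k0 A0 n0 b0) (output e1 k1 A1 n1 b1) m.
(** A place [n0] where neither value for the first side, combined with the value [b] at [n] for the
    second, can be forced on all partitions. *)
Definition undecided (X A0 A1 : nat -> bool) (F0 F1 e0 k0 e1 k1 n : nat) (b : bool) : Prop :=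
  exists n0, forall b0, ~ covered X A0 A1 F0 F1 e0 k0 e1 k1 n0 b0 n b.
(* Four closure conditions in one, selected by [t]. *)
Definition partition_case (X A0 A1 W : nat -> bool) (t n1 F0 F1 e0 k0 e1 k1 : nat) : Prop :=
  (t = 0 -> forall n, W n = true <-> covered X A0 A1 F0 F1 e0 k0 e1 k1 n true n1 true) /\
  (t = 1 -> forall n, W n = true <-> covered X A0 A1 F0 F1 e0 k0 e1 k1 n true n1 false) /\
  (t = 2 -> forall n, W n = true <-> undecided X A0 A1 F0 F1 e0 k0 e1 k1 n false) /\
  (t = 3 -> (forall b, undecided X A0 A1 F0 F1 e0 k0 e1 k1 n1 b) ->
     infinite_set W /\ sub W X /\ forall b,
       (exists n0, forall b0, refuted W (dec F0) (output e0 k0 A0 n0 b0)) \/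
       refuted W (dec F1) (output e1 k1 A1 n1 b)).

Definition closed_partition (M : coded_family) : Prop :=
  forall x a0 a1 t n1 F0 F1 e0 k0 e1 k1, infinite_set (M x) ->
  exists w, partition_case (M x) (M a0) (M a1) (M w) t n1 F0 F1 e0 k0 e1 k1.

Definition model (M : coded_family) : Prop :=
  (forall z, M 0 z = true) /\ closed_selection M /\ closed_partition M.

Lemma RDef_output e k r n b F : Cmp e -> Cmp k -> Cmp r -> Cmp n -> Cmp F ->
  RDef (fun ne X _ => output (e ne) (k ne) (col X (r ne)) (n ne) b (dec (F ne))).
Proof.
  intros He Hk Hr Hn HF. eapply RDef_ext.
  (* The five terms are packed into one variable, so that they need not be moved under the
     quantifier inside [output_code]. *)
  2: { apply (RDef_ex (fun u ne X H => (u = cpair (e ne) (cpair (k ne) (cpair (r ne) (cpair (n ne) (F ne))))) /\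
         output_code (p1 u) (p1 (p2 u)) (col X (p1 (p2 (p2 u)))) (p1 (p2 (p2 (p2 u)))) b
           (p2 (p2 (p2 (p2 u)))))).
       apply RDef_and.
       - apply (RDef_graph (fun ne => cpair (e ne) (cpair (k ne) (cpair (r ne) (cpair (n ne) (F ne)))))). cmp.
       - unfold output_code. rdef. }
  intros ne X H; cbn beta. unfold output. rewrite enc_dec. split.
  - intros (u & -> & A). now repeat rewrite ?p1_pair, ?p2_pair in A.
  - intros A. eexists. split; [reflexivity|]. now repeat rewrite ?p1_pair, ?p2_pair.
Qed.

(** Stems, partitions and members of the family are all given by numbers, so being a model is
    arithmetical in the code of the family. *)
Lemma RDef_model : RDef (fun _ X _ => model (col X)).
Proof.
  unfold model, closed_selection, closed_partition, partition_case, undecided, covered, refuted, Good, covers.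
  repeat first [progress rdef | apply RDef_output].
Qed.

(** [X'] and [R] are found before [M] is given: totality of the selection holds on all infinite
    subsets of [X'], hence on those listed by any family. *)
Lemma selection_set p q F X : exists X' R, infinite_set X ->
  infinite_set X' /\ sub X' X /\ forall M, Good M p q F X' R.
Proof.
  destruct (classic (infinite_set X)) as [I|I]; [|exists X, X; contradiction].
  destruct (selection (UT p q)) with (F0 := dec F) (X := X) as (X' & ps & I' & S' & A & B); auto.
  { intros; now apply UT_local. }
  { apply UT_has_path. }
  exists X', (fun z => enc (ps (dec (p1 z))) =? p2 z). intros _. split; auto. split; auto. intros M. split.
  - intros F' l E. rewrite p1_pair, p2_pair, Nat.eqb_eq. intros <-. rewrite dec_enc.
    destruct (A _ E) as [L C]. split.
    + destruct (Nat.eq_dec (length (ps (dec F'))) 0) as [Z|Z]; auto. right.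
      exists (list_max (dec F')). split; auto. apply memb_In, list_max_In. lia.
    + intros F'' E'. destruct (C _ E') as [S U]. split; auto.
      intros l'. rewrite p1_pair, p2_pair, Nat.eqb_eq. intros <-. now rewrite dec_enc.
  - intros F' h k E IH SH. destruct (B _ (M h) k E IH SH) as (F'' & E' & L).
    exists (enc F''), (enc (ps F'')). rewrite p1_pair, p2_pair, Nat.eqb_eq, !dec_enc. auto.
Qed.
Lemma set_of (P : nat -> Prop) : exists W : nat -> bool, forall n, W n = true <-> P n.
Proof.
  exists (fun n => if excluded_middle_informative (P n) then true else false). intros n.
  destruct (excluded_middle_informative _); split; auto; discriminate.
Qed.
Lemma refuted_sub C C' F g : sub C' C -> refuted C F g -> refuted C' F g.
Proof. intros S R F' E. apply R. eapply ext_sub; eauto. Qed.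

Lemma partition_set X A0 A1 t n1 F0 F1 e0 k0 e1 k1 : exists W, infinite_set X ->
  partition_case X A0 A1 W t n1 F0 F1 e0 k0 e1 k1.
Proof.
  unfold partition_case.
  destruct t as [|[|[|[|t]]]].
  1: destruct (set_of (fun n => covered X A0 A1 F0 F1 e0 k0 e1 k1 n true n1 true)) as [W HW];
    exists W; repeat split; try discriminate; apply HW.
  1: destruct (set_of (fun n => covered X A0 A1 F0 F1 e0 k0 e1 k1 n true n1 false)) as [W HW];
    exists W; repeat split; try discriminate; apply HW.
  1: destruct (set_of (fun n => undecided X A0 A1 F0 F1 e0 k0 e1 k1 n false)) as [W HW];
    exists W; repeat split; try discriminate; apply HW.
  2: exists X; repeat split; discriminate.
  destruct (classic (infinite_set X /\ forall b, undecided X A0 A1 F0 F1 e0 k0 e1 k1 n1 b)) as [[I U]|N].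
  2: { exists X. intros I. repeat (split; [discriminate|]). intros _ U. tauto. }
  (* The two bits may have different undecided places, so the reservoir is thinned once for each
     bit; refutations survive thinning. *)
  destruct (U true) as [n N1], (U false) as [n' N0].
  destruct (uncovered_reservoir X (dec F0) (dec F1) (output e0 k0 A0 n) (output e1 k1 A1 n1 true) I N1)
    as (C1 & I1 & S1 & H1).
  assert (N0' : forall b, ~ exists m, covers C1 (dec F0) (dec F1) (output e0 k0 A0 n' b) (output e1 k1 A1 n1 false) m).
  { intros b [m Hm]. apply (N0 b). exists m. intros D. destruct (Hm D) as [(F & E & G)|(F & E & G)];
      [left|right]; exists F; (split; [|exact G]); revert E; apply ext_sub; intros x Hx;
      rewrite !andb_true_iff in *; destruct Hx as [[Hx L] R]; auto. }
  destruct (uncovered_reservoir C1 (dec F0) (dec F1) (output e0 k0 A0 n') (output e1 k1 A1 n1 false) I1 N0')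
    as (C & IC & SC & H0).
  exists C. intros _. repeat (split; [discriminate|]). intros _ _. split; auto.
  split; [eapply sub_trans; eauto|]. intros [|].
  - destruct H1 as [H1|H1]; [left; exists n; intros b|right]; eapply refuted_sub; eauto.
  - destruct H0 as [H0|H0]; [left; exists n'; intros b|right]; auto.
Qed.

(** Names for the sets generated from the full set: [T1] for the two outputs of the selection,
    chosen by its bit, and [T2] for the partition conditions. Numerical parameters are packed into
    one number. *)
Inductive tm : Type :=
| T0 : tm
| T1 : bool -> nat -> tm -> tm
| T2 : nat -> tm -> tm -> tm -> tm.
Fixpoint ctm (t : tm) : nat :=
  match t with
  | T0 => 0
  | T1 b n x => S (cpair (b2n b) (cpair n (ctm x)))
  | T2 n x a c => S (cpair 2 (cpair n (cpair (ctm x) (cpair (ctm a) (ctm c)))))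
  end.
Lemma ctm_inj t : forall t', ctm t = ctm t' -> t = t'.
Proof.
  induction t as [|b n x IH|n x IHx a IHa c IHc]; intros [|b' n' x'|n' x' a' c'] E; cbn [ctm] in E;
    try discriminate; auto; injection E as E.
  - apply pair_inj in E as [E1 E]. apply pair_inj in E as [-> E]. f_equal; auto.
    destruct b, b'; auto; discriminate.
  - apply pair_inj in E as [E1 _]. destruct b; discriminate.
  - apply pair_inj in E as [E1 _]. destruct b'; discriminate.
  - apply pair_inj in E as [_ E]. apply pair_inj in E as [-> E]. apply pair_inj in E as [E1 E].
    apply pair_inj in E as [E2 E3]. f_equal; auto.
Qed.

(* Skolem hull of the full set. *)
Lemma model_exists : exists M, model M.
Proof.
  assert (S1 : forall nX : nat * (nat -> bool), exists XR : (nat -> bool) * (nat -> bool),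
    let v i := nth i (dec (fst nX)) 0 in infinite_set (snd nX) ->
    infinite_set (fst XR) /\ sub (fst XR) (snd nX) /\ forall M, Good M (v 0) (v 1) (v 2) (fst XR) (snd XR)).
  { intros [n X]. destruct (selection_set (nth 0 (dec n) 0) (nth 1 (dec n) 0) (nth 2 (dec n) 0) X)
      as (X' & R & H). exists (X', R). exact H. }
  apply choice in S1 as [sk1 H1].
  assert (S2 : forall u : nat * ((nat -> bool) * ((nat -> bool) * (nat -> bool))), exists W,
    let v i := nth i (dec (fst u)) 0 in infinite_set (fst (snd u)) ->
    partition_case (fst (snd u)) (fst (snd (snd u))) (snd (snd (snd u))) W
      (v 0) (v 1) (v 2) (v 3) (v 4) (v 5) (v 6) (v 7)).
  { intros u. apply partition_set. }
  apply choice in S2 as [sk2 H2].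
  set (I := fix I t := match t with
    | T0 => fun _ => true
    | T1 b n x => if b : bool then fst (sk1 (n, I x)) else snd (sk1 (n, I x))
    | T2 n x a c => sk2 (n, (I x, (I a, I c))) end).
  assert (E : forall n, exists t, forall t', ctm t' = n -> t = t').
  { intros n. destruct (classic (exists t, ctm t = n)) as [[t Ht]|N].
    - exists t. intros t' Ht'. apply ctm_inj. congruence.
    - exists T0. intros t' Ht'. exfalso. eauto. }
  apply choice in E as [d Hd].
  assert (D : forall t, d (ctm t) = t) by (intros; now apply Hd).
  exists (fun i => I (d i)). split; [|split].
  - intros z. now rewrite (D T0 : d 0 = T0).
  - intros p q F x IX. exists (ctm (T1 true (enc [p; q; F]) (d x))), (ctm (T1 false (enc [p; q; F]) (d x))).
    rewrite !D. cbn [I]. specialize (H1 (enc [p; q; F], I (d x)) IX). cbn [fst] in H1.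
    rewrite dec_enc in H1. cbn [nth snd] in H1. destruct H1 as (A & B & C). auto.
  - intros x a0 a1 t n1 F0 F1 e0 k0 e1 k1 IX.
    exists (ctm (T2 (enc [t; n1; F0; F1; e0; k0; e1; k1]) (d x) (d a0) (d a1))). rewrite D. cbn [I].
    specialize (H2 (enc [t; n1; F0; F1; e0; k0; e1; k1], (I (d x), (I (d a0), I (d a1)))) IX).
    cbn [fst] in H2. rewrite dec_enc in H2. exact H2.
Qed.

Lemma avoiding_model (Bs : nat -> nat -> bool) : (forall j, ~ hyperarithmetical (Bs j)) ->
  exists M, model M /\ forall i j, exists x, M i x <> Bs j x.
Proof.
  intros NB. destruct (avoidance _ Bs RDef_model NB) as (X & MX & AX).
  - destruct model_exists as [M HM]. exists (fun z => M (p1 z) (p2 z)).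
    replace (col _) with M; auto. extensionality i. extensionality x. unfold col.
    now rewrite p1_pair, p2_pair.
  - exists (col X). auto.
Qed.

(** * The generic set *)

Section Generic.
Variables (M : coded_family) (Bs : nat -> nat -> bool) (A : nat -> bool).
Hypothesis HM : model M.
Hypothesis avoid : forall i j, exists x, M i x <> Bs j x.

(* Stems of the two candidates ([true] for the one inside [A]) and index of the reservoir. *)
Definition cond : Type := (bool -> list nat) * nat.
Definition Ok (c : cond) : Prop :=
  (forall i y, In y (fst c i) -> A y = i) /\ infinite_set (M (snd c)).
Definition extends (c' c : cond) : Prop :=
  (forall i, ext (M (snd c)) (fst c i) (fst c' i)) /\ sub (M (snd c')) (M (snd c)).

Lemma extends_refl c : extends c c.
Proof. split; [constructor|intros x; auto]. Qed.
Lemma extends_trans c c' c'' : extends c'' c' -> extends c' c -> extends c'' c.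
Proof.
  intros [E S] [E' S']. split; [|eapply sub_trans; eauto]. intros i.
  eapply ext_trans; [apply E'|]. eapply ext_sub; eauto.
Qed.

(** Totality is tested only on reservoirs of the model, which is why the refuting reservoirs of
    [partition_case] have to belong to the model. *)
Definition Tot (a : nat) (F : list nat) (X : nat -> bool) : Prop :=
  forall F' h k, ext X F F' -> infinite_set (M h) -> sub (M h) X ->
  exists F'' l, ext (M h) F' F'' /\ M a (cpair (enc F'') l) = true /\ k <= length (dec l).

Lemma Tot_extends a c c' i : extends c' c -> Tot a (fst c i) (M (snd c)) -> Tot a (fst c' i) (M (snd c')).
Proof.
  intros [E S] T F' h k E' I S'. apply T; auto; [|eapply sub_trans; eauto].
  eapply ext_trans; [apply E|]. eapply ext_sub; eauto.
Qed.
Lemma Good_Tot p q a F X : Good M p q (enc F) X (M a) -> Tot a F X.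
Proof.
  intros [_ G] F' h k E I S. destruct (G (enc F') h k) as (F'' & l & E' & R & L); rewrite ?dec_enc; auto.
  exists (dec F''), l. rewrite dec_enc in E'. rewrite enc_dec. auto.
Qed.
Lemma Tot_output a F X h e k n : Tot a F X -> infinite_set (M h) -> sub (M h) X ->
  exists b F', ext (M h) F (dec F') /\ output e k (M a) n b (dec F').
Proof.
  intros T I SX. destruct (T F h (k + S (cpair n 0))) as (F' & l & E & R & L); auto; [constructor|].
  exists (negb (rl (dec l) (cpair n 0) =? 0)), (enc F'). rewrite dec_enc. split; auto.
  exists l. split; auto. destruct (Nat.eq_dec e 0) as [->|]; [left|right]; split; auto; try lia.
  split; [lia|]. apply eqb_reflx.
Qed.

(** Either a wrong value for [Bs j] has been output on side [i], or no further extension can make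
    the function total on that side. *)
Definition Sat (i : bool) (a e k j : nat) (c : cond) : Prop :=
  (exists n, output e k (M a) n (negb (Bs j n)) (fst c i)) \/
  (forall c', Ok c' -> extends c' c -> ~ Tot a (fst c' i) (M (snd c'))).

Lemma not_coded w j : ~ forall n, M w n = true <-> Bs j n = true.
Proof. intros H. destruct (avoid w j) as [x Hx]. apply Hx, eq_true_iff_eq, H. Qed.

(* If no pair of wrong answers can be forced, then one of the two sets [Bs j0], [Bs j1]
   is definable from the way in which the forcing questions are answered. *)
Lemma force_covered a0 e0 k0 j0 a1 e1 k1 j1 F0 F1 x : infinite_set (M x) ->
  Tot a0 F0 (M x) -> Tot a1 F1 (M x) -> exists n0 n1,
  covered (M x) (M a0) (M a1) (enc F0) (enc F1) e0 k0 e1 k1 n0 (negb (Bs j0 n0)) n1 (negb (Bs j1 n1)).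
Proof.
  intros I T0 T1. destruct HM as (_ & _ & HP).
  apply NNPP. intros Q.
  set (cov := covered (M x) (M a0) (M a1) (enc F0) (enc F1) e0 k0 e1 k1) in *.
  set (und := undecided (M x) (M a0) (M a1) (enc F0) (enc F1) e0 k0 e1 k1).
  (* Since no two wrong values are covered together, a wrong value at [n1] can be covered only
     together with a right one at [n0]. *)
  assert (R : forall n0 n1 b0, cov n0 b0 n1 (negb (Bs j1 n1)) -> b0 = Bs j0 n0).
  { intros n0 n1 b0 C. destruct (Bool.bool_dec b0 (Bs j0 n0)) as [|N]; auto. exfalso. apply Q.
    exists n0, n1. replace (negb (Bs j0 n0)) with b0; auto. destruct b0, (Bs j0 n0); auto; congruence. }
  (* Otherwise at every [n0] some value would be covered together with the wrong value at [n]; it is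
     the right one, so [Bs j0] would be a set of the model by case 0 or 1 of the partition
     closure. *)
  assert (U : forall n, und n (negb (Bs j1 n))).
  { intros n. apply NNPP. intros N.
    assert (C : forall n0, exists b0, cov n0 b0 n (negb (Bs j1 n))).
    { intros n0. apply NNPP. intros N'. apply N. exists n0. intros b0 C. apply N'. eauto. }
    assert (W : exists w, forall n0, M w n0 = true <-> cov n0 true n (negb (Bs j1 n))).
    { destruct (negb (Bs j1 n)).
      - destruct (HP x a0 a1 0 n (enc F0) (enc F1) e0 k0 e1 k1 I) as (w & Hw & _). exists w. now apply Hw.
      - destruct (HP x a0 a1 1 n (enc F0) (enc F1) e0 k0 e1 k1 I) as (w & _ & Hw & _). exists w. now apply Hw. }
    destruct W as [w Hw]. apply (not_coded w j0). intros n0. rewrite Hw. split.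
    - intros D. apply R in D. auto.
    - intros D. destruct (C n0) as [b0 Hb]. pose proof (R _ _ _ Hb). congruence. }
  (* If both values at [n] were undecided, case 3 would give a reservoir of the model. Totality of
     [a0] on it excludes the refutations on the first side, so both values at [n] are refuted on the
     second side, against totality of [a1]. *)
  assert (V : forall n, ~ und n (Bs j1 n)).
  { intros n N. destruct (HP x a0 a1 3 n (enc F0) (enc F1) e0 k0 e1 k1 I) as (w & _ & _ & _ & Hw).
    destruct Hw as (IW & SW & Hb); auto.
    { intros b. destruct (Bool.bool_dec b (Bs j1 n)) as [->|Nb]; [exact N|].
      replace b with (negb (Bs j1 n)); [apply U|]. destruct b, (Bs j1 n); auto; congruence. }
    rewrite !dec_enc in Hb.
    assert (Z : forall b, refuted (M w) F1 (output e1 k1 (M a1) n b)).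
    { intros b. destruct (Hb b) as [[n0 H0]|H1]; auto. exfalso.
      destruct (Tot_output a0 F0 (M x) w e0 k0 n0 T0 IW SW) as (b0 & F' & E & O). apply (H0 b0 F' E O). }
    destruct (Tot_output a1 F1 (M x) w e1 k1 n T1 IW SW) as (b & F' & E & O). apply (Z b F' E O). }
  (* Thus [n] is in [Bs j1] iff the value false is undecided at [n], and case 2 puts this set into
     the model. *)
  destruct (HP x a0 a1 2 0 (enc F0) (enc F1) e0 k0 e1 k1 I) as (w & _ & _ & Hw & _).
  apply (not_coded w j1). intros n. rewrite (Hw eq_refl n). fold und. split.
  - intros D. destruct (Bs j1 n) eqn:E; auto. exfalso. apply (V n). now rewrite E.
  - intros D. specialize (U n). now rewrite D in U.
Qed.

Lemma Sat_dense c a0 e0 k0 j0 a1 e1 k1 j1 : Ok c ->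
  exists c', Ok c' /\ extends c' c /\ (Sat true a0 e0 k0 j0 c' \/ Sat false a1 e1 k1 j1 c').
Proof.
  intros O.
  destruct (classic (exists c', Ok c' /\ extends c' c /\ Tot a0 (fst c' true) (M (snd c')))) as [(c1 & O1 & L1 & T0)|N].
  2: { exists c. split; auto. split; [apply extends_refl|]. left. right. intros c' O' L' T. apply N. eauto. }
  destruct (classic (exists c', Ok c' /\ extends c' c1 /\ Tot a1 (fst c' false) (M (snd c')))) as [(c2 & O2 & L2 & T1)|N].
  2: { exists c1. split; auto. split; auto. right. right. intros c' O' L' T. apply N. eauto. }
  apply (Tot_extends _ _ _ _ L2) in T0. destruct c2 as [F x]. cbn [fst snd] in *.
  destruct O2 as [OA I]. cbn [fst snd] in *.
  destruct (force_covered a0 e0 k0 j0 a1 e1 k1 j1 (F true) (F false) x I T0 T1) as (n0 & n1 & m & C).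
  rewrite !dec_enc in C.
  (* The only use of [A] in answering a forcing question: the answer holds for every partition,
     hence for the one given by [A] below [m]. *)
  destruct (restrict_list A m) as [D HD]. specialize (C (enc D)). rewrite dec_enc in C.
  destruct C as [(F' & E & R)|(F' & E & R)].
  - exists (fun i => if i : bool then dec F' else F false, x). split; [|split].
    + split; auto. cbn. intros [|] y Hy; [|now apply OA].
      destruct (ext_new _ _ _ _ E Hy) as [J|[J _]]; [now apply OA|].
      rewrite !andb_true_iff, Nat.ltb_lt in J. destruct J as [[_ L] J]. now rewrite <- HD.
    + eapply extends_trans; [|eapply extends_trans; eauto]. split; [|intros y; auto]. cbn. intros [|]; [|constructor].
      revert E. apply ext_sub. intros y Hy. rewrite !andb_true_iff in Hy. tauto.
    + left. left. exists n0. exact R.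
  - exists (fun i => if i : bool then F true else dec F', x). split; [|split].
    + split; auto. cbn. intros [|] y Hy; [now apply OA|].
      destruct (ext_new _ _ _ _ E Hy) as [J|[J _]]; [now apply OA|].
      rewrite !andb_true_iff, Nat.ltb_lt in J. destruct J as [[_ L] J].
      rewrite <- HD by auto. now apply negb_true_iff.
    + eapply extends_trans; [|eapply extends_trans; eauto]. split; [|intros y; auto]. cbn. intros [|]; [constructor|].
      revert E. apply ext_sub. intros y Hy. rewrite !andb_true_iff in Hy. tauto.
    + right. left. exists n1. exact R.
Qed.

Lemma Good_dense c i p q : Ok c ->
  exists c', Ok c' /\ extends c' c /\ exists a, Good M p q (enc (fst c' i)) (M (snd c')) (M a).
Proof.
  intros [OA I]. destruct HM as (_ & HS & _).
  destruct (HS p q (enc (fst c i)) (snd c) I) as (x' & r & I' & S' & G).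
  exists (fst c, x'). split; [split; auto|]. split; [split; auto; constructor|]. eauto.
Qed.

(** The first component of [n] is padding that lets each task recur arbitrarily late; the list in
    the second component selects the kind of task and its parameters. *)
Definition task (n : nat) (c : cond) : Prop :=
  let v i := nth i (dec (p2 n)) 0 in
  if v 0 =? 0
  then exists a, Good M (v 1) (v 2) (enc (fst c (v 3 =? 0))) (M (snd c)) (M a)
  else Sat true (v 1) (v 2) (v 3) (v 4) c \/ Sat false (v 5) (v 6) (v 7) (v 8) c.

Lemma generic_conditions : exists c : nat -> cond, (forall t, Ok (c t)) /\
  (forall s t, s <= t -> extends (c t) (c s)) /\
  (forall i p q, exists t a, Good M p q (enc (fst (c t) i)) (M (snd (c t))) (M a)) /\
  exists i, forall a e k j s, exists t, s <= t /\ Sat i a e k j (c t).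
Proof.
  destruct (generic_sequence Ok extends task (fun _ => [], 0)) as (c & _ & O & L).
  - split; [intros i y []|]. destruct HM as (H0 & _). intros m. exists m. split; auto.
  - intros c n Oc. unfold task. destruct (nth 0 (dec (p2 n)) 0 =? 0).
    + now apply Good_dense.
    + now apply Sat_dense.
  - exists c. assert (ML : forall s t, s <= t -> extends (c t) (c s)).
    { intros s t H. induction H; [apply extends_refl|]. eapply extends_trans; [|eauto]. apply L. }
    split; auto. split; auto.
    assert (TK : forall s l, exists t, s <= t /\ task (cpair s (enc l)) (c t)).
    { intros s l. exists (S (cpair s (enc l))). split; [pose proof (pair_ge s (enc l)); lia|]. apply L. }
    split.
    + intros i p q. destruct (TK 0 [0; p; q; if i then 0 else 1]) as (t & _ & T).
      unfold task in T. rewrite p2_pair, dec_enc in T. cbn [nth Nat.eqb] in T. destruct T as [a G].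
      exists t, a. destruct i; exact G.
    (* If the side [true] fails one requirement from some stage on, pairing that requirement with an
       arbitrary one of the side [false] shows that the latter is met at late stages. *)
    + destruct (classic (forall a e k j s, exists t, s <= t /\ Sat true a e k j (c t))) as [H|H]; eauto.
      exists false. intros a1 e1 k1 j1 s. apply NNPP. intros N. apply H. intros a e k j s'.
      apply NNPP. intros N'.
      destruct (TK (max s s') [1; a; e; k; j; a1; e1; k1; j1]) as (t & Lt & T).
      unfold task in T. rewrite p2_pair, dec_enc in T. cbn [nth Nat.eqb] in T.
      destruct T as [T|T]; [apply N'|apply N]; exists t; split; auto; lia.
Qed.

Lemma generic_set : exists G i, infinite_set G /\ (forall n, G n = true -> A n = i) /\
  forall j, ~ hyp_in G (Bs j).
Proof.
  destruct generic_conditions as (c & O & ML & HG & i & HS).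
  set (st := fun t => fst (c t) i).
  destruct (set_of (fun y => exists t, In y (st t))) as [G HGs]. exists G, i.
  assert (Mon : forall s t, s <= t -> incl (st s) (st t)).
  { intros s t L. apply (ext_incl (M (snd (c s)))). apply (ML s t L). }
  (* The function obtained for [p] and [q] is total from stage [t0] on, so its requirements can only
     be met by wrong outputs. *)
  assert (Done : forall p q, exists t0 a, Good M p q (enc (st t0)) (M (snd (c t0))) (M a) /\
    forall e k j s, exists t n, t0 <= t /\ s <= t /\ output e k (M a) n (negb (Bs j n)) (st t)).
  { intros p q. destruct (HG i p q) as (t0 & a & Gd). exists t0, a. split; auto. intros e k j s.
    destruct (HS a e k j (max s t0)) as (t & L & [[n D]|D]).
    - exists t, n. split; [lia|]. split; [lia|exact D].
    - exfalso. apply (D (c t) (O t) (extends_refl _)).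
      apply (Tot_extends a (c t0)); [apply ML; lia|]. eapply Good_Tot. apply Gd. }
  split; [|split].
  - intros m. destruct (Done 0 0) as (t0 & a & Gd & D).
    (* The mode [e = 0] asks for a long output. Its length is bounded by an element of the stem,
       which is therefore at least [m]. *)
    destruct (D 0 (S m) 0 0) as (t & n & L0 & _ & l & R & [[_ L]|[L _]]); [|lia].
    destruct Gd as [Gd _].
    assert (E : ext (M (snd (c t0))) (dec (enc (st t0))) (dec (enc (st t))))
      by (rewrite !dec_enc; apply (ML t0 t L0)).
    destruct (Gd (enc (st t)) l E R) as [[Z|(x & Hx & Lx)] _]; [lia|].
    rewrite dec_enc in Hx. exists x. split; [lia|]. apply HGs. exists t. now apply memb_In.
  - intros n Hn. apply HGs in Hn as [t Ht]. now apply (O t).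
  - intros j [[phi Hphi] [chi Hchi]]. set (B := Bs j) in *.
    set (p := cF phi). set (q := cF chi).
    destruct (Done p q) as (t0 & a & [Gd _] & D).
    assert (EX : forall s t, t0 <= s -> s <= t -> ext (M (snd (c t0))) (st s) (st t)).
    { intros s t L1 L2. eapply ext_sub; [apply (ML t0 s L1)|]. apply (ML s t L2). }
    assert (GD : forall s t l, t0 <= s -> s <= t -> M a (cpair (enc (st s)) l) = true ->
      UT p q (memb (st t)) (dec l) = true /\
      forall l', M a (cpair (enc (st t)) l') = true -> sfx (dec l) (dec l')).
    { intros s t l L1 L2 R. destruct (Gd (enc (st s)) l) as [_ H]; auto.
      - rewrite !dec_enc. now apply EX.
      - specialize (H (enc (st t))). rewrite !dec_enc in H. apply H. now apply EX. }
    destruct (D 0 0 0 0) as (t1 & n1 & L1 & _ & l1 & R1 & _).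
    (* Outputs at increasing stages and of increasing length; they cohere, and their limit is a path
       of the comparison tree of [G]. *)
    destruct (generic_sequence (fun tl : nat * nat => t0 <= fst tl /\ M a (cpair (enc (st (fst tl))) (snd tl)) = true)
      (fun tl' tl => fst tl < fst tl')
      (fun k tl => S k <= length (dec (snd tl))) (t1, l1)) as (s & _ & SO & SS); [split; auto|..].
    { intros [t l] k [L R]. destruct (D 0 (S k) 0 (S t)) as (t' & n & L0 & Lt & l' & R' & [[_ Ll]|[Ll _]]); [|lia].
      exists (t', l'). cbn in *. split; auto. }
    assert (ST : forall k k', k <= k' -> fst (s k) <= fst (s k')).
    { intros k k' H. induction H; auto. destruct (SS m). lia. }
    assert (Sk : forall k, k <= fst (s k)).
    { induction k; [lia|]. destruct (SS k). lia. }
    assert (SL : forall k, k <= length (dec (snd (s k)))).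
    { intros [|k]; [lia|]. apply SS. }
    destruct (limit_path (fun k => dec (snd (s k)))) as [f Hf]; auto.
    { intros k. apply (GD (fst (s k)) (fst (s (S k)))); try apply SO. apply ST. lia. }
    assert (Pf : path (UT p q G) f).
    { intros k. apply (tail_closed_sfx _ _ (dec (snd (s k))) (UT_tail p q G)).
      - rewrite <- (Hf k). apply sfx_pre_le, SL.
      (* A stage whose stem contains all elements of [G] below the length of the node; up to there
         the tree of the stem and the tree of [G] agree. *)
      - assert (exists t, fst (s k) <= t /\ forall x, x < length (dec (snd (s k))) -> G x = true -> In x (st t))
          as (t & Lt & Ht).
        { induction (length (dec (snd (s k)))) as [|m (t & Lt & Ht)]; [exists (fst (s k)); split; [lia|lia]|].
          destruct (G m) eqn:Gm.
          - pose proof Gm as Gm'. apply HGs in Gm' as [t' Ht']. exists (max t t'). split; [lia|].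
            intros x Lx Gx. destruct (Nat.eq_dec x m) as [->|].
            + apply (Mon t' (max t t')); auto; lia.
            + apply (Mon t (max t t')); [lia|]. apply Ht; auto; lia.
          - exists t. split; auto. intros x Lx Gx. destruct (Nat.eq_dec x m) as [->|]; [congruence|].
            apply Ht; auto; lia. }
        rewrite (UT_local p q G (memb (st t))).
        + apply (GD (fst (s k)) t); auto; apply SO.
        + intros x Lx. apply eq_true_iff_eq. rewrite memb_In. split; auto. intros J. apply HGs. eauto. }
    assert (DEC : forall n, f (cpair n 0) <> 0 <-> B n = true).
    { intros n. rewrite (UT_decides p q G f n Pf).
      - unfold p. rewrite <- Tr_iff. symmetry. apply Hphi.
      - unfold p, q. rewrite <- !Tr_iff. rewrite <- Hphi, <- (Hchi n). destruct (B n); cbn; split; congruence. }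
    (* The mode [e = 1] gives a wrong value at some [n]. By coherence the path [f] has the same
       value there, which contradicts [DEC]. *)
    destruct (D 1 0 j 0) as (t & n & L0 & _ & l & R & [[Z _]|(_ & Ln & E)]); [lia|].
    apply eqb_prop in E.
    assert (Ef : f (cpair n 0) = rl (dec l) (cpair n 0)).
    { set (k := S (cpair n 0 + t)).
      destruct (GD t (fst (s k)) l L0) as [_ H]; auto.
      { specialize (Sk k). unfold k in *. lia. }
      specialize (H (snd (s k)) (proj2 (SO k))). destruct H as [_ H]. rewrite <- (H _ Ln).
      rewrite <- (Hf k), rl_pre; auto. specialize (SL k). unfold k in *. lia. }
    specialize (DEC n). fold B in E. rewrite <- Ef in E.
    destruct (Nat.eqb_spec (f (cpair n 0)) 0) as [Z|Z]; cbn in E; destruct (B n); cbn in E; try discriminate.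
    + apply DEC; auto.
    + apply DEC in Z. discriminate.
Qed.
End Generic.

Theorem cone_avoidance (Bs : nat -> nat -> bool) (A : nat -> bool) :
  (forall j, ~ hyperarithmetical (Bs j)) ->
  exists G i, infinite_set G /\ (forall n, G n = true -> A n = i) /\ forall j, ~ hyp_in G (Bs j).
Proof.
  intros NB. destruct (avoiding_model Bs NB) as (M & HM & AV). eapply generic_set; eauto.
Qed.

(** * The Kleene-Brouwer order *)

Definition kb (a b : list nat) : bool :=
  ((length b <? length a) && ball (length b) (fun j => rl a j =? rl b j)) ||
  bex (length a) (fun i => (i <? length b) && (rl a i <? rl b i) && ball i (fun j => rl a j =? rl b j)).

Definition left_of (a b : list nat) : Prop :=
  exists i, i < length a /\ i < length b /\ rl a i < rl b i /\ forall j, j < i -> rl a j = rl b j.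

Lemma kb_spec a b : kb a b = true <-> (length b < length a /\ sfx b a) \/ left_of a b.
Proof.
  unfold kb. rewrite orb_true_iff, andb_true_iff, Nat.ltb_lt, ball_spec, bex_spec. split.
  - intros [[L H]|(i & L & H)].
    + left. split; auto. split; [lia|]. intros i Hi. apply Nat.eqb_eq. auto.
    + right. exists i. rewrite !andb_true_iff, !Nat.ltb_lt, ball_spec in H. destruct H as [[A B] C].
      split; auto. split; auto. split; auto. intros j Hj. apply Nat.eqb_eq. auto.
  - intros [[L [_ H]]|(i & A & B & C & D)]; [left|right].
    + split; auto. intros i Hi. apply Nat.eqb_eq. auto.
    + exists i. rewrite !andb_true_iff, !Nat.ltb_lt, ball_spec. split; auto. split; auto.
      intros j Hj. apply Nat.eqb_eq. auto.
Qed.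

Lemma kb_irrefl a : kb a a = false.
Proof.
  apply not_true_iff_false. rewrite kb_spec. intros [[L _]|(i & _ & _ & L & _)]; lia.
Qed.
Lemma kb_trans a b c : kb a b = true -> kb b c = true -> kb a c = true.
Proof.
  rewrite !kb_spec. intros [[L1 [_ S1]]|(i & Ia & Ib & Li & Ei)] [[L2 [_ S2]]|(k & Kb & Kc & Lk & Ek)].
  - left. split; [lia|]. split; [lia|]. intros j Hj. rewrite S1 by lia. auto.
  - right. exists k. split; [lia|]. split; auto. split; [rewrite S1; auto|].
    intros j Hj. rewrite S1 by lia. auto.
  - destruct (le_lt_dec (length c) i) as [L|L].
    + left. split; [lia|]. split; [lia|]. intros j Hj. rewrite Ei by lia. auto.
    + right. exists i. split; auto. split; auto. split; [rewrite <- S2; auto|].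
      intros j Hj. rewrite Ei by auto. apply S2. lia.
  - right. exists (min i k). split; [lia|]. split; [lia|]. split.
    + destruct (Nat.lt_trichotomy i k) as [L|[->|L]].
      * rewrite Nat.min_l by lia. rewrite <- Ek; auto.
      * rewrite Nat.min_id. lia.
      * rewrite Nat.min_r by lia. rewrite Ei; auto.
    + intros j Hj. rewrite Ei by lia. apply Ek. lia.
Qed.
Lemma kb_total a b : a <> b -> kb a b = true \/ kb b a = true.
Proof.
  intros N. rewrite !kb_spec.
  destruct (classic (exists i, i < length a /\ i < length b /\ rl a i <> rl b i)) as [[i Hi]|Q].
  - revert Hi. induction i as [i IH] using lt_wf_ind. intros (A & B & C).
    destruct (classic (exists j, j < i /\ rl a j <> rl b j)) as [(j & Hj & Nj)|E].
    + apply (IH j Hj). split; [lia|]. split; [lia|auto].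
    + assert (E' : forall j, j < i -> rl a j = rl b j).
      { intros j Hj. apply NNPP. intros Nj. apply E. eauto. }
      destruct (Nat.lt_trichotomy (rl a i) (rl b i)) as [L|[L|L]]; [|contradiction|].
      * left. right. exists i. auto.
      * right. right. exists i. split; auto. split; auto. split; auto. intros; symmetry; auto.
  - assert (E : forall i, i < length a -> i < length b -> rl a i = rl b i).
    { intros i A B. apply NNPP. intros C. apply Q. eauto. }
    destruct (Nat.lt_trichotomy (length a) (length b)) as [L|[L|L]].
    + right. left. split; auto. split; [lia|]. intros i Hi. symmetry. apply E; lia.
    + exfalso. apply N. rewrite <- (pre_rl a), <- (pre_rl b), <- L. apply pre_ext. intros; apply E; lia.
    + left. left. split; auto. split; [lia|]. intros i Hi. apply E; lia.
Qed.

Section KB.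
Variable T : list nat -> bool.
Hypothesis TC : tail_closed T.
Let R (a b : list nat) : Prop := T a = true /\ T b = true /\ kb a b = true.

(** Induction on [s] in the well-founded tree, and inside it on the entry [k] of a child: a node to
    the left of [k :: s] is either to the left of [s] or above a child with a smaller entry. *)
Lemma kb_acc_above s : Acc (child T) s -> T s = true ->
  (forall u, T u = true -> left_of u s -> Acc R u) ->
  forall u, T u = true -> sfx s u -> Acc R u.
Proof.
  intros A. induction A as [s _ IH]. intros Ts Left.
  assert (C : forall k, T (k :: s) = true -> forall u, T u = true -> sfx (k :: s) u -> Acc R u).
  { induction k as [k IHk] using lt_wf_ind. intros Tk. apply IH; auto; [exists k; auto|].
    intros u Tu (i & Iu & Is & Li & Ei). cbn [length] in Is.
    destruct (Nat.eq_dec i (length s)) as [->|N].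
    - rewrite rl_last in Li.
      assert (sfx (rl u (length s) :: s) u) as Su.
      { split; [cbn; lia|]. cbn [length]. intros j Hj. destruct (Nat.eq_dec j (length s)) as [->|].
        - now rewrite rl_last.
        - rewrite rl_cons by lia. rewrite Ei by lia. apply rl_cons. lia. }
      apply (IHk _ Li); auto. eapply tail_closed_sfx; eauto.
    - apply Left; auto. exists i. split; auto. split; [lia|]. rewrite rl_cons in Li by lia. split; auto.
      intros j Hj. rewrite Ei by auto. apply rl_cons. lia. }
  assert (C' : forall u, T u = true -> sfx s u -> length s < length u -> Acc R u).
  { intros u Tu [_ Su] L.
    assert (sfx (rl u (length s) :: s) u) as Su'.
    { split; [cbn; lia|]. cbn [length]. intros j Hj. destruct (Nat.eq_dec j (length s)) as [->|].
      - now rewrite rl_last.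
      - rewrite rl_cons by lia. apply Su. lia. }
    apply (C (rl u (length s))); auto. eapply tail_closed_sfx; eauto. }
  intros u Tu [Lu Su]. destruct (Nat.eq_dec (length u) (length s)) as [E|E].
  - assert (u = s) as ->.
    { rewrite <- (pre_rl u), <- (pre_rl s), E. apply pre_ext. auto. }
    constructor. intros v (Tv & _ & K). apply kb_spec in K as [[L Sv]|K]; auto.
  - apply C'; auto; [split; auto|lia].
Qed.

Lemma kb_wellorder : ~ (exists f, path T f) ->
  is_wellorder (fun x => T (dec x)) (fun x y => kb (dec x) (dec y)).
Proof.
  intros NP. split; [intros; apply kb_irrefl|]. split; [intros x y z _ _ _; apply kb_trans|].
  split; [intros x y _ _ N; apply kb_total; intros E; apply N; now apply dec_inj|].
  intros x Tx. destruct (path_or_wf T TC) as [P|W]; [contradiction|].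
  assert (AR : Acc R (dec x)).
  { assert (sfx [] (dec x)) as S0 by (split; cbn; lia).
    apply (kb_acc_above [] W); auto.
    - eapply tail_closed_sfx; eauto.
    - intros u _ (i & _ & L & _). cbn in L. lia. }
  clear Tx. remember (dec x) as a eqn:Ea. revert x Ea. induction AR as [a _ IH]. intros x ->.
  constructor. intros y (Ty & Tx & K). eapply (IH (dec y)); [split; auto|reflexivity].
Qed.
End KB.

(** * Comparison of well-orders *)

Definition olt (D : nat -> bool) (R : nat -> nat -> bool) (a b : nat) : Prop :=
  D a = true /\ D b = true /\ R a b = true.
Definition bisim (D : nat -> bool) (R : nat -> nat -> bool) (D' : nat -> bool) (R' : nat -> nat -> bool)
    (B : nat -> nat -> Prop) : Prop :=
  forall x u, B x u -> D x = true /\ D' u = true /\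
    (forall x', olt D R x' x -> exists u', olt D' R' u' u /\ B x' u') /\
    (forall u', olt D' R' u' u -> exists x', olt D R x' x /\ B x' u').
(** Equality of ranks without ordinals: the relation is the greatest bisimulation between the two
    orders. *)
Definition same_rank D R D' R' (x u : nat) : Prop := exists B, bisim D R D' R' B /\ B x u.

Lemma same_rank_bisim D R D' R' : bisim D R D' R' (same_rank D R D' R').
Proof.
  intros x u (B & HB & Bxu). destruct (HB x u Bxu) as (A1 & A2 & A3 & A4). split; auto. split; auto. split.
  - intros x' L. destruct (A3 x' L) as (u' & L' & B'). exists u'. split; auto. exists B; auto.
  - intros u' L. destruct (A4 u' L) as (x' & L' & B'). exists x'. split; auto. exists B; auto.
Qed.
Lemma same_rank_sym D R D' R' x u : same_rank D R D' R' x u -> same_rank D' R' D R u x.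
Proof.
  intros (B & HB & Bxu). exists (fun u x => B x u). split; auto. intros v y H.
  destruct (HB y v H) as (A1 & A2 & A3 & A4). auto.
Qed.

Section Compare.
Variables (D : nat -> bool) (R : nat -> nat -> bool) (D' : nat -> bool) (R' : nat -> nat -> bool).
Hypothesis W : is_wellorder D R.
Hypothesis W' : is_wellorder D' R'.
Let J := same_rank D R D' R'.

Lemma same_rank_functional x u v : J x u -> J x v -> u = v.
Proof.
  intros Hu Hv. pose proof (same_rank_bisim _ _ _ _ _ _ Hu) as (Dx & _).
  destruct W as (_ & _ & _ & A). specialize (A x Dx). revert u v Hu Hv.
  induction A as [x _ IH]. intros u v Hu Hv.
  destruct (same_rank_bisim _ _ _ _ _ _ Hu) as (_ & Du & Fu & Bu).
  destruct (same_rank_bisim _ _ _ _ _ _ Hv) as (_ & Dv & Fv & Bv).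
  destruct W' as (I' & _ & T' & _).
  apply NNPP. intros N. destruct (T' u v Du Dv N) as [L|L].
  - destruct (Bv u) as (x' & Lx & Jx); [repeat split; auto|].
    destruct (Fu x' Lx) as (u' & Lu & Ju). assert (u' = u) by (eapply IH; eauto; apply Lx).
    subst. destruct Lu as (_ & _ & Lu). rewrite I' in Lu; [discriminate|auto].
  - destruct (Bu v) as (x' & Lx & Jx); [repeat split; auto|].
    destruct (Fv x' Lx) as (u' & Lu & Ju). assert (u' = v) by (eapply IH; eauto; apply Lx).
    subst. destruct Lu as (_ & _ & Lu). rewrite I' in Lu; [discriminate|auto].
Qed.
Lemma same_rank_mono x y u v : J x u -> J y v -> olt D R x y -> olt D' R' u v.
Proof.
  intros Hu Hv L. destruct (same_rank_bisim _ _ _ _ _ _ Hv) as (_ & _ & F & _).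
  destruct (F x L) as (u' & L' & J'). now rewrite (same_rank_functional x u u').
Qed.

Lemma wf_least (E : nat -> bool) (S : nat -> nat -> bool) (P : nat -> Prop) : is_wellorder E S ->
  (exists x, E x = true /\ P x) -> exists x, E x = true /\ P x /\ forall y, olt E S y x -> ~ P y.
Proof.
  intros (_ & _ & _ & A) (x & Ex & Px). specialize (A x Ex). revert Px. induction A as [x _ IH]. intros Px.
  destruct (classic (exists y, olt E S y x /\ P y)) as [(y & L & Py)|N].
  - apply (IH y); auto. apply L.
  - exists x. split; auto. split; auto. intros y L Py. apply N. eauto.
Qed.

(** Take the least [x0] without partner. If some element of the other order had no partner below
    [x0], the least such [u0] could be matched with [x0] and the bisimulation extended by this
    pair. *)
Lemma wellorder_comparison : (forall x, D x = true -> exists u, J x u) \/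
  exists x0, D x0 = true /\ (forall x, olt D R x x0 -> exists u, J x u) /\ forall u, D' u = true -> exists x, olt D R x x0 /\ J x u.
Proof.
  destruct (classic (forall x, D x = true -> exists u, J x u)) as [H|H]; auto. right.
  destruct (wf_least D R (fun x => ~ exists u, J x u) W) as (x0 & D0 & N0 & M0).
  { apply not_all_ex_not in H as [x H]. apply imply_to_and in H. eauto. }
  exists x0. split; auto. split; [intros x L; now apply NNPP, M0|]. apply NNPP. intros N.
  destruct (wf_least D' R' (fun u => ~ exists x, olt D R x x0 /\ J x u) W') as (u0 & D0' & N0' & M0').
  { apply not_all_ex_not in N as [u N]. apply imply_to_and in N. eauto. }
  apply N0. exists u0. exists (fun x u => J x u \/ (x = x0 /\ u = u0)). split; auto.
  intros x u [Jxu|[-> ->]].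
  - destruct (same_rank_bisim _ _ _ _ _ _ Jxu) as (A1 & A2 & A3 & A4). split; auto. split; auto. split.
    + intros x' L. destruct (A3 x' L) as (u' & L' & J'). exists u'; auto.
    + intros u' L. destruct (A4 u' L) as (x' & L' & J'). exists x'; auto.
  - split; auto. split; auto. split.
    + intros x' L. specialize (M0 x' L). apply NNPP in M0 as [u' J'].
      destruct (same_rank_bisim _ _ _ _ _ _ J') as (_ & Du' & _ & B).
      exists u'. split; [|left; exact J'].
      destruct W' as (_ & _ & T' & _). destruct (Nat.eq_dec u' u0) as [->|Nu].
      { exfalso. apply N0'. eauto. }
      destruct (T' u' u0 Du' D0' Nu) as [Q|Q]; [repeat split; auto|].
      exfalso. apply N0'. destruct (B u0) as (x'' & L'' & J''); [repeat split; auto|].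
      exists x''. split; [|exact J'']. destruct W as (_ & T & _ & _).
      destruct L as (L1 & _ & L3), L'' as (K1 & _ & K3). repeat split; auto. eapply (T x'' x'); eauto.
    + intros u' L. specialize (M0' u' L). apply NNPP in M0' as (x' & L' & J'). exists x'. split; auto.
Qed.
End Compare.

Lemma restricted_wellorder D R x0 : is_wellorder D R -> is_wellorder (fun x => D x && R x x0) R.
Proof.
  intros (A1 & A2 & A3 & A4). split; [|split; [|split]].
  - intros x H. apply andb_true_iff in H. now apply A1.
  - intros x y z Hx Hy Hz. apply andb_true_iff in Hx, Hy, Hz. now apply A2.
  - intros x y Hx Hy. apply andb_true_iff in Hx, Hy. now apply A3.
  - intros x H. apply andb_true_iff in H as [H _]. specialize (A4 x H). clear H. induction A4 as [x _ IH].
    constructor. intros y (Hy & Hx & L). apply IH. apply andb_true_iff in Hx, Hy. tauto.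
Qed.

Lemma embeds_or_copies D R DW RW : is_wellorder D R -> is_wellorder DW RW ->
  (exists J : nat -> nat -> Prop, (forall x, D x = true -> exists u, J x u) /\
     forall x y u v, J x u -> J y v -> olt D R x y -> olt DW RW u v) \/
  (exists x0, order_iso DW RW (fun x => D x && R x x0) R).
Proof.
  intros W W'. destruct (wellorder_comparison D R DW RW W W') as [H|(x0 & Dx0 & D0 & H)].
  - left. exists (same_rank D R DW RW). split; auto. intros x y u v. now apply same_rank_mono.
  - right. exists x0.
    assert (F : forall u, exists x, DW u = true -> olt D R x x0 /\ same_rank D R DW RW x u).
    { intros u. destruct (classic (DW u = true)) as [Du|N]; [|exists 0; contradiction].
      destruct (H u Du) as [x Hx]. eauto. }
    apply choice in F as [f Hf]. exists f. split; [|split].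
    + intros u Du. destruct (Hf u Du) as [(A & _ & B) _]. now rewrite A, B.
    + intros x Hx. apply andb_true_iff in Hx as [Dx Lx].
      destruct (D0 x) as [u Ju]; [repeat split; auto|].
      pose proof (same_rank_bisim _ _ _ _ _ _ Ju) as (_ & Du & _). exists u. split; auto.
      destruct (Hf u Du) as [_ J']. apply same_rank_sym in J'. apply same_rank_sym in Ju.
      now apply (same_rank_functional DW RW D R W' W u).
    + intros u v Du Dv. destruct (Hf u Du) as [Lu Ju], (Hf v Dv) as [Lv Jv]. split; intros L.
      * apply same_rank_sym in Ju. apply same_rank_sym in Jv.
        apply (same_rank_mono DW RW D R W' W _ _ _ _ Ju Jv). repeat split; auto.
      * apply (same_rank_mono D R DW RW W W' _ _ _ _ Ju Jv). destruct Lu as (A & _), Lv as (B & _).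
        repeat split; auto.
Qed.

(** * The ordinal clause *)

Definition Cset (p : nat -> bool) : Prop := CB (fun ne => p (ne 0)).
Definition Crel (r : nat -> nat -> bool) : Prop := CB (fun ne => r (ne 0) (ne 1)).
Lemma Cset_computable O p : Cset p -> computable_set_in O p.
Proof. intros (e & N & H & _). exists e. intros n. apply (H O [n]). Qed.
Lemma Crel_computable O r : Crel r -> computable_rel_in O r.
Proof. intros (e & N & H & _). exists e. intros x y. apply (H O [x; y]). Qed.

Lemma CB_kb a b : Cmp a -> Cmp b -> CB (fun ne => kb (dec (a ne)) (dec (b ne))).
Proof.
  apply (Cmp_comp2 (fun a b => b2n (kb (dec a) (dec b)))). unfold kb. cmp.
Qed.

Definition diag_tree (n : nat) : list nat -> bool := Tr (cpair n n) emptyset.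
Lemma diag_tail n : tail_closed (diag_tree n).
Proof. intros a l. apply Tr_tail. Qed.

(** A Sigma^1_1 definition [phi], evaluated at its own code, would say of its own tree both that it
    has a path and that it has none. *)
Lemma diagonal_not_sigma11 O : (forall n, O n = true <-> ~ exists f, path (diag_tree n) f) ->
  ~ sigma11_in emptyset O.
Proof.
  intros HO [phi H]. specialize (H (cF phi)). rewrite HO, Tr_iff in H. unfold diag_tree in H. tauto.
Qed.

Section Spector.
Variables (G DW : nat -> bool) (RW : nat -> nat -> bool) (O : nat -> bool).
Hypothesis HO : forall n, O n = true <-> ~ exists f, path (diag_tree n) f.
Hypothesis HW : computable_wellorder_in G DW RW.
Hypothesis long : ~ exists D' R', computable_wellorder_in emptyset D' R' /\ order_iso DW RW D' R'.

(** The Kleene-Brouwer order of a well-founded diagonal tree is computable. If it did not embed, the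
    order [DW] would be isomorphic to a proper initial segment of it, which is computable as well,
    against [long]. *)
Lemma diag_embeds n : O n = true -> exists J : nat -> nat -> Prop,
  (forall x, diag_tree n (dec x) = true -> exists u, J x u) /\
  forall x y u v, J x u -> J y v ->
    olt (fun x => diag_tree n (dec x)) (fun x y => kb (dec x) (dec y)) x y -> olt DW RW u v.
Proof.
  intros On. apply HO in On. destruct HW as (_ & _ & W).
  pose proof (kb_wellorder (diag_tree n) (diag_tail n) On) as WL.
  destruct (embeds_or_copies _ _ _ _ WL W) as [H|[x0 H]]; auto.
  exfalso. apply long. eexists _, _. split; [|apply H]. split; [|split].
  - apply Cset_computable. apply CB_andb.
    + apply (CB_Tr (fun _ => cpair n n) (fun _ => 0)); cmp.
    + apply (CB_kb (fun ne => ne 0) (fun _ => x0)); cmp.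
  - apply Crel_computable. apply (CB_kb (fun ne => ne 0) (fun ne => ne 1)); cmp.
  - exact (restricted_wellorder _ _ x0 WL).
Qed.

(** A path of the tree descends in the Kleene-Brouwer order, and its image would descend in a
    well-order. *)
Lemma embeds_diag n (J : nat -> nat -> Prop) :
  (forall x, diag_tree n (dec x) = true -> exists u, J x u) ->
  (forall x y u v, J x u -> J y v ->
    olt (fun x => diag_tree n (dec x)) (fun x y => kb (dec x) (dec y)) x y -> olt DW RW u v) ->
  O n = true.
Proof.
  intros T M. apply HO. intros [f P]. destruct HW as (_ & _ & _ & _ & _ & A).
  set (x := fun k => enc (pre f k)).
  assert (L : forall k, olt (fun x => diag_tree n (dec x)) (fun x y => kb (dec x) (dec y)) (x (S k)) (x k)).
  { intros k. unfold x. split; [rewrite dec_enc; apply P|]. split; [rewrite dec_enc; apply P|].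
    rewrite !dec_enc. apply kb_spec. left. rewrite !length_pre. split; [lia|]. apply sfx_pre_le. lia. }
  assert (N : forall u, Acc (olt DW RW) u -> forall k, ~ J (x k) u).
  { intros u Au. induction Au as [u _ IH]. intros k Jk.
    destruct (T (x (S k))) as [v Jv]; [apply (L k)|].
    apply (IH v) with (k := S k); auto. apply (M (x (S k)) (x k)); auto. }
  destruct (T (x 0)) as [u J0]; [apply (L 0)|]. destruct (T (x 1)) as [v J1]; [apply (L 1)|].
  apply (N u) with (k := 0); auto. apply A. apply (M _ _ _ _ J1 J0 (L 0)).
Qed.

(** Membership in [O] is the existence of an embedding into the [G]-computable order, non-membership
    is the existence of a path; both are Sigma^1_1 in [G]. *)
Lemma diag_hyp : hyp_in G O.
Proof.
  destruct HW as ([eD HD] & [eR HR] & _).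
  assert (KR : forall u v, eval G eR (dec (S (cpair u (S (cpair v 0))))) 1 <-> RW u v = true).
  { intros u v. rewrite !dec_S, !p2_pair, !p1_pair, dec_S, p1_pair, p2_pair, dec_0. specialize (HR u v). split.
    - intros H. pose proof (eval_functional _ _ _ _ _ H HR). destruct (RW u v); auto; discriminate.
    - intros E. now rewrite E in HR. }
  assert (KD : forall u, eval G eD (dec (S (cpair u 0))) 1 <-> DW u = true).
  { intros u. rewrite !dec_S, p2_pair, p1_pair, dec_0. specialize (HD u). split.
    - intros H. pose proof (eval_functional _ _ _ _ _ H HD). destruct (DW u); auto; discriminate.
    - intros E. now rewrite E in HD. }
  split.
  - apply sigma11_intro with (P := fun ne X H =>
      (forall x, Tr (cpair (ne 0) (ne 0)) (memb (dec 0)) (dec x) = true -> exists u, X (cpair x u) = true) /\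
      (forall x y u v, X (cpair x u) = true -> X (cpair y v) = true ->
         (Tr (cpair (ne 0) (ne 0)) (memb (dec 0)) (dec x) = true /\
          Tr (cpair (ne 0) (ne 0)) (memb (dec 0)) (dec y) = true /\ kb (dec x) (dec y) = true) ->
         eval H eD (dec (S (cpair u 0))) 1 /\ eval H eD (dec (S (cpair v 0))) 1 /\
         eval H eR (dec (S (cpair u (S (cpair v 0))))) 1)).
    { repeat first [progress rdef | apply RDef_eval | apply CB_kb]. }
    intros n. cbn [ncons]. rewrite <- emptyset_memb. split.
    + intros On. destruct (diag_embeds n On) as (J & T & M).
      destruct (set_of (fun z => J (p1 z) (p2 z))) as [X HX]. exists X. split.
      * intros x Tx. destruct (T x Tx) as [u Ju]. exists u. apply HX. now rewrite p1_pair, p2_pair.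
      * intros x y u v Jx Jy L. apply HX in Jx, Jy. rewrite p1_pair, p2_pair in Jx, Jy.
        rewrite !KD, KR. apply (M x y u v Jx Jy L).
    + intros (X & T & M). apply (embeds_diag n (fun x u => X (cpair x u) = true) T).
      intros x y u v Jx Jy L. specialize (M x y u v Jx Jy L). now rewrite !KD, KR in M.
  - apply sigma11_intro with (P := fun ne X H => exists l, sfx (dec 0) (dec l) /\ 0 <= l /\ X l = true /\
      forall l', X l' = true -> Tr (cpair (ne 0) (ne 0)) (memb (dec 0)) (dec l') = true /\
        exists a, X (S (cpair a l')) = true).
    { rdef. }
    intros n. cbn [ncons]. rewrite negb_true_iff, <- not_true_iff_false, HO.
    pose proof (through_coded (diag_tree n) [] (fun _ => True) (diag_tail n)) as TCd.
    split.
    + intros N. apply NNPP in N as [f P]. destruct TCd as [_ TCd]; auto.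
      destruct TCd as (X & l & A & _ & B & C); [exists f, 0; split; auto; split; auto|].
      exists X, l. rewrite <- emptyset_memb, dec_0. split; auto. split; [lia|]. auto.
    + intros (X & l & A & _ & B & C) N. apply N. destruct TCd as [TCd _]; auto.
      destruct TCd as (f & _ & [P _] & _); eauto. exists X, l. rewrite dec_0 in A. auto.
Qed.
End Spector.

(** The empty oracle always answers 0, so its queries are replaced by the constant program
    [pzero]. *)
Lemma eval_oracle_free e : exists e', forall O xs y, eval emptyset e xs y -> eval O e' xs y.
Proof.
  induction e as [| |i| |f gs [f' IHf] IHgs|f g [f' IHf] [g' IHg]|f [f' IHf]] using prf_ind_list.
  - exists pzero. intros O xs y H. inversion H; constructor.
  - exists psucc. intros O xs y H. inversion H; constructor.
  - exists (pproj i). intros O xs y H. inversion H; constructor.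
  - exists pzero. intros O xs y H. inversion H; constructor.
  - assert (exists gs', forall O xs ys, evals emptyset gs xs ys -> evals O gs' xs ys) as [gs' Hgs].
    { induction IHgs as [|g gs [g' Hg] _ [gs' IH]].
      - exists []. intros O xs ys H. inversion H; constructor.
      - exists (g' :: gs'). intros O xs ys H. inversion H; constructor; auto. }
    exists (pcomp f' gs'). intros O xs y H. inversion H; econstructor; eauto.
  - exists (pprec f' g'). intros O xs. destruct xs as [|n t]; [intros y H; inversion H|].
    induction n as [|n IHn]; intros y H; inversion H; subst.
    + constructor. auto.
    + econstructor; eauto.
  - exists (pmu f'). intros O xs y H. apply eval_mu in H as [A B]. constructor; auto.
    intros m L. destruct (B m L) as [k Hk]. eauto.
Qed.
Lemma ordinals_below_empty G : ordinals_below emptyset G.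
Proof.
  intros D R ([eD HD] & [eR HR] & W). exists D, R. split.
  - destruct (eval_oracle_free eD) as [eD' HD'], (eval_oracle_free eR) as [eR' HR'].
    split; [exists eD'; auto|]. split; [exists eR'; auto|auto].
  - exists (fun x => x). split; auto. split; [eauto|]. reflexivity.
Qed.

Theorem theorem4 (B : nat -> bool) (hB : ~ hyperarithmetical B) (A : nat -> bool) :
  exists H : nat -> bool,
    infinite_set H /\
    ((forall n, H n = true -> A n = true) \/ (forall n, H n = true -> A n = false)) /\
    ~ hyp_in H B /\
    omega1_eq H emptyset.
Proof.
  destruct (set_of (fun n => ~ exists f, path (diag_tree n) f)) as [O HO].
  (* Both sets are avoided at once: [B] for the main claim, and [O] because it would become
     Delta^1_1 in [G] if some [G]-computable well-order had no computable copy. *)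
  destruct (cone_avoidance (fun j => match j with 0 => B | S _ => O end) A) as (G & i & I & GA & NG).
  { intros [|j]; auto. intros [S _]. now apply (diagonal_not_sigma11 O HO). }
  exists G. split; auto. split; [destruct i; auto|]. split; [apply (NG 0)|].
  split; [|apply ordinals_below_empty].
  intros D R W. apply NNPP. intros N. apply (NG 1). eapply diag_hyp; eauto.
Qed.
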